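(* Fix an integer $k\ge 0$ and constants $C>0$, $\delta>0$, $M>0$, $\sigma>0$. For each $n$, let $x_i=i/n$, $i=1,\ldots,n$, and let $y\in\mathbb{R}^n$ be drawn from the model $y_i=f_0(x_i)+\varepsilon_i$, $i=1,\ldots,n$, where $\varepsilon_1,\ldots,\varepsilon_n$ are i.i.d. with $\mathbb{E}[\varepsilon_i]=0$ and $\mathbb{P}(|\varepsilon_i|>t)\le M\exp(-t^2/(2\sigma^2))$ for all $t>0$. Assume that $f_0\in\mathcal{F}_k(C)$, i.e. $f_0:[0,1]\to\mathbb{R}$ is $k$ times weakly differentiable and $\mathrm{TV}(f_0^{(k)})\le C$. Let $\hat f$ denote the $k$th order locally adaptive regression spline estimate with tuning parameter $\lambda=\Theta(n^{1/(2k+3)})$, and let $\hat\beta$ denote the $k$th order trend filtering estimate with tuning parameter $(1+\delta)\lambda$. Then, as $n\to\infty$, $$\frac1n\sum_{i=1}^n\bigl(\hat\beta_i-\hat f(x_i)\bigr)^2=O_{\mathbb{P}}\bigl(n^{-(2k+2)/(2k+3)}\bigr).$$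
   Context: Total variation: $\mathrm{TV}(f)=\sup\{\sum_{i=1}^{p-1}|f(z_{i+1})-f(z_i)| : z_1<\cdots<z_p \text{ a partition of }[0,1]\}$. $f^{(k)}$ denotes the $k$th weak derivative of $f$ ($f^{(0)}=f$). $A_n=O_{\mathbb P}(B_n)$ means $A_n/B_n$ is bounded in probability; $a_n=\Theta(b_n)$ means $a_n=O(b_n)$ and $b_n=O(a_n)$. Trend filtering: the discrete difference operators are defined by $D^{(1)}$ with $(D^{(1)}\beta)_i=\beta_{i+1}-\beta_i$ (of size $(m-1)\times m$ when acting on $\mathbb{R}^m$), and recursively $D^{(k+1)}=D^{(1)}D^{(k)}\in\mathbb{R}^{(n-k-1)\times n}$, where here $D^{(1)}$ has size $(n-k-1)\times(n-k)$. The $k$th order trend filtering estimate with tuning parameter $\mu\ge0$ is the unique minimizer $$\hat\beta=\operatorname{argmin}_{\beta\in\mathbb{R}^n}\ \tfrac12\|y-\beta\|_2^2+\frac{n^k}{k!}\,\mu\,\|D^{(k+1)}\beta\|_1 .$$ Locally adaptive regression splines: let $T=\{x_{k/2+2},\ldots,x_{n-k/2}\}$ if $k$ is even and $T=\{x_{(k+1)/2+1},\ldots,x_{n-(k+1)/2}\}$ if $k$ is odd (so $T$ has $n-k-1$ elements). Let $\mathcal{G}_k$ be the set of functions $f:[0,1]\to\mathbb{R}$ that are $k$th degree splines with knots contained in $T$ (piecewise polynomials of degree $k$ with continuous derivatives of orders $0,\ldots,k-1$ at the knots; $k$th derivatives, and the functions themselves when $k=0$, are taken right-continuous). The $k$th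 order locally adaptive regression spline estimate with tuning parameter $\lambda\ge0$ is $$\hat f=\operatorname{argmin}_{f\in\mathcal{G}_k}\ \tfrac12\sum_{i=1}^n(y_i-f(x_i))^2+\lambda\,\mathrm{TV}(f^{(k)}).$$ *)

(* Defs.v *)
From HB Require Import structures.
From mathcomp Require Import all_boot all_order all_algebra.
From mathcomp Require Import all_classical all_reals all_analysis.

Set Implicit Arguments.
Unset Strict Implicit.
Unset Printing Implicit Defensive.

Import Order.TTheory GRing.Theory Num.Theory.
Import numFieldNormedType.Exports.

Local Open Scope classical_set_scope.
Local Open Scope ring_scope.

(* Tests of class C^1 rather than C^oo: for locally integrable functions both
   classes define the same first-order weak derivative. *)
Definition test_function (R : realType) (phi : R -> R) : Prop :=
  [/\ forall x, derivable phi x 1,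
      continuous (phi^`())%classic &
      exists2 K : set R, compact K /\ K `<=` `]0, 1[ &
        forall x, ~ K x -> phi x = 0].

Definition weak_derivative (R : realType) (f g : R -> R) : Prop :=
  [/\ locally_integrable `]0, 1[ f,
      locally_integrable `]0, 1[ g &
      forall phi : R -> R, test_function phi ->
        \int[lebesgue_measure]_(x in `]0, 1[) (f x * (phi^`())%classic x) =
        - \int[lebesgue_measure]_(x in `]0, 1[) (g x * phi x)].

(* g is a representative of the k-th weak derivative of f, obtained by
   differentiating k times; for k = 0 it is f itself, pointwise on [0, 1]. *)
Fixpoint weak_derivativen (R : realType) (k : nat) (f g : R -> R) : Prop :=
  if k is k'.+1 then
    exists2 h, weak_derivative f h & weak_derivativen k' h g
  else forall x, x \in `[0, 1] -> f x = g x.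

(* A weakly differentiable function is only defined up to a null set, but its
   values at the design points matter: for k > 0 it is identified with its
   continuous representative.  Likewise TV of a k-th weak derivative is at most
   C when some representative g has pointwise total variation at most C. *)
Definition bv_class (R : realType) (k : nat) (C : R) (f : R -> R) : Prop :=
  ((0 < k)%N -> {within `[0, 1], continuous f}) /\
  exists2 g, weak_derivativen k f g & (total_variation 0 1 g <= C%:E)%E.

(* x_(i+1) = (i+1)/n: 'I_n is indexed from 0. *)
Definition design (R : realType) (n : nat) (i : 'I_n) : R := i.+1%:R / n%:R.

(* The m.-1 x m first-difference matrix. *)
Definition diff1_mx (R : realType) (m : nat) : 'M[R]_(m.-1, m) :=
  \matrix_(i < m.-1, j < m)
    ((nat_of_ord j == i.+1)%:R - (nat_of_ord j == i)%:R).

(* The number of rows is n - k, written iter k predn n so that the recursive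
   product typechecks without a cast; the order 0 operator is the identity. *)
Fixpoint diff_mx (R : realType) (n k : nat) : 'M[R]_(iter k predn n, n) :=
  if k is k'.+1 then diff1_mx R (iter k' predn n) *m diff_mx R n k'
  else 1%:M.

Definition tf_objective (R : realType) (k n : nat) (mu : R) (y beta : 'cV[R]_n)
    : R :=
  2^-1 * \sum_(i < n) (y i 0 - beta i 0) ^+ 2 +
  n%:R ^+ k / k`!%:R * mu *
    \sum_(i < iter k.+1 predn n) `|(diff_mx R n k.+1 *m beta) i 0|.

Definition is_trend_filter (R : realType) (k n : nat) (mu : R)
    (y beta : 'cV[R]_n) : Prop :=
  forall beta' : 'cV[R]_n, tf_objective k mu y beta <= tf_objective k mu y beta'.

(* Increasing list of the knots; for k = 0 the last one is x_n = 1. *)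
Definition knots (R : realType) (k n : nat) : seq R :=
  [seq i%:R / n%:R | i <- if odd k
     then index_iota (k.+1)./2.+1 (n - (k.+1)./2).+1
     else index_iota (k./2 + 2) (n - k./2).+1].

(* Pieces are numbered from 0 and are closed on the left: piece j of [0, 1] is
   [T_(j-1), T_j[, and the last one is closed on the right as well. *)
Definition piece (R : realType) (T : seq R) (x : R) : nat :=
  count (fun t => t <= x) T.

(* f is on [0, 1] a spline of degree k with knots in T, with polynomial pieces
   P j, and g is its k-th derivative, right-continuous at the knots. *)
Definition spline_with_derivative (R : realType) (k : nat) (T : seq R)
    (f g : R -> R) : Prop :=
  exists P : nat -> {poly R},
  [/\ forall j, (j <= size T)%N -> (size (P j) <= k.+1)%N,
      forall j i, (j < size T)%N -> (i < k)%N ->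
        ((P j)^`(i)).[T`_j] = ((P j.+1)^`(i)).[T`_j] &
      forall x, x \in `[0, 1] ->
        f x = (P (piece T x)).[x] /\ g x = ((P (piece T x))^`(k)).[x]].

(* g stands for the k-th derivative of f. *)
Definition spline_objective (R : realType) (n : nat) (lambda : R)
    (y : 'cV[R]_n) (f g : R -> R) : \bar R :=
  ((2^-1 * \sum_(i < n) (y i 0 - f (design R i)) ^+ 2)%:E +
   lambda%:E * total_variation 0 1 g)%E.

Definition is_adaptive_spline (R : realType) (k n : nat) (lambda : R)
    (y : 'cV[R]_n) (f : R -> R) : Prop :=
  exists2 g, spline_with_derivative k (knots R k n) f g &
  forall f' g', spline_with_derivative k (knots R k n) f' g' ->
    (spline_objective lambda y f g <= spline_objective lambda y f' g')%E.

Definition mutually_independent (R : realType) (d : measure_display)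
    (Omega : measurableType d) (P : probability Omega R) (I : finType)
    (X : I -> {RV P >-> R}) : Prop :=
  forall (J : {set I}) (A : I -> set R), (forall i, measurable (A i)) ->
    P (\bigcap_(i in [set` J]) (X i @^-1` A i)) =
    (\prod_(i in J) P (X i @^-1` A i))%E.

Definition identically_distributed (R : realType) (d : measure_display)
    (Omega : measurableType d) (P : probability Omega R) (I : finType)
    (X : I -> {RV P >-> R}) : Prop :=
  forall (i j : I) (A : set R), measurable A ->
    P (X i @^-1` A) = P (X j @^-1` A).

(* A_n = O_P(B_n).  The event |A_n / B_n| > K is required to lie in a measurable
   event of probability at most e, i.e. to have outer probability at most e;
   for measurable A_n this is the usual P(|A_n / B_n| > K) <= e. *)
Definition bigO_prob (R : realType) (d : nat -> measure_display)
    (Omega : forall n, measurableType (d n))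
    (P : forall n, probability (Omega n) R)
    (A : forall n, Omega n -> R) (B : nat -> R) : Prop :=
  forall e : R, 0 < e -> exists K : R, \forall n \near \oo,
    exists2 E : set (Omega n), measurable E /\ (P n E <= e%:E)%E &
      forall w, K < `|A n w / B n| -> E w.

(* Main.v *)
(** Put L = n^(1/(2k+3)) and J(v) = n^k * sum |D^(k+1) v|.  Both estimates minimize a
    quadratic loss plus a penalty comparable to L * J, so it is enough to bound the
    noise: for every c > 0, there is a random F with E F = O(L) such that, for all
    vectors v at once,
      <eps, v> <= |v|^2 / 4 + c L J(v) + F.
    The basic inequality then puts both estimates at squared distance O_P(L) from
    the vector theta of values of f0, for which J(theta) is bounded.

    For the noise bound, cut the design into blocks of length about n / L.  On a block
    of length b with partial sums of the noise at most N, summation by parts gives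
    <eps, v> <= N (sup |v| + sum |D v|), which a discrete interpolation inequality
    bounds by N (b^(-1) sum |v| + b^k sum |D^(k+1) v|) up to constants.  This is good
    enough when N is at most a fixed threshold; otherwise the block is halved.  Since
    E N^6 = O(b^3), the expected cost of all cuts remains summable.

    The spline estimate competes only with splines with knots in T, so theta is first
    replaced with the values of such a spline f*, obtained from the discrete Taylor
    expansion of theta; it satisfies TV(f*^(k)) <= J(theta) and is O(1/n) away. *)
Require Import Defs.
From HB Require Import structures.
From mathcomp Require Import all_boot all_order all_algebra.
From mathcomp Require Import all_classical all_reals all_analysis.
From mathcomp Require Import measurable_realfun.
From mathcomp Require Import ring lra zify.

Set Implicit Arguments.
Unset Strict Implicit.
Unset Printing Implicit Defensive.

Import Order.TTheory GRing.Theory Num.Theory.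
Import numFieldNormedType.Exports.

Local Open Scope classical_set_scope.
Local Open Scope ring_scope.

(** * Finite differences *)

(** The exponent 1/(2k+3) is the one that balances threshold and noise. Interpolation on a block of
    length b0 is affordable while 2 N b0^k is at most c L n^k. With b0 of order n/L and L^(2k+3) =
    n, this allows N up to order L^(k+1), which is the order of sqrt(b0), the typical size of the
    partial sums. Hence each of the roughly L blocks costs O(1) on average. The threshold tau stays
    fixed under halving. On a block of length b, the cost N^2/b on the event N > tau is at most
    N^6/(b tau^4), of mean O(b^2/tau^4). Level j has 2^j blocks of length about b0/2^j, so its cost
    decays like 2^(-j). With fourth moments all levels would cost the same; six is the next even
    exponent. Since F depends on the noise only, the bound holds for all v at once, and halving
    takes the place of chaining over a function class. A second obstacle is that f0 is known only
    through its weak derivatives, whereas J(theta) involves its values. Differences of truncated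
    powers supply test functions whose derivatives are again of this kind. *)

Definition sdiff {R : realFieldType} (h : nat) (v : nat -> R) : nat -> R :=
  fun i => v (i + h)%N - v i.

Notation D1 := (sdiff 1).

Lemma ler_sum_widen {R : realFieldType} (F : nat -> R) a b :
  (forall i, 0 <= F i) -> (a <= b)%N -> \sum_(i < a) F i <= \sum_(i < b) F i.
Proof.
move=> F0 /subnKC <-; rewrite (@big_split_ord _ _ _ a (b - a)) /=.
by rewrite lerDl sumr_ge0.
Qed.

Lemma sdiffC {R : realFieldType} h h' (v : nat -> R) :
  sdiff h (sdiff h' v) = sdiff h' (sdiff h v).
Proof.
by apply/funext => i; rewrite /sdiff (addnAC i h h'); ring.
Qed.

Lemma iter_sdiffC {R : realFieldType} j h h' (v : nat -> R) :
  iter j (sdiff h) (sdiff h' v) = sdiff h' (iter j (sdiff h) v).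
Proof. by elim: j => //= j ->; rewrite sdiffC. Qed.

Lemma sdiff_telescope {R : realFieldType} h (v : nat -> R) x :
  sdiff h v x = \sum_(s < h) D1 v (x + s)%N.
Proof.
elim: h => [|h IH]; first by rewrite big_ord0 /sdiff addn0 subrr.
by rewrite big_ord_recr /= -IH /sdiff addn1 addnS; ring.
Qed.

(** A step-[h] difference is a sum of [h] consecutive unit differences. Iterating it [j] times
    therefore sums [h ^ j] values of the unit difference of order [j], all inside the window of the
    hypothesis. *)
Lemma ler_iter_sdiff {R : realFieldType} j h (u : nat -> R) m x :
  (forall i, (x <= i)%N -> (i + j <= x + j * h)%N -> m <= iter j D1 u i) ->
  m * h%:R ^+ j <= iter j (sdiff h) u x.
Proof.
elim: j u m => [|j IH] u m um.
  by rewrite expr0 mulr1; apply: um => //; rewrite addn0 mul0n addn0.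
rewrite iterSr exprS mulrA; apply: IH => i xi ix.
rewrite iter_sdiffC sdiff_telescope -[h in _ * h%:R]card_ord mulrC mulr_natl.
rewrite -sumr_const; apply: ler_sum => s _; rewrite -iterS; apply: um.
  exact: leq_trans xi (leq_addr _ _).
have := ltn_ord s; rewrite mulSn; lia.
Qed.

Lemma sum_norm_iter_sdiff {R : realFieldType} j h (u : nat -> R) :
  \sum_(x < h) `|iter j (sdiff h) u x|
    <= 2 ^+ j * \sum_(x < j.+1 * h) `|u x|.
Proof.
elim: j u => [|j IH] u; first by rewrite expr0 mul1r mul1n.
under eq_bigr do rewrite iterSr.
apply: (le_trans (IH _)); rewrite exprSr -mulrA.
rewrite ler_pM2l ?exprn_gt0//.
have -> : 2 * \sum_(x < j.+2 * h) `|u x|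
    = \sum_(x < j.+2 * h) `|u x| + \sum_(x < j.+2 * h) `|u x| by ring.
apply: (@le_trans _ _
  (\sum_(x < j.+1 * h) (`|u (x + h)%N| + `|u x|))).
  by apply: ler_sum => x _; rewrite /sdiff ler_normB.
rewrite big_split /=; apply: lerD.
  rewrite [(j.+2 * h)%N]mulSn (@big_split_ord _ _ _ h (j.+1 * h)) /=.
  under [X in _ <= _ + X]eq_bigr do rewrite addnC.
  by rewrite lerDr sumr_ge0.
rewrite [(j.+2 * h)%N]mulSnr (@big_split_ord _ _ _ (j.+1 * h) h) /=.
by rewrite lerDl sumr_ge0.
Qed.

(** The differences of order [j] with the wide step [h], about [b / j.+1], are at least [m * h ^ j]
    at each of [h] starting points, while their sum is at most [2 ^ j] times the sum of |u|.
    Rounding [h] down costs a factor 2 at most, hence the constant [2 * j.+1]. *)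
Lemma min_iter_diff_le {R : realFieldType} j b (u : nat -> R) m :
  (j < b)%N -> 0 <= m ->
  (forall i, (i < b - j)%N -> m <= iter j D1 u i) ->
  m * b%:R ^+ j.+1
    <= 2 ^+ j * (2 * j.+1)%:R ^+ j.+1 * \sum_(i < b) `|u i|.
Proof.
move=> jb m0 um; pose h := (b %/ j.+1)%N.
have hb : (j.+1 * h <= b)%N by rewrite mulnC leq_trunc_div.
have h0 : (0 < h)%N by rewrite divn_gt0.
have bh : (b <= 2 * j.+1 * h)%N.
  have := divn_eq b j.+1; have := ltn_pmod b (ltn0Sn j); rewrite -/h; nia.
have key : h%:R * (m * h%:R ^+ j) <= 2 ^+ j * \sum_(i < b) `|u i|.
  apply: (@le_trans _ _ (\sum_(x < h) `|iter j (sdiff h) u x|)).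
    rewrite -[h in h%:R * _]card_ord mulr_natl -sumr_const.
    apply: ler_sum => x _; apply: le_trans (ler_norm _).
    apply: ler_iter_sdiff => i xi ix; apply: um.
    have := ltn_ord x; move: hb ix; rewrite mulSn; lia.
  apply: (le_trans (sum_norm_iter_sdiff _ _ _)).
  rewrite ler_pM2l ?exprn_gt0//.
  exact: (@ler_sum_widen _ (fun i => `|u i|)).
have -> : 2 ^+ j * (2 * j.+1)%:R ^+ j.+1 * \sum_(i < b) `|u i|
  = (2 * j.+1)%:R ^+ j.+1 * (2 ^+ j * \sum_(i < b) `|u i|) by ring.
apply: (@le_trans _ _ ((2 * j.+1)%:R ^+ j.+1 * (h%:R * (m * h%:R ^+ j)))).
  have -> : (2 * j.+1)%:R ^+ j.+1 * (h%:R * (m * h%:R ^+ j))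
    = m * (2 * j.+1 * h)%:R ^+ j.+1 :> R.
    by rewrite [in RHS]natrM exprMn exprS [_%:R ^+ j.+1 in RHS]exprS; ring.
  by rewrite ler_wpM2l// lerXn2r// ?nnegrE// ler_nat.
by rewrite ler_wpM2l// exprn_ge0.
Qed.

Lemma diff_le_variation {R : realFieldType} (w : nat -> R) b i i' :
  (i < b)%N -> (i' < b)%N ->
  `|w i - w i'| <= \sum_(s < b.-1) `|D1 w s|.
Proof.
wlog ii' : i i' / (i <= i')%N => [H ib i'b|ib i'b].
  by case: (leqP i i') => [/H|/ltnW/H]; [exact|rewrite distrC; exact].
have -> : w i - w i' = - sdiff (i' - i) w i.
  by rewrite /sdiff subnKC// opprB.
rewrite normrN sdiff_telescope; apply: (le_trans (ler_norm_sum _ _ _)).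
have ib' : (i + (i' - i) <= b.-1)%N by lia.
apply: le_trans (@ler_sum_widen _ (fun s => `|D1 w s|) _ _ _ ib') => //.
by rewrite (@big_split_ord _ _ _ i (i' - i)) /= lerDr sumr_ge0.
Qed.

Lemma iter_sdiffN {R : realFieldType} j h (u : nat -> R) i :
  iter j (sdiff h) (fun x => - u x) i = - iter j (sdiff h) u i.
Proof.
elim: j i => //= j IH i; rewrite /sdiff in IH *.
by rewrite !IH; ring.
Qed.

(** If a value of the difference of order [j] exceeds its variation [V] over the block, this
    difference keeps its sign and stays above the excess everywhere. Then [min_iter_diff_le] applies
    to [u] or to [- u], with the excess as [m]. *)
Lemma iter_diff_sup_le {R : realFieldType} j b (u : nat -> R) i :
  (i < b - j)%N ->
  `|iter j D1 u i| * b%:R ^+ j.+1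
    <= 2 ^+ j * (2 * j.+1)%:R ^+ j.+1 * (\sum_(i < b) `|u i|)
       + b%:R ^+ j.+1 * \sum_(i < b - j.+1) `|iter j.+1 D1 u i|.
Proof.
move=> ib; rewrite [b%:R ^+ j.+1 * _]mulrC -lerBlDr -mulrBl.
have [jb|jb] := leqP b j; first by move: ib; lia.
set V := \sum_(i < _) `|iter j.+1 D1 u i|.
have [m0|m0] := lerP (`|iter j D1 u i| - V) 0.
  apply: (@le_trans _ _ 0); first by rewrite mulr_le0_ge0// exprn_ge0.
  by rewrite !mulr_ge0// ?exprn_ge0// sumr_ge0.
have osc i' : (i' < b - j)%N -> `|iter j D1 u i - iter j D1 u i'| <= V.
  move=> i'b; rewrite /V; have -> : (b - j.+1)%N = (b - j).-1 by lia.
  exact: diff_le_variation.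
have [u0|u0] := lerP 0 (iter j D1 u i).
  apply: min_iter_diff_le => // [|i' i'b]; first exact: ltW.
  have := osc _ i'b; rewrite ler_norml (ger0_norm u0) => /andP[]; lra.
have -> : \sum_(i < b) `|u i| = \sum_(i < b) `|- u i|.
  by apply: eq_bigr => s _; rewrite normrN.
apply: (min_iter_diff_le (u := fun x => - u x)) => // [|i' i'b].
  exact: ltW.
have := osc _ i'b; rewrite iter_sdiffN ler_norml (ltr0_norm u0) => /andP[]; lra.
Qed.

Lemma iter_diff_variation_le {R : realFieldType} j b (u : nat -> R) :
  b%:R ^+ j * \sum_(i < b - j) `|iter j D1 u i|
    <= 2 ^+ j * (2 * j.+1)%:R ^+ j.+1 * (\sum_(i < b) `|u i|)
       + b%:R ^+ j.+1 * \sum_(i < b - j.+1) `|iter j.+1 D1 u i|.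
Proof.
set C := (2 ^+ j * _); set X := \sum_(i < b) _; set W := \sum_(i < _ - j.+1) _.
have [->|b0] := posnP b.
  rewrite sub0n big_ord0 mulr0 addr_ge0// mulr_ge0// ?sumr_ge0//.
  by rewrite mulr_ge0// exprn_ge0.
have b0' : (0 : R) < b%:R by rewrite ltr0n.
rewrite -(ler_pM2l b0') mulrA -exprS mulr_sumr.
apply: (@le_trans _ _ (\sum_(i < b - j) (C * X + b%:R ^+ j.+1 * W))).
  by apply: ler_sum => i _; rewrite mulrC iter_diff_sup_le.
rewrite sumr_const card_ord -[_ *+ (b - j)]mulr_natl ler_wpM2r ?ler_nat ?leq_subr//.
by rewrite addr_ge0// mulr_ge0// ?exprn_ge0// ?sumr_ge0// mulr_ge0// exprn_ge0.
Qed.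

(* A discrete Gagliardo-Nirenberg inequality. *)
Lemma discrete_interpolation {R : realFieldType} (k : nat) :
  exists2 C : R, 0 < C & forall b (u : nat -> R) i, (i < b)%N ->
    b%:R * (`|u i| + \sum_(s < b.-1) `|D1 u s|) <=
      C * (\sum_(s < b) `|u s|) +
      2 * b%:R ^+ k.+1 * \sum_(s < b - k.+1) `|iter k.+1 D1 u s|.
Proof.
have [C C0 HC] : exists2 C : R, 0 < C & forall b (u : nat -> R),
    b%:R * (\sum_(s < b - 1) `|D1 u s|) <= C * (\sum_(s < b) `|u s|) +
      b%:R ^+ k.+1 * \sum_(s < b - k.+1) `|iter k.+1 D1 u s|.
  elim: k => [|k [C C0 IH]].
    exists 1 => // b u; rewrite expr1 lerDr mul1r.
    by rewrite sumr_ge0.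
  exists (C + 2 ^+ k.+1 * (2 * k.+2)%:R ^+ k.+2) => [|b u].
    by rewrite addr_gt0// mulr_gt0// exprn_gt0// ltr0n.
  apply: (le_trans (IH b u)); rewrite mulrDl -addrA lerD2l.
  exact: iter_diff_variation_le.
exists (2 * C + 1) => [|b u i ib]; first by rewrite addr_gt0// mulr_gt0.
have := HC b u; rewrite subn1.
set V := \sum_(s < b.-1) _; set X := \sum_(s < b) _; set W := \sum_(s < _ - k.+1) _.
move=> bV.
(* For every [s] in the block, |u i| is at most |u s| plus the variation; this is summed over
   [s]. *)
have : b%:R * `|u i| <= X + b%:R * V.
  rewrite -[b in X in X <= _]card_ord mulr_natl -sumr_const.
  rewrite -[b in X in _ <= _ + X]card_ord mulr_natl -sumr_const -big_split /=.
  apply: ler_sum => s _.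
  have := diff_le_variation u ib (ltn_ord s); rewrite -/V => H.
  have := ler_normD (u s) (u i - u s).
  have -> : u s + (u i - u s) = u i by ring.
  lra.
rewrite mulrDr; lra.
Qed.

Lemma abel_bound {R : realFieldType} (e u : nat -> R) (N : R) b :
  (forall j, (j <= b)%N -> `|\sum_(s < j) e s| <= N) -> (0 < b)%N ->
  `|\sum_(s < b) e s * u s| <= N * (`|u b.-1| + \sum_(s < b.-1) `|D1 u s|).
Proof.
case: b => // b HN _ /=.
have -> : \sum_(s < b.+1) e s * u s =
    (\sum_(s < b.+1) e s) * u b - \sum_(s < b) (\sum_(t < s.+1) e t) * D1 u s.
  elim: b {HN} => [|b IH]; first by rewrite !big_ord_recl !big_ord0; ring.
  rewrite big_ord_recr IH /=.
  rewrite [\sum_(s < b.+2) e s]big_ord_recr /=.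
  rewrite [X in _ = _ - X]big_ord_recr /= /sdiff addn1; ring.
apply: (le_trans (ler_normB _ _)); rewrite mulrDr normrM; apply: lerD.
  by rewrite ler_wpM2r// HN.
apply: (le_trans (ler_norm_sum _ _ _)); rewrite mulr_sumr.
apply: ler_sum => s _; rewrite normrM ler_wpM2r// HN//.
exact: leqW (ltn_ord s).
Qed.

Lemma sum_norm_sqr_le {R : realFieldType} b (u : nat -> R) :
  (\sum_(s < b) `|u s|) ^+ 2 <= b%:R * \sum_(s < b) u s ^+ 2.
Proof.
have [->|b0] := posnP b; first by rewrite !big_ord0 expr0n mulr0.
set X := \sum_(s < b) `|u s|.
have b0' : (0 : R) < b%:R by rewrite ltr0n.
have : 0 <= \sum_(s < b) (b%:R * `|u s| - X) ^+ 2.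
  by apply: sumr_ge0 => s _; exact: sqr_ge0.
have -> : \sum_(s < b) (b%:R * `|u s| - X) ^+ 2 =
    b%:R * (b%:R * \sum_(s < b) u s ^+ 2 - X ^+ 2).
  under eq_bigr do rewrite sqrrB exprMn real_normK ?num_real//.
  rewrite big_split sumrB /= sumr_const card_ord -mulr_sumr.
  have -> : \sum_(i < b) b%:R * `|u i| * X *+ 2 = 2 * b%:R * X * X.
    under eq_bigr do rewrite -mulrA -mulrnAr.
    rewrite -mulr_sumr sumrMnl -mulr_suml -/X; ring.
  rewrite -mulr_natl; ring.
by rewrite pmulr_rge0// subr_ge0.
Qed.

(** * Moments of sums of independent variables *)

Import HBNNSimple.

Lemma integral_mul_nnsfun d (T : measurableType d) (R : realType)
    (P : {measure set T -> \bar R}) (g : T -> R) (X : T -> R)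
    (h : {nnsfun R >-> R}) :
  measurable_fun setT g -> (forall w, 0 <= g w) -> measurable_fun setT X ->
  (\int[P]_w (g w * h (X w))%:E =
  \sum_(y \in range h) (y%:E * \int[P]_w (g w * \1_(h @^-1` [set y]) (X w))%:E))%E.
Proof.
move=> mg g0 mX.
have mi y : measurable_fun setT (fun w => g w * \1_(h @^-1` [set y]) (X w)).
  by apply: measurable_funM => //; apply: measurableT_comp => //; exact: measurable_indic.
have hy0 y w : 0 <= y * (g w * \1_(h @^-1` [set y]) (X w)).
  have := nnfun_muleindic_ge0 h y (X w).
  by rewrite -EFinM lee_fin mulrCA => ?; exact: mulr_ge0.
transitivity (\int[P]_w (\sum_(y \in range h)
    (y * (g w * \1_(h @^-1` [set y]) (X w)))%:E))%E.
  apply: eq_integral => w _; rewrite fsumEFin//; congr EFin.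
  rewrite [h (X w)]fimfunE.
  rewrite !fsbig_finite//= mulr_sumr.
  by apply: eq_bigr => y _; rewrite mulrCA.
rewrite ge0_integral_fsum//.
- apply: eq_fsbigr => y /[1!inE] -[x _ <-].
  rewrite -ge0_integralZl_EFin//.
  + by move=> w _; rewrite lee_fin mulr_ge0// indicE.
  + exact/measurable_EFinP.
- by move=> y; apply/measurable_EFinP; exact: measurable_funM.
- by move=> y w _; rewrite lee_fin.
Qed.

(** Monotone approximation by simple functions passes from indicators to [f]. It serves to split off
    one independent factor, since independence is stated for events only. *)
Lemma integral_mul_comp_le d (T : measurableType d) (R : realType)
    (P : probability T R) (g : T -> R) (X : T -> R) (f : R -> R) (c : R) :
  measurable_fun setT g -> (forall w, 0 <= g w) -> measurable_fun setT X ->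
  measurable_fun setT f -> (forall x, 0 <= f x) -> 0 <= c ->
  (forall A, measurable A ->
    \int[P]_w (g w * \1_A (X w))%:E <= c%:E * P (X @^-1` A))%E ->
  (\int[P]_w (g w * f (X w))%:E <= c%:E * \int[P]_w (f (X w))%:E)%E.
Proof.
move=> mg g0 mX mf f0 c0 H.
pose F := EFin \o f.
have mF : measurable_fun setT F by exact/measurable_EFinP.
have F0 x : setT x -> (0 <= F x)%E by rewrite /F/= lee_fin.
pose h := nnsfun_approx measurableT mF.
have hf n x : h n x <= f x.
  rewrite -lee_fin -[leRHS]/(F x).
  by rewrite /h nnsfun_approxE le_approx.
have hE n : (\int[P]_w (g w * h n (X w))%:E <= c%:E * \int[P]_w (h n (X w))%:E)%E.
  rewrite integral_mul_nnsfun//.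
  have -> : (\int[P]_w (h n (X w))%:E = \int[P]_w (cst 1 w * h n (X w))%:E)%E.
    by apply: eq_integral => w _; rewrite mul1r.
  rewrite integral_mul_nnsfun//.
  have hi y : (\int[P]_w (cst 1 w * \1_(h n @^-1` [set y]) (X w))%:E
      = P (X @^-1` (h n @^-1` [set y])))%E.
    under eq_integral do rewrite mul1r.
    rewrite -[LHS]/(\int[P]_w (\1_(X @^-1` (h n @^-1` [set y])) w)%:E)%E.
    rewrite integral_indic ?setIT//.
    rewrite -[X @^-1` _]setTI; exact: mX.
  under [in leRHS]eq_fsbigr do rewrite hi.
  rewrite !fsbig_finite//= big_seq [in leRHS]big_seq.
  rewrite ge0_sume_distrr; last first.
    move=> y; rewrite in_fset_set// inE => -[x _ <-].
    by rewrite mule_ge0// lee_fin.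
  apply: lee_sum => y; rewrite in_fset_set// inE => -[x _ <-].
  by rewrite [leRHS]muleCA lee_wpmul2l// ?lee_fin// H.
have -> : (\int[P]_w (g w * f (X w))%:E
    = \int[P]_w (limn (fun n => (g w * h n (X w))%:E)))%E.
  apply: eq_integral => w _; apply/esym/cvg_lim => //.
  under eq_fun do rewrite EFinM.
  rewrite EFinM; apply: cvgeZl => //.
  exact: (@cvg_nnsfun_approx _ _ _ _ measurableT _ mF F0).
have mgh n : measurable_fun setT (fun w => (g w * h n (X w))%:E).
  apply/measurable_EFinP; apply: measurable_funM => //.
  exact: measurableT_comp.
have ndgh w m n : (m <= n)%N -> ((g w * h m (X w))%:E <= (g w * h n (X w))%:E)%E.
  by move=> mn; rewrite lee_fin ler_wpM2l//; exact/lefP/nd_nnsfun_approx.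
have gh0 n w : (0 <= (g w * h n (X w))%:E)%E by rewrite lee_fin mulr_ge0.
rewrite monotone_convergence//; last by move=> w _ m n; exact: ndgh.
apply: lime_le.
  apply: ereal_nondecreasing_is_cvgn => m n mn; apply: ge0_le_integral => //.
  by move=> w _; exact: ndgh.
apply: nearW => n; apply: (le_trans (hE n)).
rewrite lee_wpmul2l ?lee_fin//; apply: ge0_le_integral => //.
- by move=> w _; rewrite lee_fin.
- by apply/measurable_EFinP; exact: measurableT_comp.
- by apply/measurable_EFinP; exact: measurableT_comp.
- by move=> w _; rewrite lee_fin.
Qed.

Lemma measurable_prod_in d (T : measurableType d) (R : realType) (I : finType)
    (J : {set I}) (h : I -> T -> R) :
  (forall i, measurable_fun setT (h i)) ->
  measurable_fun setT (fun w => \prod_(i in J) h i w).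
Proof.
move=> mh; under eq_fun do rewrite -big_enum.
by apply: measurable_prod => i _; exact: mh.
Qed.

Lemma integral_prod_independent_le d (T : measurableType d) (R : realType)
    (P : probability T R) n (X : 'I_n -> {RV P >-> R}) (f : R -> R) (r : R) :
  mutually_independent X -> measurable_fun setT f -> (forall x, 0 <= f x) ->
  0 <= r -> (forall i, \int[P]_w (f (X i w))%:E <= r%:E)%E ->
  forall J : {set 'I_n},
    (\int[P]_w (\prod_(i in J) f (X i w))%:E <= (r ^+ #|J|)%:E)%E.
Proof.
move=> indep mf f0 r0 fr.
have mfX i : measurable_fun setT (fun w => f (X i w)) by exact: measurableT_comp.
have prodE (J' : {set 'I_n}) (A : 'I_n -> set R) : (forall i, measurable (A i)) ->
    (\prod_(i in J') P (X i @^-1` A i) =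
      (\prod_(i in J') fine (P (X i @^-1` A i)))%:E)%E.
  move=> mA; rewrite -prodEFin; apply: eq_bigr => i _.
  by rewrite fineK// fin_num_measure// -[X i @^-1` _]setTI; exact: measurable_funP.
(* Generalized for the induction: the factors indexed by [J'] are indicators of events, and each
   step turns one factor of [J] into an indicator. When [J] is empty, only the definition of
   independence is left. *)
suff H m (J J' : {set 'I_n}) (A : 'I_n -> set R) : #|J| = m -> {in J, forall i, i \notin J'} ->
    (forall i, measurable (A i)) ->
    (\int[P]_w ((\prod_(i in J) f (X i w)) *
        \prod_(i in J') \1_(A i) (X i w))%:E <=
     (r ^+ m * \prod_(i in J') fine (P (X i @^-1` A i)))%:E)%E.
  move=> J; have := H #|J| J finset.set0 (fun=> setT) erefl.
  rewrite big_set0 mulr1; under eq_integral do rewrite big_set0 mulr1.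
  by apply => // i _; rewrite finset.inE.
elim: m J J' A => [|m IH] J J' A Jm dJ mA.
  have -> : J = finset.set0 by apply/eqP; rewrite -cards_eq0 Jm.
  rewrite expr0 mul1r.
  under eq_integral do rewrite big_set0 mul1r.
  rewrite -prodE// -indep//.
  under eq_integral => w _.
    have -> : \prod_(i in J') \1_(A i) (X i w) =
       \1_(\bigcap_(i in [set` J']) (X i @^-1` A i)) w :> R.
      rewrite indicE; have [/set_mem H|/negP H] := boolP (w \in _).
        by rewrite big1// => i iJ; rewrite indicE mem_set//; exact: H.
      apply/eqP; rewrite prodf_seq_eq0; apply/negPn/negP => /hasPn H'.
      apply: H; rewrite inE => i /= iJ'; have := H' i (mem_index_enum i).
      by rewrite iJ' indicE pnatr_eq0 eqb0 negbK inE.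
    over.
  rewrite integral_indic ?setIT//.
  apply: fin_bigcap_measurable => // i _.
  by rewrite -[X i @^-1` _]setTI; exact: measurable_funP.
have [i0 i0J] : exists i0, i0 \in J by apply/set0Pn; rewrite -cards_eq0 Jm.
pose J0 := J :\ i0.
have J0m : #|J0| = m by move: Jm; rewrite (cardsD1 i0) i0J => -[].
have i0J' : i0 \notin J' by exact: dJ.
pose g w := (\prod_(i in J0) f (X i w)) * \prod_(i in J') \1_(A i) (X i w).
pose c := r ^+ m * \prod_(i in J') fine (P (X i @^-1` A i)).
have c0 : 0 <= c.
  by rewrite mulr_ge0// ?exprn_ge0//; apply: prodr_ge0 => i _; exact: fine_ge0.
have step := @integral_mul_comp_le _ _ _ P g (X i0) f c.
have -> : (\int[P]_w ((\prod_(i in J) f (X i w)) *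
    \prod_(i in J') \1_(A i) (X i w))%:E = \int[P]_w (g w * f (X i0 w))%:E)%E.
  apply: eq_integral => w _; congr EFin.
  rewrite (big_setD1 i0)//= /g -/J0; ring.
apply: (le_trans (step _ _ _ _ _ _ _)) => //.
- apply: measurable_funM; apply: measurable_prod_in => // i.
  apply: measurableT_comp => //; exact: measurable_indic.
- by move=> w; rewrite mulr_ge0//; apply: prodr_ge0 => // i _; rewrite indicE.
- move=> B mB.
  pose A' i := if i == i0 then B else A i.
  have A'0 : A' i0 = B by rewrite /A' eqxx.
  have A'E i : i \in J' -> A' i = A i.
    by move=> iJ'; rewrite /A'; case: eqP => // ii0; rewrite -ii0 iJ' in i0J'.
  have := IH J0 (i0 |: J')%SET A' J0m.
  rewrite big_setU1//= A'0.
  under eq_bigr => i iJ' do rewrite A'E//.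
  have -> : (\int[P]_w ((\prod_(i in J0) f (X i w)) *
        \prod_(i in (i0 |: J')%SET) \1_(A' i) (X i w))%:E =
     \int[P]_w (g w * \1_B (X i0 w))%:E)%E.
    apply: eq_integral => w _; congr EFin; rewrite big_setU1//= A'0 /g.
    have -> : \prod_(i in J') \1_(A' i) (X i w) =
        \prod_(i in J') \1_(A i) (X i w) :> R.
      by apply: eq_bigr => i iJ'; rewrite A'E.
    ring.
  move=> step'; apply: (le_trans (step' _ _)).
  + move=> i; rewrite /J0 !finset.inE => /andP[ii0 iJ].
    by rewrite negb_or ii0 dJ.
  + by move=> i; rewrite /A'; case: eqP.
  + rewrite -[P (X i0 @^-1` B)]fineK; last first.
      by rewrite fin_num_measure// -[X i0 @^-1` _]setTI; exact: measurable_funP.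
    by rewrite -EFinM lee_fin /c mulrAC mulrA.
- have -> : r ^+ m.+1 * \prod_(i in J') fine (P (X i @^-1` A i)) = c * r.
    rewrite /c exprS; ring.
  rewrite [leRHS]EFinM; apply: lee_wpmul2l; first by rewrite lee_fin.
  exact: fr.
Qed.

(** * Exponential moments of the noise *)

Lemma integral_probability_cst d (T : measurableType d) (R : realType)
  (P : probability T R) (r : R) : (\int[P]_w r%:E = r%:E)%E.
Proof.
rewrite (@integral_cst _ _ _ P setT measurableT r%:E) -[RHS]mule1.
congr (_ * _)%E; exact: probability_setT.
Qed.

(** The linear term vanishes in the mean of a centred variable, so the mean of exp(s X) is bounded
    through that of exp(2 s^2 X^2). *)
Lemma expR_le_addr_sqr (R : realType) (x : R) : expR x <= x + expR (2 * x ^+ 2).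
Proof.
have e2 : 1 + 2 * x ^+ 2 <= expR (2 * x ^+ 2) := expR_ge1Dx _.
have [xl|xl] := ltP x (- 2^-1).
  have : expR x <= 1 by rewrite -expR0 ler_expR; lra.
  nra.
have [xr|xr] := ltP (2^-1) x.
  have : expR x <= expR (2 * x ^+ 2) by rewrite ler_expR; nra.
  lra.
have : expR x <= (1 - x)^-1.
  rewrite -[x in expR x]opprK expRN lef_pV2 ?posrE ?expR_gt0//; last lra.
  exact: expR_ge1Dx.
have -> : (1 - x)^-1 = 1 + x + x ^+ 2 / (1 - x) by field; lra.
have : x ^+ 2 / (1 - x) <= 2 * x ^+ 2.
  rewrite ler_pdivrMr; last lra.
  nra.
lra.
Qed.

Lemma expr6_le_expR (R : realType) (x : R) :
  x ^+ 6 <= 6`!%:R * (expR x + expR (- x)).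
Proof.
have c0 : (0 : R) < 6`!%:R by rewrite ltr0n fact_gt0.
move: (6`!%:R : R) c0 (@expR_ge1Dxn R ^~ 5) => c c0 E.
have H (z : R) : 0 <= z -> z ^+ 6 <= c * expR z.
  move=> z0; rewrite mulrC -ler_pdivrMr//.
  by apply: le_trans (E _ z0); rewrite lerDr.
have [x0|/ltW x0] := leP 0 x.
  by apply: (le_trans (H _ x0)); rewrite (ler_wpM2l (ltW c0))// lerDl expR_ge0.
have -> : x ^+ 6 = (- x) ^+ 6 by ring.
have x0' : 0 <= - x by rewrite oppr_ge0.
by apply: (le_trans (H _ x0')); rewrite (ler_wpM2l (ltW c0))// lerDr expR_ge0.
Qed.

Lemma bernoulli_ineq (R : realFieldType) (t : R) b :
  0 <= t -> 1 + b%:R * (t - 1) <= t ^+ b.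
Proof.
move=> t0; elim: b => [|b IH]; first by rewrite expr0; lra.
apply: (@le_trans _ _ (t * (1 + b%:R * (t - 1)))); last first.
  by rewrite exprS ler_wpM2l.
rewrite -subr_ge0.
have -> : t * (1 + b%:R * (t - 1)) - (1 + b.+1%:R * (t - 1)) =
  b%:R * (t - 1) ^+ 2 by rewrite -natr1; ring.
by rewrite mulr_ge0// sqr_ge0.
Qed.

Lemma expR_div_le (R : realType) (z : R) b : (0 < b)%N ->
  expR (z / b%:R) <= 1 + (expR z - 1) / b%:R.
Proof.
move=> b0; have b0' : (0 : R) < b%:R by rewrite ltr0n.
rewrite -lerBlDl ler_pdivlMr// mulrC lerBrDl.
have -> : expR z = expR (z / b%:R) ^+ b.
  by rewrite -expRM_natl; congr expR; field; rewrite gt_eqF.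
exact/bernoulli_ineq/expR_ge0.
Qed.

(* The layers [j < Z <= j + 1] have probability at most [M exp(-2j)]. *)
Lemma integral_expR_tail_le d (T : measurableType d) (R : realType)
    (P : probability T R) (Z : T -> R) (M : R) :
  measurable_fun setT Z -> (forall w, 0 <= Z w) -> 0 <= M ->
  (forall j, (0 < j)%N ->
    P [set w | (j%:R < Z w)%R] <= (M * expR (- (2 * j%:R)))%:E)%E ->
  (\int[P]_w (expR (Z w))%:E <= (1 + expR 1 * (1 + 2 * M))%:E)%E.
Proof.
move=> mZ Z0 M0 tail.
have mA j : measurable [set w | j%:R < Z w].
  rewrite (_ : [set w | _] = Z @^-1` `]j%:R, +oo[).
    by rewrite -[_ @^-1` _]setTI; exact: mZ.
  by apply/seteqP; split => w /=; rewrite in_itv/= andbT.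
pose L j w : \bar R := (expR j.+1%:R * \1_[set w | j%:R < Z w] w)%:E.
have L0 j w : (0 <= L j w)%E by rewrite lee_fin mulr_ge0 ?expR_ge0// indicE.
have mL j : measurable_fun setT (L j).
  apply/measurable_EFinP; apply: measurable_funM => //; exact: measurable_indic.
have EL j : (\int[P]_w L j w <=
    (if j is 0 then expR 1 else expR 1 * (M * 2^-1 ^+ j))%:E)%E.
  rewrite /L; under eq_integral do rewrite EFinM.
  rewrite ge0_integralZl_EFin ?expR_ge0//; last first.
    exact/measurable_EFinP/measurable_indic.
  rewrite integral_indic// setIT; case: j => [|j].
    rewrite -[leRHS]mule1; apply: lee_wpmul2l; first by rewrite lee_fin expR_ge0.
    exact: probability_le1.
  apply: (@le_trans _ _ ((expR j.+2%:R)%:E * (M * expR (- (2 * j.+1%:R)))%:E)%E).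
    apply: lee_wpmul2l; first by rewrite lee_fin expR_ge0.
    exact: tail.
  rewrite -EFinM lee_fin.
  have -> : expR j.+2%:R * (M * expR (- (2 * j.+1%:R))) =
     expR 1 * (M * expR (- j.+1%:R)) :> R.
    rewrite mulrCA -expRD [RHS]mulrCA -expRD; congr (_ * expR _).
    rewrite -(@natr1 _ j.+1); ring.
  rewrite ler_wpM2l ?expR_ge0// ler_wpM2l//.
  (* What remains is exp(-(j+1)) <= 2^(-(j+1)), that is 2 <= exp 1; the layers then form a geometric
     series. *)
  rewrite expRN exprVn lef_pV2 ?posrE ?exprn_gt0 ?expR_gt0//.
  rewrite -[j.+1%:R]mulr1 expRM_natl lerXn2r ?nnegrE ?expR_ge0//.
  exact: (expR_ge1Dx 1).
have pt w : ((expR (Z w))%:E <= 1 + \sum_(0 <= j <oo) L j w)%E.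
  have [Zw|Zw] := leP (Z w) 0.
    apply: (@le_trans _ _ 1%E); first by rewrite lee_fin -expR0 ler_expR.
    by rewrite leeDl// nneseries_ge0.
  have [j jZ Zj] : exists2 j, j%:R < Z w & Z w <= j.+1%:R.
    have /andP[jZ Zj] := truncn_itv (ltW Zw).
    move: jZ; rewrite le_eqVlt => /orP[/eqP jZ|jZ]; last first.
      by exists (Num.truncn (Z w)) => //; exact: ltW.
    case: (Num.truncn (Z w)) jZ => [|j] jZ; first by rewrite -jZ ltxx in Zw.
    by exists j; rewrite -jZ// ltr_nat.
  apply: (@le_trans _ _ (L j w)).
    by rewrite /L indicE mem_set// mulr1 lee_fin ler_expR.
  apply: (@le_trans _ _ (\sum_(0 <= j <oo) L j w)%E); last by rewrite leeDr.
  apply: le_trans (nneseries_lim_ge j.+1 _); last by [].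
  by rewrite big_nat_recr//= leeDr// sume_ge0.
have mS : measurable_fun setT (fun w => \sum_(0 <= j <oo) L j w)%E.
  exact: ge0_emeasurable_sum.
have S0 w : (0 <= \sum_(0 <= j <oo) L j w)%E by exact: nneseries_ge0.
apply: (@le_trans _ _ (\int[P]_w (1 + \sum_(0 <= j <oo) L j w))%E).
  apply: ge0_le_integral => //.
  - apply/measurable_EFinP; exact: measurableT_comp.
  - exact: emeasurable_funD.
rewrite ge0_integralD// integral_nneseries// EFinD; apply: leeD.
  by rewrite integral_probability_cst.
apply: lime_le.
  by apply: is_cvg_nneseries => n _ _; exact: integral_ge0.
apply: nearW => n.
apply: (@le_trans _ _ (\sum_(0 <= j < n) (if j is 0 then expR 1 else expR 1 * (M * 2^-1 ^+ j))%:E)%E).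
  by apply: lee_sum => j _; exact: EL.
rewrite sumEFin lee_fin.
case: n => [|n]; first by rewrite big_nil mulr_ge0 ?expR_ge0// addr_ge0// mulr_ge0.
rewrite big_nat_recl//= mulrDr mulr1 lerD2l -mulr_sumr -mulr_sumr.
rewrite ler_wpM2l ?expR_ge0// mulrC ler_wpM2r//.
suff : \sum_(0 <= i < n) 2^-1 ^+ i.+1 + 2^-1 ^+ n = 1 :> R.
  have : (0 : R) <= 2^-1 ^+ n by rewrite exprn_ge0.
  lra.
elim: n => [|n IH]; first by rewrite big_nil add0r expr0.
by rewrite big_nat_recr//= -addrA -[RHS]IH; congr (_ + _); rewrite exprS; lra.
Qed.

(** The bound [1 + A / b] is what a product of [b] such factors needs to stay below exp A. Since 2
    s^2 X^2 <= c X^2 / b, the gain 1/b comes from [expR_div_le], a Bernoulli inequality. *)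
Lemma mgf_le d (T : measurableType d) (R : realType)
    (P : probability T R) (X : T -> R) (A s c : R) b :
  (0 < b)%N -> 0 < c -> 0 <= A -> 2 * s ^+ 2 * b%:R <= c ->
  measurable_fun setT X -> (\int[P]_w (X w)%:E = 0)%E ->
  (\int[P]_w (expR (c * X w ^+ 2))%:E <= (1 + A)%:E)%E ->
  (\int[P]_w (expR (s * X w))%:E <= (1 + A / b%:R)%:E)%E.
Proof.
move=> b0 c0 A0 sbc mX EX EA.
have b0' : (0 : R) < b%:R by rewrite ltr0n.
have mE a : measurable_fun setT (fun w => (expR (a * X w ^+ 2))%:E).
  apply/measurable_EFinP; apply: measurableT_comp => //.
  apply: measurable_funM => //; exact: measurable_funX.
have iE : P.-integrable setT (fun w => (expR (c * X w ^+ 2))%:E).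
  apply/integrableP; split => //.
  under eq_integral do rewrite gee0_abs ?lee_fin ?expR_ge0//.
  by apply: le_lt_trans EA _; rewrite ltry.
have i1 : P.-integrable setT (cst (1%:E : \bar R)).
  by apply: finite_measure_integrable_cst.
(* Integrability follows from |X| <= 1 + X^2 <= (1 + 1/c) exp(c X^2). *)
have iX : P.-integrable setT (fun w => (X w)%:E).
  apply: (@le_integrable _ _ _ P setT measurableT _
    (fun w => ((1 + c^-1) * expR (c * X w ^+ 2))%:E)).
  - exact/measurable_EFinP.
  - move=> w _; rewrite lee_fin [leRHS]ger0_norm ?mulr_ge0 ?expR_ge0//; last first.
      by rewrite addr_ge0// invr_ge0 ltW.
    have e1 := expR_ge1Dx (c * X w ^+ 2).
    have cX : 0 <= c * X w ^+ 2 by rewrite mulr_ge0 ?sqr_ge0// ltW.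
    apply: (@le_trans _ _ (1 + X w ^+ 2)).
      by rewrite -(real_normK (num_real (X w))); nra.
    apply: (@le_trans _ _ ((1 + c^-1) * (1 + c * X w ^+ 2))); last first.
      by rewrite ler_wpM2l// addr_ge0// invr_ge0 ltW.
    have -> : (1 + c^-1) * (1 + c * X w ^+ 2) =
      1 + X w ^+ 2 + c^-1 + c * X w ^+ 2 by field; rewrite gt_eqF.
    by rewrite -addrA lerDl addr_ge0// invr_ge0 ltW.
  - under eq_fun do rewrite EFinM.
    exact: integrableZl.
pose Y w := (1 + (expR (c * X w ^+ 2) - 1) / b%:R).
have pt w : expR (s * X w) <= s * X w + Y w.
  apply: (le_trans (expR_le_addr_sqr _)); rewrite lerD2l.
  apply: le_trans (expR_div_le _ b0); rewrite ler_expR ler_pdivlMr// exprMn.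
  have := sqr_ge0 (X w); nra.
have YE w : (s * X w + Y w)%:E =
    (s%:E * (X w)%:E + ((1 - b%:R^-1)%:E * 1%:E + (b%:R^-1)%:E * (expR (c * X w ^+ 2))%:E))%E.
  by rewrite -!EFinM -!EFinD; congr EFin; rewrite /Y; field; rewrite gt_eqF.
apply: (@le_trans _ _ (\int[P]_w (s * X w + Y w)%:E)%E).
  apply: ge0_le_integral => //.
  - by apply/measurable_EFinP; apply: measurableT_comp => //; exact: measurable_funM.
  - apply/measurable_EFinP; apply: measurable_funD; first exact: measurable_funM.
    apply: measurable_funD => //; apply: measurable_funM => //.
    apply: measurable_funB => //; exact/measurable_EFinP/mE.
  - by move=> w _; rewrite lee_fin.
under eq_integral do rewrite YE.
rewrite integralD//; last 2 first.
- exact: integrableZl.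
- apply: integrableD => //; exact: integrableZl.
rewrite integralD//; last 2 first.
- exact: integrableZl.
- exact: integrableZl.
rewrite !integralZl// EX mule0 add0e.
rewrite integral_probability_cst.
rewrite mule1.
apply: (@le_trans _ _ ((1 - b%:R^-1)%:E + (b%:R^-1)%:E * (1 + A)%:E)%E).
  by rewrite leeD2l// lee_wpmul2l// lee_fin invr_ge0 ltW.
by rewrite -EFinM -EFinD lee_fin le_eqVlt; apply/orP; left; apply/eqP; field; rewrite gt_eqF.
Qed.

(* [x^6 <= 6! (exp(s x) + exp(- s x)) / s^6], with [s] of order [#|J|^(-1/2)]. *)
Lemma sixth_moment_le (R : realType) (M sigma : R) : 0 < M -> 0 < sigma ->
  exists2 C6 : R, 0 < C6 &
  forall d (T : measurableType d) (P : probability T R) n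
    (X : 'I_n -> {RV P >-> R}),
    mutually_independent X -> (forall i, 'E_P[X i] = 0)%E ->
    (forall i (t : R), 0 < t -> (P [set w | (t < `|X i w|)%R] <=
       (M * expR (- (t ^+ 2 / (2 * sigma ^+ 2))))%:E)%E) ->
    forall J : {set 'I_n}, (0 < #|J|)%N ->
    (\int[P]_w ((\sum_(i in J) X i w) ^+ 6)%:E <= (C6 * #|J|%:R ^+ 3)%:E)%E.
Proof.
move=> M0 sigma0; pose A := expR 1 * (1 + 2 * M).
have A0 : 0 <= A by rewrite mulr_ge0 ?expR_ge0// addr_ge0// mulr_ge0// ltW.
pose F : R := 6`!%:R.
have F0 : 0 < F by rewrite ltr0n fact_gt0.
exists (F * (2 * expR A) * (8 * sigma ^+ 2) ^+ 3).
  by rewrite !mulr_gt0// ?expR_gt0// exprn_gt0// mulr_gt0// exprn_gt0.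
move=> d T P n X indep mean tail J J0.
have b0 : (0 : R) < #|J|%:R by rewrite ltr0n.
move: J0; set b := #|J| in b0 *; move=> J0.
(* With this [c], the event j < c X^2 is |X| > 2 sigma sqrt j, whose tail bound is exactly M
   exp(-2j). *)
pose c := (4 * sigma ^+ 2)^-1.
have c0 : 0 < c by rewrite invr_gt0 mulr_gt0// exprn_gt0.
have mX i : measurable_fun setT (X i) by exact: measurable_funP.
have EA i : (\int[P]_w (expR (c * X i w ^+ 2))%:E <= (1 + A)%:E)%E.
  apply: integral_expR_tail_le.
  - apply: measurable_funM => //; exact: measurable_funX.
  - by move=> w; rewrite mulr_ge0 ?sqr_ge0// ltW.
  - exact: ltW.
  - move=> j j0; have t0 : 0 < 2 * sigma * Num.sqrt j%:R.
      by rewrite !mulr_gt0// sqrtr_gt0 ltr0n.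
    have -> : [set w | j%:R < c * X i w ^+ 2] =
        [set w | 2 * sigma * Num.sqrt j%:R < `|X i w|].
      apply/funext => w; apply/propext => /=.
      have -> : (2 * sigma * Num.sqrt j%:R < `|X i w|) =
          (j%:R * (4 * sigma ^+ 2) < X i w ^+ 2).
        rewrite -[RHS](_ : (2 * sigma * Num.sqrt j%:R) ^+ 2 < `|X i w| ^+ 2 = _).
          by rewrite ltr_pXn2r ?nnegrE ?(ltW t0).
        rewrite real_normK ?num_real// !exprMn sqr_sqrtr//.
        by congr (_ < _); ring.
      by rewrite /c [_^-1 * _]mulrC ltr_pdivlMr ?mulr_gt0 ?exprn_gt0.
    apply: (le_trans (tail _ _ t0)); rewrite lee_fin le_eqVlt; apply/orP; left.
    apply/eqP; congr (_ * expR (- _)); rewrite !exprMn sqr_sqrtr//; field.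
    by rewrite gt_eqF.
(* This choice gives equality in the requirement 2 s^2 b <= c of [mgf_le]. *)
pose s := (sigma * Num.sqrt (8 * b%:R))^-1.
have s0 : 0 < s by rewrite invr_gt0 mulr_gt0// sqrtr_gt0 mulr_gt0.
have s2 : s ^+ 2 = (8 * sigma ^+ 2 * b%:R)^-1.
  by rewrite exprVn exprMn sqr_sqrtr ?mulr_ge0 ?ltW//; congr (_^-1); ring.
have mgf r : r ^+ 2 = s ^+ 2 ->
    (\int[P]_w (expR (r * \sum_(i in J) X i w))%:E <= (expR A)%:E)%E.
  move=> rs; apply: (@le_trans _ _ (((1 + A / b%:R) ^+ #|J|)%:E)).
    under eq_integral do rewrite mulr_sumr expR_sum.
    apply: (@integral_prod_independent_le _ _ _ _ _ _ (fun x => expR (r * x))) => //.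
    - by apply: measurableT_comp => //; exact: measurable_funM.
    - by rewrite addr_ge0// divr_ge0.
    - move=> i; apply: (mgf_le J0 c0) => //.
        rewrite rs s2 /c le_eqVlt; apply/orP; left; apply/eqP; field.
        by rewrite !gt_eqF.
      by rewrite -[RHS](mean i) unlock.
  rewrite -/b lee_fin; have -> : expR A = expR (A / b%:R) ^+ b.
    by rewrite -expRM_natl; congr expR; field; rewrite gt_eqF.
  rewrite lerXn2r ?nnegrE ?expR_ge0 ?expR_ge1Dx//.
  by rewrite addr_ge0// divr_ge0.
have mS : measurable_fun setT (fun w => \sum_(i in J) X i w).
  under eq_fun do rewrite -big_enum.
  by apply: measurable_sum => i.
pose S w := \sum_(i in J) X i w.
have pt w : S w ^+ 6 <= F / s ^+ 6 * (expR (s * S w) + expR (- s * S w)).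
  rewrite mulrAC ler_pdivlMr ?exprn_gt0// -exprMn mulNr mulrC -[s * _]mulrC.
  exact: expr6_le_expR.
have mexp r : measurable_fun setT (fun w => expR (r * S w)).
  by apply: measurableT_comp => //; exact: measurable_funM.
have Fs0 : 0 <= F / s ^+ 6 by rewrite divr_ge0 ?exprn_ge0// ltW.
apply: (@le_trans _ _ (\int[P]_w (F / s ^+ 6 *
    (expR (s * S w) + expR (- s * S w)))%:E)%E).
  apply: ge0_le_integral => //.
  - by move=> w _; rewrite lee_fin exprn_even_ge0.
  - by apply/measurable_EFinP; exact: measurable_funX.
  - apply/measurable_EFinP; apply: measurable_funM => //; exact: measurable_funD.
  - by move=> w _; rewrite lee_fin; exact: pt.
under eq_integral do rewrite EFinM.
rewrite ge0_integralZl_EFin//; last first.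
  by apply/measurable_EFinP; exact: measurable_funD.
under eq_integral do rewrite EFinD.
rewrite ge0_integralD//; last 2 first.
- exact/measurable_EFinP.
- exact/measurable_EFinP.
apply: (@le_trans _ _ ((F / s ^+ 6)%:E * ((expR A)%:E + (expR A)%:E))%E).
  apply: lee_wpmul2l; first by rewrite lee_fin.
  by apply: leeD; apply: mgf => //; rewrite sqrrN.
rewrite -EFinD -EFinM lee_fin le_eqVlt; apply/orP; left; apply/eqP.
have -> : s ^+ 6 = (s ^+ 2) ^+ 3 by ring.
rewrite s2; field; rewrite !gt_eqF//.
Qed.

(** * The noise against a sequence of bounded variation *)

Definition mean_le d (T : measurableType d) (R : realType) (P : probability T R)
    (f : T -> R) (r : R) : Prop :=
  [/\ measurable_fun setT f, forall w, 0 <= f w &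
      (\int[P]_w (f w)%:E <= r%:E)%E].

Lemma mean_leD d (T : measurableType d) (R : realType) (P : probability T R)
    (f g : T -> R) (r s : R) :
  mean_le P f r -> mean_le P g s -> mean_le P (fun w => f w + g w) (r + s).
Proof.
move=> [mf f0 fr] [mg g0 gs]; split.
- exact: measurable_funD.
- by move=> w; exact: addr_ge0.
- under eq_integral do rewrite EFinD.
  rewrite ge0_integralD//; try exact/measurable_EFinP.
  - by rewrite EFinD leeD.
  - by move=> w _; rewrite lee_fin.
  - by move=> w _; rewrite lee_fin.
Qed.

Lemma mean_leZ d (T : measurableType d) (R : realType) (P : probability T R)
    (f : T -> R) (r c : R) :
  0 <= c -> mean_le P f r -> mean_le P (fun w => c * f w) (c * r).
Proof.
move=> c0 [mf f0 fr]; split.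
- exact: measurable_funM.
- by move=> w; exact: mulr_ge0.
- under eq_integral do rewrite EFinM.
  rewrite ge0_integralZl_EFin//; try exact/measurable_EFinP.
  2: by move=> w _; rewrite lee_fin.
  by rewrite EFinM; apply: lee_wpmul2l; rewrite // lee_fin.
Qed.

Lemma mean_leS d (T : measurableType d) (R : realType) (P : probability T R)
    (f g : T -> R) (r s : R) :
  measurable_fun setT f -> (forall w, 0 <= f w <= g w) -> r <= s ->
  mean_le P g r -> mean_le P f s.
Proof.
move=> mf fg rs [mg g0 gr]; split => //.
  by move=> w; case/andP: (fg w).
apply: (@le_trans _ _ r%:E); last by rewrite lee_fin.
apply: le_trans gr; apply: ge0_le_integral => //; try exact/measurable_EFinP.
- by move=> w _; rewrite lee_fin; case/andP: (fg w).
- by move=> w _; rewrite lee_fin; case/andP: (fg w).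
Qed.

Lemma mean_le_cst d (T : measurableType d) (R : realType) (P : probability T R)
    (r : R) : 0 <= r -> mean_le P (fun=> r) r.
Proof. by move=> r0; split => //; rewrite integral_probability_cst. Qed.

(** The small factor of [y ^+ 6] is the point: 2 (b1^3 + b2^3) has to stay below (b1 + b2)^3 in the
    induction over halves. If y > 10 x, then x + y is at most 11/10 y, and (11/10)^6 < 2. *)
Lemma addr_expr6_le (R : realFieldType) (x y : R) : 0 <= x -> 0 <= y ->
  (x + y) ^+ 6 <= 11 ^+ 6 * x ^+ 6 + 2 * y ^+ 6.
Proof.
move=> x0 y0; have x6 : 0 <= x ^+ 6 := exprn_ge0 _ x0.
have y6 : 0 <= y ^+ 6 := exprn_ge0 _ y0.
have [yx|xy] := leP y (10 * x).
  apply: (@le_trans _ _ ((11 * x) ^+ 6)).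
    by rewrite lerXn2r ?nnegrE ?addr_ge0 ?mulr_ge0//; lra.
  by rewrite exprMn lerDl mulr_ge0.
apply: (@le_trans _ _ ((11 / 10 * y) ^+ 6)).
  by rewrite lerXn2r ?nnegrE ?addr_ge0 ?mulr_ge0//; lra.
rewrite exprMn; apply: (@le_trans _ _ (2 * y ^+ 6)).
  by rewrite ler_wpM2r//; lra.
by rewrite lerDr mulr_ge0// exprn_ge0.
Qed.

Lemma iter_sdiff_shift {R : realFieldType} j h a (v : nat -> R) s :
  iter j (sdiff h) (fun i => v (a + i)%N) s = iter j (sdiff h) v (a + s)%N.
Proof.
elim: j s => //= j IH s; rewrite /sdiff in IH *.
by rewrite !IH addnA.
Qed.

(** A difference of order [k] fits [b - k] times into a block of length [b]. Cutting the block only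
    drops the differences that straddle the cut. *)
Lemma variation_superadditive {R : realFieldType} (k b1 b2 : nat) (u : nat -> R) :
  (forall i, 0 <= u i) ->
  \sum_(s < b1 - k) u s + \sum_(s < b2 - k) u (b1 + s)%N
    <= \sum_(s < b1 + b2 - k) u s.
Proof.
move=> u0; have [b2k|b2k] := leqP k b2.
  have -> : (b1 + b2 - k = b1 + (b2 - k))%N by lia.
  rewrite (@big_split_ord _ _ _ b1 (b2 - k)) /= lerD2r.
  by apply: ler_sum_widen => //; exact: leq_subr.
have -> : (b2 - k = 0)%N by lia.
by rewrite big_ord0 addr0; apply: ler_sum_widen => //; lia.
Qed.

Lemma half_split b : (1 < b)%N -> exists b1 b2, [/\ b = (b1 + b2)%N,
  (0 < b1)%N, (0 < b2)%N, (b <= 3 * b1)%N & (b <= 3 * b2)%N].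
Proof. by move=> b1; exists b./2, (b - b./2)%N; split; lia. Qed.

(* The block estimate, by recursive halving: a block whose partial sums are at
   most [tau] is estimated by the interpolation inequality; the others are cut
   in two, and [F] pays for the cuts. *)
Lemma dyadic_block_bound (R : realType) (k : nat) (C6 : R) : 0 < C6 ->
  exists C A kappa : R, [/\ 0 < C, 0 < A, 0 < kappa &
  forall d (T : measurableType d) (P : probability T R) n (X : nat -> T -> R)
    (b0 : nat) (t tau : R),
    (forall i, measurable_fun setT (X i)) ->
    (forall a b, (0 < b)%N -> (a + b <= n)%N ->
      mean_le P (fun w => (\sum_(i < b) X (a + i)%N w) ^+ 6) (C6 * b%:R ^+ 3)) ->
    0 < tau -> 2 * tau * b0%:R ^+ k <= t ->
    forall b a, (0 < b <= b0)%N -> (a + b <= n)%N ->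
    exists N F : T -> R,
      [/\ mean_le P (fun w => N w ^+ 6) (A * b%:R ^+ 3),
          mean_le P F (kappa * b%:R ^+ 2 / tau ^+ 4),
          measurable_fun setT N,
          forall w j, (j <= b)%N -> `|\sum_(i < j) X (a + i)%N w| <= N w &
          forall w (v : nat -> R), \sum_(i < b) X (a + i)%N w * v i <=
            4^-1 * (\sum_(i < b) v i ^+ 2) +
            t * (\sum_(s < b - k.+1) `|iter k.+1 D1 v s|) +
            C * N w ^+ 2 / b%:R + F w]].
Proof.
move=> C60; have [Cg Cg0 HCg] := @discrete_interpolation R k.
have [K K1 HK] : exists2 K : R, 1 <= K &
    forall x y, 0 <= x -> 0 <= y -> (x + y) ^+ 6 <= K * x ^+ 6 + 2 * y ^+ 6.
  by exists (11 ^+ 6); [rewrite exprn_ege1//; lra|exact: addr_expr6_le].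
have K0 : 0 <= K by rewrite (le_trans _ K1).
(* [Cg ^+ 2] comes from completing the square after interpolation. The added 1 covers blocks of
   length 1, where x v <= v^2 / 4 + x^2. *)
have [C CE C0] : exists2 C, C = Cg ^+ 2 + 1 & 0 < C.
  by exists (Cg ^+ 2 + 1); rewrite // addr_gt0// exprn_gt0.
(* The sum over the left half then contributes A b1^3 / 3, and b1^3 / 3 + 2 (b1^3 + b2^3) <= b^3 as
   both parts have length at least b / 3. *)
have [A AE A0] : exists2 A, A = 3 * K * C6 & 0 < A.
  by exists (3 * K * C6); rewrite // !mulr_gt0// (lt_le_trans _ K1).
(* Cutting a block of length b costs 6 C A b^2 / tau^4 in the mean. As b1^2 + b2^2 <= 3/4 b^2, a
   constant four times as large also pays for the cuts inside both parts. *)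
exists C, A, (24 * C * A); split => //; first by rewrite !mulr_gt0.
move=> d T P n X b0 t tau mX EX tau0 tb0 b.
elim/ltn_ind: b => b IH a /andP[bgt0 bb0] ab.
have bR0 : (0 : R) < b%:R by rewrite ltr0n.
have t0 : 0 <= t by apply: le_trans tb0; rewrite !mulr_ge0// ?exprn_ge0// ltW.
have [b1|bgt1] := leqP b 1.
  have {b1 bgt0 bb0 bR0 IH} bE : b = 1%N by apply/eqP; rewrite eqn_leq b1.
  move: ab; rewrite {b}bE => ab.
  exists (fun w => `|X a w|), (fun=> 0); split.
  - have := EX a 1%N isT ab; rewrite expr1n !mulr1.
    apply: mean_leS; first by apply: measurable_funX; exact: measurableT_comp.
      move=> w; rewrite big_ord_recl big_ord0 addr0 addn0.
      by rewrite exprn_ge0//= -normrX ger0_norm// exprn_even_ge0.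
    by rewrite AE; have := C60; nra.
  - have := mean_le_cst P (lexx (0 : R)); apply: mean_leS => //.
      by move=> w; rewrite lexx.
    by rewrite divr_ge0 ?exprn_ge0 ?mulr_ge0 ?ltW.
  - exact: measurableT_comp.
  - move=> w [_|[_|//]]; first by rewrite big_ord0 normr0.
    by rewrite big_ord_recl big_ord0 addr0 addn0.
  - move=> w v; have -> : (1 - k.+1 = 0)%N by rewrite subSS sub0n.
    rewrite !big_ord_recl !big_ord0 !addr0 addn0.
    rewrite real_normK ?num_real//= mulr0 addr0 divr1.
    have := sqr_ge0 (2^-1 * v 0%N - X a w); have := sqr_ge0 (Cg * X a w).
    rewrite CE; nra.
have [b1 [b2 [bE b1gt0 b2gt0 b31 b32]]] := half_split bgt1.
have b1b : (b1 < b)%N by rewrite bE -addn1 leq_add2l.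
have b2b : (b2 < b)%N by rewrite bE addnC -addn1 leq_add2l.
have b1b0 : (0 < b1 <= b0)%N by rewrite b1gt0 (leq_trans (ltnW b1b)).
have b2b0 : (0 < b2 <= b0)%N by rewrite b2gt0 (leq_trans (ltnW b2b)).
have ab2 : (a + b1 + b2 <= n)%N by rewrite -addnA -bE.
have ab1 : (a + b1 <= n)%N by rewrite (leq_trans _ ab2)// leq_addr.
have b1R : (0 : R) < b1%:R by rewrite ltr0n.
have b2R : (0 : R) < b2%:R by rewrite ltr0n.
have bER : b%:R = b1%:R + b2%:R :> R by rewrite bE natrD.
have b31R : b%:R <= 3 * b1%:R :> R by rewrite -natrM ler_nat.
have b32R : b%:R <= 3 * b2%:R :> R by rewrite -natrM ler_nat.
have [N1 [F1 [EN1 EF1 mN1 pN1 iN1]]] := IH b1 b1b a b1b0 ab1.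
have [N2 [F2 [EN2 EF2 mN2 pN2 iN2]]] := IH b2 b2b (a + b1)%N b2b0 ab2.
pose S w := \sum_(i < b1) X (a + i)%N w.
have mS : measurable_fun setT S by exact: measurable_sum.
pose mx w := Num.max (N1 w) (N2 w).
(* A partial sum ending in the right part is the whole left sum plus a partial sum of the right
   part. The recursion thus proves a maximal inequality from moments of single sums. *)
pose N w := `|S w| + mx w.
have mmx : measurable_fun setT mx by exact: measurable_maxr.
have mN : measurable_fun setT N.
  by apply: measurable_funD => //; exact: measurableT_comp.
have N10 w : 0 <= N1 w by apply: le_trans (pN1 w 0%N isT); rewrite big_ord0 normr0.
have N20 w : 0 <= N2 w by apply: le_trans (pN2 w 0%N isT); rewrite big_ord0 normr0.
have mx0 w : 0 <= mx w by rewrite le_max N10.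
have N0 w : 0 <= N w by rewrite addr_ge0.
have mxN w : mx w <= N w by rewrite /N lerDr.
have N1N w : N1 w <= N w by apply: le_trans (mxN w); rewrite le_max lexx.
have N2N w : N2 w <= N w by apply: le_trans (mxN w); rewrite le_max lexx orbT.
have EN : mean_le P (fun w => N w ^+ 6) (A * b%:R ^+ 3).
  have H := mean_leD (mean_leZ K0 (EX a b1 b1gt0 ab1))
    (mean_leZ (ler0n R 2) (mean_leD EN1 EN2)).
  apply: mean_leS H; first exact: measurable_funX.
    move=> w; rewrite exprn_ge0//=; apply: (le_trans (HK _ _ _ _)) => //.
    apply: lerD; first by rewrite ler_wpM2l// -normrX ger0_norm// exprn_even_ge0.
    rewrite ler_wpM2l//; rewrite /mx; case: (leP (N1 w) (N2 w)) => _.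
      by rewrite lerDr exprn_ge0.
    by rewrite lerDl exprn_ge0.
  rewrite -mulrDr; have -> : K * (C6 * b1%:R ^+ 3) = A * (b1%:R ^+ 3 / 3) :> R.
    by rewrite AE; field.
  have -> : 2 * (A * (b1%:R ^+ 3 + b2%:R ^+ 3)) = A * (2 * (b1%:R ^+ 3 + b2%:R ^+ 3)) by ring.
  rewrite -mulrDr ler_wpM2l ?(ltW A0)// bER.
  move: b31R b32R b1R b2R; rewrite bER; move: b1%:R b2%:R => x y xy yx x0 y0.
  rewrite -subr_ge0.
  have -> : (x + y) ^+ 3 - (x ^+ 3 / 3 + 2 * (x ^+ 3 + y ^+ 3)) =
    4 / 3 * (x ^+ 2 * (2 * y - x)) + y ^+ 2 * (2 * x - y) +
    1 / 3 * (x ^+ 2 * y) + x * y ^+ 2 by field.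
  have y2x : 0 <= 2 * y - x by lra.
  have x2y : 0 <= 2 * x - y by lra.
  have [x0' y0'] := (ltW x0, ltW y0).
  by rewrite !addr_ge0// !mulr_ge0// exprn_ge0.
have NR6 w : 0 <= N w ^+ 6 by exact: exprn_ge0.
(* Each part has length at least b / 3, so after a cut the two terms C N^2 / b add up to at most 6 C
   N^2 / b. For N > tau this is at most [c * N ^+ 6]. *)
pose c := 6 * C / (b%:R * tau ^+ 4).
have c0 : 0 <= c by rewrite divr_ge0 ?mulr_ge0 ?exprn_ge0 ?ltW.
have pN' w j : (j <= b)%N -> `|\sum_(i < j) X (a + i)%N w| <= N w.
  move=> jb; have [jb1|jb1] := leqP j b1.
    by apply: le_trans (N1N w); exact: pN1.
  rewrite -(subnKC (ltnW jb1)).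
  rewrite big_split_ord /=; apply: (le_trans (ler_normD _ _)); rewrite lerD2l.
  apply: (@le_trans _ _ (N2 w)); last by rewrite le_max lexx orbT.
  under eq_bigr do rewrite addnA.
  by apply: pN2; rewrite leq_subLR -bE.
exists N, (fun w => c * N w ^+ 6 + (F1 w + F2 w)); split => //.
- apply: mean_leS (mean_leD (mean_leZ c0 EN) (mean_leD EF1 EF2)).
  + case: EF1 => mF1 _ _; case: EF2 => mF2 _ _.
    apply: measurable_funD; last exact: measurable_funD.
    by apply: measurable_funM => //; exact: measurable_funX.
  + move=> w; rewrite lexx andbT; case: EF1 => _ F10 _; case: EF2 => _ F20 _.
    by apply: addr_ge0; [exact: mulr_ge0|exact: addr_ge0].
  + rewrite -mulrDl -mulrDr.
    have -> : c * (A * b%:R ^+ 3) = 24 * C * A * (b%:R ^+ 2 / 4) / tau ^+ 4.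
      by rewrite /c; field; rewrite !gt_eqF.
    rewrite -mulrDl -mulrDr ler_wpM2r ?invr_ge0 ?exprn_ge0 ?(ltW tau0)//.
    rewrite ler_wpM2l//; first by rewrite !mulr_ge0 ?ltW.
    move: b31R b32R b1R b2R; rewrite bER; move: b1%:R b2%:R => x y xy yx x0 y0.
    nra.
- move=> w v; set V := \sum_(s < b - k.+1) _; set Q := \sum_(i < b) v i ^+ 2.
  have V0 : 0 <= V by apply: sumr_ge0.
  have F0 : 0 <= F1 w + F2 w.
    by case: EF1 => _ F10 _; case: EF2 => _ F20 _; rewrite addr_ge0.
  (* Without a cut, 2 N b^k <= t absorbs the variation term of the interpolation inequality. The
     other term is split by completing the square, and Cauchy-Schwarz bounds [X1 ^+ 2] by
     [b * Q]. *)
  have [Ntau|Ntau] := leP (N w) tau.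
    pose X1 := \sum_(i < b) `|v i|.
    have H1 := @abel_bound R (fun i => X (a + i)%N w) v _ b (pN' w) bgt0.
    have H2 := HCg b v b.-1 (ltac:(by rewrite prednK)).
    have H3 := sum_norm_sqr_le b v.
    move: H1 H2 H3; rewrite -/V -/X1 -/Q.
    set Z := `|v b.-1| + _; set Y := \sum_(i < b) _ => H1 H2 H3.
    have bk : b%:R ^+ k <= b0%:R ^+ k :> R by rewrite lerXn2r ?nnegrE// ler_nat.
    have X1_0 : 0 <= X1 by apply: sumr_ge0.
    have H4 : b%:R * (N w * Z) <= N w * (Cg * X1) + b%:R * (t * V).
      rewrite mulrCA; apply: (@le_trans _ _ (N w * (Cg * X1 + 2 * b%:R ^+ k.+1 * V))).
        by rewrite ler_wpM2l.
      rewrite mulrDr lerD2l exprS.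
      have -> : N w * (2 * (b%:R * b%:R ^+ k) * V) =
        b%:R * (2 * N w * b%:R ^+ k * V) by ring.
      rewrite (ler_wpM2l (ltW bR0))// ler_wpM2r//; apply: le_trans tb0.
      by rewrite ler_pM ?mulr_ge0 ?exprn_ge0// ler_wpM2l.
    have H5 : N w * (Cg * X1) <= 4^-1 * X1 ^+ 2 + Cg ^+ 2 * N w ^+ 2.
      have := sqr_ge0 (2^-1 * X1 - Cg * N w); nra.
    have H6 : Y <= N w * Z by apply: le_trans H1; exact: ler_norm.
    rewrite -(ler_pM2l bR0); apply: (@le_trans _ _ (b%:R * (N w * Z))).
      by rewrite ler_wpM2l// ltW.
    apply: (le_trans H4).
    have -> : b%:R * (4^-1 * Q + t * V + C * N w ^+ 2 / b%:R +
        (c * N w ^+ 6 + (F1 w + F2 w))) =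
      4^-1 * (b%:R * Q) + b%:R * (t * V) + C * N w ^+ 2 +
        b%:R * (c * N w ^+ 6 + (F1 w + F2 w)) by field; rewrite gt_eqF.
    have : 0 <= b%:R * (c * N w ^+ 6 + (F1 w + F2 w)).
      by apply: mulr_ge0; [exact: ltW|apply: addr_ge0 => //; exact: mulr_ge0].
    have := sqr_ge0 (N w); rewrite CE; lra.
  have i1 := iN1 w v; have := iN2 w (fun i => v (b1 + i)%N).
  under eq_bigr do rewrite -addnA.
  under [X in _ <= _ + t * X + _ + _ -> _]eq_bigr do rewrite iter_sdiff_shift.
  move=> i2.
  have -> : \sum_(i < b) X (a + i)%N w * v i = \sum_(i < b1) X (a + i)%N w * v i +
      \sum_(i < b2) X (a + (b1 + i))%N w * v (b1 + i)%N.
    by rewrite [in LHS]bE big_split_ord.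
  apply: (le_trans (lerD i1 i2)).
  have QE : Q = \sum_(i < b1) v i ^+ 2 + \sum_(i < b2) v (b1 + i)%N ^+ 2.
    by rewrite /Q [in LHS]bE big_split_ord.
  have VE := @variation_superadditive R k.+1 b1 b2
    (fun s => `|iter k.+1 D1 v s|) ltac:(done).
  move: VE; rewrite -bE -/V.
  have CN : C * N1 w ^+ 2 / b1%:R + C * N2 w ^+ 2 / b2%:R <= c * N w ^+ 6.
    have n1 : C * N1 w ^+ 2 / b1%:R <= C * N w ^+ 2 * (3 / b%:R).
      rewrite ler_pM ?mulr_ge0 ?sqr_ge0 ?invr_ge0 ?(ltW C0) ?(ltW b1R)//.
        by rewrite ler_wpM2l ?(ltW C0)// lerXn2r ?nnegrE.
      by rewrite ler_pdivlMr// ler_pdivrMl// mulrC.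
    have n2 : C * N2 w ^+ 2 / b2%:R <= C * N w ^+ 2 * (3 / b%:R).
      rewrite ler_pM ?mulr_ge0 ?sqr_ge0 ?invr_ge0 ?(ltW C0) ?(ltW b2R)//.
        by rewrite ler_wpM2l ?(ltW C0)// lerXn2r ?nnegrE.
      by rewrite ler_pdivlMr// ler_pdivrMl// mulrC.
    have n3 : C * N w ^+ 2 * (3 / b%:R) + C * N w ^+ 2 * (3 / b%:R) <= c * N w ^+ 6.
      have -> : c * N w ^+ 6 = 6 * C * N w ^+ 2 / b%:R * (N w ^+ 4 / tau ^+ 4).
        by rewrite /c; field; rewrite !gt_eqF.
      have -> : C * N w ^+ 2 * (3 / b%:R) + C * N w ^+ 2 * (3 / b%:R) =
         6 * C * N w ^+ 2 / b%:R * 1 by field; rewrite gt_eqF.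
      rewrite ler_wpM2l//.
        by rewrite divr_ge0 ?(ltW bR0)// !mulr_ge0 ?sqr_ge0 ?(ltW C0).
      by rewrite ler_pdivlMr ?exprn_gt0// mul1r lerXn2r ?nnegrE ?(ltW tau0) ?N0// ltW.
    by apply: (le_trans (lerD n1 n2)).
  have CNw : 0 <= C * N w ^+ 2 / b%:R.
    by rewrite divr_ge0 ?(ltW bR0)// mulr_ge0 ?sqr_ge0 ?(ltW C0).
  move=> VE; have := ler_wpM2l t0 VE; rewrite mulrDr QE; lra.
Qed.

Lemma sum_ord_interval {R : realFieldType} n (F : nat -> R) a b :
  (a + b <= n)%N ->
  \sum_(i < n | (a <= i < a + b)%N) F i = \sum_(i < b) F (a + i)%N.
Proof.
move=> abn; rewrite -(big_mkord (fun i => a <= i < a + b)%N F).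
have -> : \sum_(i < b) F (a + i)%N = \sum_(0 <= i < b) F (i + a)%N.
  by rewrite big_mkord; apply: eq_bigr => i _; rewrite addnC.
have -> : \sum_(0 <= i < b) F (i + a)%N = \sum_(a <= i < a + b) F i.
  by rewrite -{2}[a]add0n big_addn addKn.
rewrite [RHS](big_nat_widen _ _ n)// [RHS](big_nat_widenl _ 0)//.
by apply: eq_bigl => i; rewrite andbC.
Qed.

Definition extend_ord {R : realFieldType} n (x : 'I_n -> R) (i : nat) : R :=
  if insub i is Some o then x o else 0.

Lemma extend_ordE {R : realFieldType} n (x : 'I_n -> R) (i : 'I_n) :
  extend_ord x i = x i.
Proof. by rewrite /extend_ord valK. Qed.

(** Blocks of length [b0] are peeled off from the left, and [b / b0 + 1] accounts for a last,
    shorter one. The term C N^2 / b of each block joins [F] through z <= 1 + z^3 with z = N^2 / b,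
    so the sixth moment is again sufficient. *)
Lemma noise_blocks_bound (R : realType) (k : nat) (C6 : R) : 0 < C6 ->
  exists2 K : R, 0 < K &
  forall d (T : measurableType d) (P : probability T R) n (X : nat -> T -> R)
    (b0 : nat) (t tau : R),
    (forall i, measurable_fun setT (X i)) ->
    (forall a b, (0 < b)%N -> (a + b <= n)%N ->
      mean_le P (fun w => (\sum_(i < b) X (a + i)%N w) ^+ 6) (C6 * b%:R ^+ 3)) ->
    0 < tau -> 2 * tau * b0%:R ^+ k <= t -> (0 < b0)%N ->
    forall b a, (a + b <= n)%N ->
    exists2 F : T -> R,
      mean_le P F (K * (1 + b0%:R ^+ 2 / tau ^+ 4) * (b%:R / b0%:R + 1)) &
      forall w (v : nat -> R), \sum_(i < b) X (a + i)%N w * v i <=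
            4^-1 * (\sum_(i < b) v i ^+ 2) +
            t * (\sum_(s < b - k.+1) `|iter k.+1 D1 v s|) + F w.
Proof.
move=> C60; have [C [A [kappa [C0 A0 kappa0 H]]]] := dyadic_block_bound k C60.
pose K := C * (1 + A) + kappa.
have K0 : 0 < K by rewrite addr_gt0// mulr_gt0// addr_gt0.
exists K => // d T P n X b0 t tau mX EX tau0 tb0 b0gt0 b.
have b0R : (0 : R) < b0%:R by rewrite ltr0n.
have t0 : 0 <= t by apply: le_trans tb0; rewrite !mulr_ge0// ?exprn_ge0// ltW.
pose B := K * (1 + b0%:R ^+ 2 / tau ^+ 4).
have Q0 : 0 <= b0%:R ^+ 2 / tau ^+ 4 by rewrite divr_ge0 ?exprn_ge0// ltW.
have B0 : 0 <= B by rewrite mulr_ge0 ?(ltW K0)// addr_ge0.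
have one b' a : (0 < b' <= b0)%N -> (a + b' <= n)%N -> exists2 F : T -> R,
      mean_le P F B & forall w (v : nat -> R), \sum_(i < b') X (a + i)%N w * v i <=
            4^-1 * (\sum_(i < b') v i ^+ 2) +
            t * (\sum_(s < b' - k.+1) `|iter k.+1 D1 v s|) + F w.
  move=> b'b0 ab'; have [N [F [EN EF mN _ iN]]] := H _ _ _ _ _ _ _ _ mX EX tau0 tb0 _ _ b'b0 ab'.
  have /andP[b'0 b'le] := b'b0.
  have b'R : (0 : R) < b'%:R by rewrite ltr0n.
  exists (fun w => C * N w ^+ 2 / b'%:R + F w); last first.
    by move=> w v; rewrite addrA; exact: iN.
  have E1 := mean_leD (mean_leZ (ltW C0) (mean_leD (mean_le_cst P (@ler01 R))
    (mean_leZ (c := (b'%:R ^+ 3)^-1) _ EN))) EF.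
  case: EF (EF) => mF F0 _ EF.
  apply: mean_leS (E1 _).
  - apply: measurable_funD => //; apply: measurable_funM => //.
    by apply: measurable_funM => //; exact: measurable_funX.
  - move=> w; have CN : 0 <= C * N w ^+ 2 / b'%:R.
      by apply: divr_ge0 => //; apply: mulr_ge0; [exact: ltW|exact: sqr_ge0].
    rewrite addr_ge0//= lerD2r -mulrA ler_wpM2l ?(ltW C0)//.
    have -> : (b'%:R ^+ 3)^-1 * N w ^+ 6 = (N w ^+ 2 / b'%:R) ^+ 3.
      by field; rewrite gt_eqF.
    have : 0 <= N w ^+ 2 / b'%:R by rewrite divr_ge0 ?sqr_ge0 ?(ltW b'R).
    move: (N w ^+ 2 / b'%:R) => z z0.
    have [z1|z1] := leP z 1; first by rewrite (le_trans z1)// lerDl exprn_ge0.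
    rewrite (@le_trans _ _ (z ^+ 3)) ?lerDr//.
    by rewrite exprS ler_peMr// exprn_ege1// ltW.
  - have -> : (b'%:R ^+ 3)^-1 * (A * b'%:R ^+ 3) = A by field; rewrite gt_eqF.
    rewrite /B [leRHS]mulrDr [K * 1]mulr1 lerD//.
      by rewrite /K lerDl ltW.
    rewrite -[leLHS]mulrA ler_pM ?(ltW kappa0) ?divr_ge0 ?exprn_ge0 ?(ltW tau0)//.
      by rewrite /K lerDr mulr_ge0 ?(ltW C0) ?addr_ge0 ?(ltW A0).
    rewrite ler_wpM2r ?invr_ge0 ?exprn_ge0 ?(ltW tau0)//.
    by rewrite lerXn2r ?nnegrE// ler_nat.
  - by rewrite invr_ge0 exprn_ge0.
elim/ltn_ind: b => b IH a ab.
have [b0E|bgt0] := posnP b.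
  exists (fun=> 0); last first.
    move=> w v; rewrite b0E sub0n !big_ord0; lra.
  have := mean_le_cst P (lexx (0 : R)); apply: mean_leS => //.
    by move=> w; rewrite lexx.
  by rewrite mulr_ge0// b0E mul0r add0r.
have [bb0|bb0] := leqP b b0.
  have [F EF iF] := one b a (introT andP (conj bgt0 bb0)) ab.
  exists F => //; case: (EF) => mF F0 _; apply: mean_leS EF => //.
    by move=> w; rewrite F0 lexx.
  by rewrite ler_peMr// lerDr divr_ge0.
have bE : b = (b0 + (b - b0))%N by rewrite subnKC// ltnW.
have ab' : (a + b0 + (b - b0) <= n)%N by rewrite -addnA -bE.
have ab0 : (a + b0 <= n)%N by rewrite (leq_trans _ ab')// leq_addr.
have [F1 EF1 iF1] := one b0 a (introT andP (conj b0gt0 (leqnn _))) ab0.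
have b'lt : (b - b0 < b)%N by rewrite ltn_subrL b0gt0.
have [F2 EF2 iF2] := IH _ b'lt (a + b0)%N ab'.
exists (fun w => F1 w + F2 w).
  have := mean_leD EF1 EF2; case: (EF1) => mF1 F10 _; case: (EF2) => mF2 F20 _.
  apply: mean_leS; first exact: measurable_funD.
    by move=> w; rewrite lexx andbT addr_ge0.
  rewrite -/B -[X in X + _]mulr1 -mulrDr ler_wpM2l//.
  rewrite natrB ?(ltnW bb0)// mulrBl divff ?gt_eqF//; lra.
move=> w v.
have i1 := iF1 w v; have := iF2 w (fun i => v (b0 + i)%N).
under eq_bigr do rewrite -addnA.
under [X in _ <= _ + t * X + _ -> _]eq_bigr do rewrite iter_sdiff_shift.
move=> i2.
have -> : \sum_(i < b) X (a + i)%N w * v i = \sum_(i < b0) X (a + i)%N w * v i +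
    \sum_(i < b - b0) X (a + (b0 + i))%N w * v (b0 + i)%N.
  by rewrite [in LHS]bE big_split_ord.
apply: (le_trans (lerD i1 i2)).
have QE : \sum_(i < b) v i ^+ 2 =
    \sum_(i < b0) v i ^+ 2 + \sum_(i < b - b0) v (b0 + i)%N ^+ 2.
  by rewrite [in LHS]bE big_split_ord.
have VE := @variation_superadditive R k.+1 b0 (b - b0)
  (fun s => `|iter k.+1 D1 v s|) ltac:(done).
move: VE; rewrite -bE => VE; have := ler_wpM2l t0 VE; rewrite mulrDr QE; lra.
Qed.

(* Cuts [0, n) into blocks of length about [n / L]. *)
Lemma noise_bound (R : realType) (k : nat) (c M sigma : R) :
  0 < c -> 0 < M -> 0 < sigma ->
  exists2 K : R, 0 < K &
  forall d (T : measurableType d) (P : probability T R) n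
    (X : 'I_n -> {RV P >-> R}) (L : R),
    mutually_independent X -> (forall i, 'E_P[X i] = 0)%E ->
    (forall i (t : R), 0 < t -> (P [set w | (t < `|X i w|)%R] <=
       (M * expR (- (t ^+ 2 / (2 * sigma ^+ 2))))%:E)%E) ->
    1 <= L -> L ^+ (2 * k + 3) = n%:R ->
    exists2 F : T -> R, mean_le P F (K * L) &
      forall w (v : nat -> R), \sum_(i < n) X i w * v i <=
            4^-1 * (\sum_(i < n) v i ^+ 2) +
            c * L * n%:R ^+ k * (\sum_(s < n - k.+1) `|iter k.+1 D1 v s|) + F w.
Proof.
move=> c0 M0 sigma0; have [C6 C60 H6] := sixth_moment_le M0 sigma0.
have [K K0 HK] := @noise_blocks_bound R k C6 C60.
pose Q : R := 2 ^+ (4 * k + 6) / c ^+ 4.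
have Q0 : 0 <= Q by rewrite divr_ge0 ?exprn_ge0// ltW.
exists (K * (1 + Q) * 2); first by rewrite !mulr_gt0// ltr_wpDr.
move=> d T P n X L indep mean tail L1 Ln.
have L0 : 0 < L by apply: lt_le_trans L1.
have n0 : (0 : R) < n%:R by rewrite -Ln exprn_gt0.
have LnL : L <= n%:R by rewrite -Ln addnS exprS ler_peMr ?(ltW L0)// exprn_ege1.
pose z := n%:R / L.
have z1 : 1 <= z by rewrite ler_pdivlMr// mul1r.
have z0 : 0 < z by apply: lt_le_trans z1.
(* As z >= 1, this integer lies between z and 2 z. *)
pose b0 := (Num.truncn z).+1.
have /andP[zl zu] := truncn_itv (ltW z0).
have zb0 : z <= b0%:R by exact: ltW.
have b02z : b0%:R <= 2 * z by rewrite /b0 -natr1; lra.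
have b0R : (0 : R) < b0%:R by rewrite ltr0n.
pose t := c * L * n%:R ^+ k.
have t0 : 0 < t by rewrite !mulr_gt0// exprn_gt0.
(* The largest threshold allowed by [2 * tau * b0 ^ k <= t]. *)
pose tau := t / (2 * b0%:R ^+ k).
have tau0 : 0 < tau by rewrite divr_gt0// mulr_gt0// exprn_gt0.
have tb0 : 2 * tau * b0%:R ^+ k <= t.
  rewrite /tau le_eqVlt; apply/orP; left; apply/eqP; field.
  by rewrite expf_neq0// gt_eqF.
pose X' i w := extend_ord (fun j => X j w) i.
have mX' i : measurable_fun setT (X' i).
  rewrite /X' /extend_ord; case: insub => [j|]; last exact: measurable_cst.
  exact: measurable_funP.
have EX' a b : (0 < b)%N -> (a + b <= n)%N ->
    mean_le P (fun w => (\sum_(i < b) X' (a + i)%N w) ^+ 6) (C6 * b%:R ^+ 3).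
  move=> bgt0 abn; pose J := [set i : 'I_n | (a <= i < a + b)%N]%SET.
  have SJ w : \sum_(i < b) X' (a + i)%N w = \sum_(i in J) X i w.
    rewrite -(@sum_ord_interval _ n (fun i => X' i w) a b)//.
    apply: eq_big => [i|i _]; first by rewrite finset.inE.
    by rewrite /X' extend_ordE.
  have cJ : #|J| = b.
    apply/eqP; rewrite -(eqr_nat R) -sum1_card natr_sum.
    have := @sum_ord_interval R n (fun=> 1) a b abn.
    rewrite [X in _ = X]sumr_const card_ord.
    move=> <-; apply/eqP.
    by apply: eq_bigl => i; rewrite finset.inE.
  split.
  - by apply: measurable_funX; exact: measurable_sum.
  - by move=> w; rewrite exprn_even_ge0.
  - under eq_integral do rewrite SJ.
    by rewrite -cJ; apply: H6 => //; rewrite cJ.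
have [F EF iF] := HK _ _ _ _ _ _ _ _ mX' EX' tau0 tb0 isT n 0%N (leqnn _).
exists F; last first.
  move=> w v; have := iF w v; congr (_ <= _).
  by apply: eq_bigr => i _; rewrite add0n /X' extend_ordE.
case: (EF) => mF F0 _; apply: mean_leS EF => //.
  by move=> w; rewrite F0 lexx.
(* Here the size of [L] is decisive: up to a constant the ratio is (n / L^(2k+3))^2, which equals
   1. *)
have h1 : b0%:R ^+ 2 / tau ^+ 4 <= Q.
  have -> : b0%:R ^+ 2 / tau ^+ 4 = 16 * (b0%:R ^+ 2 * (b0%:R ^+ k) ^+ 4) / t ^+ 4.
    by rewrite /tau; field; rewrite expf_neq0 ?gt_eqF.
  apply: (@le_trans _ _ (16 * ((2 * z) ^+ 2 * ((2 * z) ^+ k) ^+ 4) / t ^+ 4)).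
    rewrite ler_wpM2r ?invr_ge0 ?exprn_ge0 ?(ltW t0)// ler_wpM2l//.
    have z20 : 0 <= 2 * z by rewrite mulr_ge0 ?(ltW z0).
    rewrite ler_pM ?exprn_ge0// lerXn2r ?nnegrE ?exprn_ge0//.
    by rewrite lerXn2r ?nnegrE.
  have nE : n%:R = (L ^+ k) ^+ 2 * L ^+ 3 :> R by rewrite -Ln exprD mulnC exprM.
  have u0 : L ^+ k != 0 by rewrite expf_neq0 ?gt_eqF.
  have m0 : n%:R ^+ k != 0 :> R by rewrite expf_neq0 ?gt_eqF.
  have zk : (2 * (n%:R / L)) ^+ k = 2 ^+ k * (n%:R ^+ k / L ^+ k).
    by rewrite exprMn expr_div_n.
  rewrite /t /z /Q zk exprD [(4 * k)%N]mulnC exprM.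
  move: (2 ^+ k) => p.
  have -> : 16 * ((2 * (n%:R / L)) ^+ 2 * (p * (n%:R ^+ k / L ^+ k)) ^+ 4) /
      (c * L * n%:R ^+ k) ^+ 4 =
      p ^+ 4 * 2 ^+ 6 / c ^+ 4 * ((n%:R / ((L ^+ k) ^+ 2 * L ^+ 3)) ^+ 2).
    by field; rewrite u0 m0 !gt_eqF.
  by rewrite -nE divff ?gt_eqF// expr1n mulr1.
have h2 : n%:R / b0%:R + 1 <= 2 * L.
  have : n%:R / b0%:R <= L.
    by rewrite ler_pdivrMr// mulrC -ler_pdivrMr.
  lra.
rewrite -[leRHS]mulrA; apply: ler_pM => //.
- by rewrite mulr_ge0 ?(ltW K0)// addr_ge0// divr_ge0 ?exprn_ge0// ltW.
- by rewrite ler_wpM2l ?(ltW K0)// lerD2l.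
Qed.

(** * Splines at the design points *)

Lemma piece_ltE (R : realType) (T : seq R) (x : R) j :
  sorted <%R T -> (j < size T)%N -> (j < piece T x)%N = (T`_j <= x).
Proof.
rewrite /piece; elim: T j => //= t T IH j pT jT.
have sT : sorted <%R T by exact: path_sorted pT.
have [tx|tx] := boolP (t <= x).
  case: j jT => [|j] jT /=; first by rewrite tx.
  by rewrite ltnS in jT; rewrite add1n ltnS IH.
have T0 : count (fun u => u <= x) T = 0%N.
  apply/eqP; rewrite -leqn0 leqNgt -has_count; apply/hasPn => u uT /=.
  have /allP /(_ _ uT) tu : all (> t) T.
    by rewrite (order_path_min lt_trans pT).
  by rewrite -ltNge (lt_trans _ tu)// ltNge.
rewrite T0 addn0 ltn0; apply/esym/negbTE.
case: j jT => [|j] jT //=; rewrite -ltNge; rewrite ltnS in jT.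
have /allP /(_ _ (mem_nth 0 jT)) tu : all (> t) T.
  by rewrite (order_path_min lt_trans pT).
by rewrite (lt_trans _ tu)// ltNge.
Qed.

Lemma piece_le (R : realType) (T : seq R) (x : R) : (piece T x <= size T)%N.
Proof. exact: count_size. Qed.

Lemma sum_piece (R : realType) (T : seq R) (x : R) (F : nat -> R) :
  sorted <%R T ->
  \sum_(j < piece T x) F j = \sum_(j < size T) F j * (T`_j <= x)%R%:R.
Proof.
move=> sT; rewrite (big_ord_widen _ F (piece_le T x)) big_mkcond /=.
apply: eq_bigr => j _; rewrite piece_ltE//.
by case: ifP; rewrite ?mulr1 ?mulr0.
Qed.

Lemma derivn_expXsubC (R : comNzRingType) (a c : R) k i : (i <= k)%N ->
  ((('X - a%:P) ^+ k)^`(i)).[c] = (c - a) ^+ (k - i) *+ k ^_ i.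
Proof.
move=> ik; suff -> : (('X - a%:P) ^+ k)^`(i) = ('X - a%:P) ^+ (k - i) *+ k ^_ i.
  by rewrite hornerMn horner_exp hornerXsubC.
elim: i ik => [|i IH] ik; first by rewrite derivn0 subn0 ffactn0.
rewrite derivnS IH ?(ltnW ik)// derivMn deriv_exp derivXsubC mul1r -mulrnA.
by rewrite ffactnSr mulnC -subnS.
Qed.

Lemma poly_eq0_of_horner (R : realFieldType) (p : {poly R}) :
  (forall x, p.[x] = 0) -> p = 0.
Proof.
move=> p0; apply/eqP/negPn/negP => pn0.
have := @max_poly_roots _ p [seq i%:R | i <- iota 0 (size p)] pn0.
rewrite size_map size_iota ltnn => H.
suff: false by []; apply: H.
  by apply/allP => x _; apply/eqP; exact: p0.
by rewrite map_inj_uniq ?iota_uniq// => i j /eqP; rewrite eqr_nat => /eqP.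
Qed.

Lemma poly_vanishing_derivatives (R : realFieldType) (q : {poly R}) k (a : R) :
  (size q <= k.+1)%N -> (forall i, (i < k)%N -> q^`(i).[a] = 0) ->
  exists c, q = c *: ('X - a%:P) ^+ k.
Proof.
move=> sq q0; exists q^`N(k).[a]; apply/eqP; rewrite -subr_eq0; apply/eqP.
apply: poly_eq0_of_horner => x.
rewrite hornerD hornerN hornerZ horner_exp hornerXsubC.
have := nderiv_taylor q (mulrC a (x - a)); rewrite subrKC => ->.
have N0 i : (i < k)%N -> q^`N(i).[a] = 0.
  move=> /q0; rewrite nderivn_def hornerMn => /eqP.
  by rewrite mulrn_eq0 eqn0Ngt fact_gt0 /= => /eqP.
rewrite (big_ord_widen k.+1 (fun i => q^`N(i).[a] * (x - a) ^+ i) sq).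
rewrite big_mkcond big_ord_recr /= big1 ?add0r => [|i _]; last first.
  by case: ifP => // _; rewrite N0 ?mul0r.
case: ifP => [_|/negbT]; first by rewrite subrr.
rewrite -leqNgt => qk; rewrite nderivn_poly0//.
by rewrite horner0 mul0r subrr.
Qed.

Lemma spline_of_coefficients (R : realType) k (T : seq R) (p : {poly R})
    (c : nat -> R) : sorted <%R T -> (size p <= k.+1)%N ->
  spline_with_derivative k T
    (fun x => p.[x] + \sum_(j < size T) c j * (T`_j <= x)%R%:R * (x - T`_j) ^+ k)
    (fun x => p^`(k).[x] + \sum_(j < size T) k`!%:R * c j * (T`_j <= x)%R%:R).
Proof.
move=> sT sp.
pose P m := p + \sum_(j < m) c j *: ('X - (T`_j)%:P) ^+ k.
exists P; split.
- move=> m _; rewrite (leq_trans (size_polyD _ _))// geq_max sp /=.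
  apply: (leq_trans (size_sum _ _ _)); apply/bigmax_leqP => j _.
  by rewrite (leq_trans (size_scale_leq _ _))// size_exp_XsubC ltnS leqnn.
- move=> j i jT ik; rewrite /P big_ord_recr /= addrA [in RHS]derivnD.
  rewrite hornerD derivnZ hornerZ derivn_expXsubC 1?ltnW//.
  by rewrite subrr expr0n subn_eq0 leqNgt ik mul0rn mulr0 addr0.
- move=> x _; split.
  + rewrite /P hornerD horner_sum; congr (_ + _).
    transitivity (\sum_(j < piece T x) c j * (x - T`_j) ^+ k).
      rewrite (sum_piece x (fun j => c j * (x - T`_j) ^+ k) sT).
      by apply: eq_bigr => j _; rewrite mulrAC.
    by apply: eq_bigr => j _; rewrite hornerZ horner_exp hornerXsubC.
  + rewrite /P derivnD hornerD; congr (_ + _).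
    transitivity (\sum_(j < piece T x) k`!%:R * c j).
      by rewrite (sum_piece x (fun j => k`!%:R * c j) sT).
    rewrite raddf_sum horner_sum; apply: eq_bigr => j _ /=.
    by rewrite derivnZ hornerZ derivn_expXsubC// subnn expr0 ffactnn mulrC.
Qed.

(** Consecutive pieces share their derivatives of order below [k] at the knot, so by Taylor's
    formula they differ by a multiple of (x - t)^k. These multiples are the coordinates of the
    spline in the truncated power basis. *)
Lemma coefficients_of_spline (R : realType) k (T : seq R) (f g : R -> R) :
  sorted <%R T -> spline_with_derivative k T f g ->
  exists2 p : {poly R}, (size p <= k.+1)%N & exists c : nat -> R,
  forall x, x \in `[0, 1] ->
    f x = p.[x] + \sum_(j < size T) c j * (T`_j <= x)%R%:R * (x - T`_j) ^+ k /\
    g x = p^`(k).[x] + \sum_(j < size T) k`!%:R * c j * (T`_j <= x)%R%:R.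
Proof.
move=> sT [P [sP cP fgP]].
have jump j : exists cj, (j < size T)%N ->
    P j.+1 = P j + cj *: ('X - (T`_j)%:P) ^+ k.
  have [jT|jT] := ltnP j (size T); last by exists 0.
  have [||cj cjE] := @poly_vanishing_derivatives R (P j.+1 - P j) k T`_j.
  - rewrite (leq_trans (size_polyD _ _))// size_polyN geq_max.
    by rewrite !sP// ltnW.
  - by move=> i ik; rewrite derivnB hornerD hornerN cP// subrr.
  - by exists cj => _; rewrite -cjE addrC subrK.
have /choice [c cE] := jump.
exists (P 0%N); [exact: sP|exists c].
have PE m : (m <= size T)%N -> P m = P 0%N + \sum_(j < m) c j *: ('X - (T`_j)%:P) ^+ k.
  elim: m => [|m IH] mT; first by rewrite big_ord0 addr0.
  by rewrite cE// IH ?(ltnW mT)// big_ord_recr addrA.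
move=> x /fgP[-> ->]; rewrite PE ?piece_le//; split.
- rewrite hornerD horner_sum; congr (_ + _).
  transitivity (\sum_(j < piece T x) c j * (x - T`_j) ^+ k).
    by apply: eq_bigr => j _; rewrite hornerZ horner_exp hornerXsubC.
  rewrite (sum_piece x (fun j => c j * (x - T`_j) ^+ k) sT).
  by apply: eq_bigr => j _; rewrite mulrAC.
- rewrite derivnD hornerD; congr (_ + _).
  transitivity (\sum_(j < piece T x) k`!%:R * c j).
    rewrite raddf_sum horner_sum; apply: eq_bigr => j _ /=.
    by rewrite derivnZ hornerZ derivn_expXsubC// subnn expr0 ffactnn mulrC.
  by rewrite (sum_piece x (fun j => k`!%:R * c j) sT).
Qed.

Lemma total_variation_step_le (R : realType) (c0 : R) (a T : nat -> R) m :
  (total_variation 0 1 (fun x => c0 + \sum_(j < m) a j * (T j <= x)%R%:R)%R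
    <= (\sum_(j < m) `|a j|)%:E)%E.
Proof.
elim: m => [|m IH].
  rewrite nondecreasing_total_variation//; last by move=> x y _ _ _; rewrite !big_ord0.
  by rewrite !big_ord0 subrr.
pose st (x : R) : R := (T m <= x)%R%:R.
have nd (b : R) : 0 <= b -> {in `[0, 1] &, nondecreasing_fun (fun x => b * st x)}.
  move=> b0 x y _ _ xy; rewrite ler_wpM2l// /st ler_nat.
  by case: (boolP (T m <= x)) => // /le_trans -> .
have nd_le (b : R) : 0 <= b ->
    (total_variation 0 1 (fun x => b * st x)%R <= b%:E)%E.
  move=> b0; rewrite nondecreasing_total_variation//; last exact: nd.
  rewrite lee_fin -mulrBr ler_piMr// lerBlDr (@le_trans _ _ 1)//.
    by rewrite /st lern1; case: (_ <= _)%R.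
  by rewrite lerDl.
have step : (total_variation 0 1 (fun x => a m * st x)%R <= `|a m|%:E)%E.
  have [am|am] := leP 0 (a m); first by rewrite ger0_norm//; exact: nd_le.
  have -> : (fun x => a m * st x) = \- (fun x => - a m * st x).
    by apply/funext => x /=; rewrite mulNr opprK.
  by rewrite total_variationN ltr0_norm// nd_le// oppr_ge0 ltW.
have -> : (fun x => c0 + \sum_(j < m.+1) a j * (T j <= x)%R%:R) =
  (fun x => c0 + \sum_(j < m) a j * (T j <= x)%R%:R) \+ (fun x => a m * st x).
  by apply/funext => x /=; rewrite big_ord_recr /= addrA.
apply: (le_trans (total_variation_le _ _ _)) => //.
by rewrite big_ord_recr /= EFinD leeD.
Qed.

(** Each interval between consecutive knots contributes the jump at its right end. A knot at 0 would
    hide its jump from [0, 1]; a knot at 1, which occurs for k = 0, does not, because the steps are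
    right-continuous. *)
Lemma total_variation_step_ge (R : realType) (c0 : R) (a T : nat -> R) m g :
  (forall j, (j < m)%N -> 0 < T j <= 1) ->
  (forall i j, (i < j < m)%N -> T i < T j) ->
  (forall x, x \in `[0, 1] -> g x = c0 + \sum_(j < m) a j * (T j <= x)%R%:R) ->
  ((\sum_(j < m) `|a j|)%:E <= total_variation 0 1 g)%E.
Proof.
move=> T01 Tm gE; case: m => [|m] in T01 Tm gE *.
  by rewrite big_ord0; apply: total_variation_ge0; exact: ler01.
have gT j : (j < m.+1)%N -> g (T j) = c0 + \sum_(i < j.+1) a i.
  move=> jm; have /andP[Tj0 Tj1] := T01 _ jm.
  rewrite gE ?in_itv/= ?Tj1 ?(ltW Tj0)//; congr (_ + _).
  rewrite (big_ord_widen m.+1 a jm) [RHS]big_mkcond /=.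
  apply: eq_bigr => i _; rewrite ltnS.
  case: (ltngtP i j) => [ij|ij|->]; last by rewrite lexx mulr1.
    by rewrite ltW ?mulr1// Tm// ij.
  by rewrite leNgt Tm ?ij//= mulr0.
have g0 : g 0 = c0.
  rewrite gE ?in_itv/= ?lexx ?ler01// big1 ?addr0// => i _.
  by have /andP[Ti _] := T01 _ (ltn_ord i); rewrite leNgt Ti mulr0.
have H j : (j < m.+1)%N -> ((\sum_(i < j.+1) `|a i|)%:E <= total_variation 0 (T j) g)%E.
  elim: j => [|j IH] jm.
    rewrite big_ord_recl big_ord0 addr0.
    have /andP[T0 _] := T01 _ jm.
    have := total_variation_ge g (ltW T0); rewrite gT// g0.
    by rewrite big_ord_recl big_ord0 addr0 addrC addKr.
  have /andP[Tj0 _] := T01 _ (ltnW jm).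
  have TT : T j < T j.+1 by apply: Tm; rewrite ltnSn.
  rewrite big_ord_recr /= EFinD (@total_variationD _ 0 (T j.+1) (T j) g (ltW Tj0) (ltW TT)).
  apply: leeD; first by apply: IH; exact: ltnW.
  have := total_variation_ge g (ltW TT); rewrite !gT ?(ltnW jm)//.
  rewrite [\sum_(i < j.+2) _]big_ord_recr /=.
  by have -> : forall z u v : R, z + (u + v) - (z + u) = v by move=> *; ring.
have /andP[Tm0 Tm1] := T01 m (ltnSn m).
rewrite (@total_variationD _ 0 1 (T m) g (ltW Tm0) Tm1) -[leLHS]adde0.
by apply: leeD; [exact: H|exact: total_variation_ge0].
Qed.

Lemma derivn_horner_const (R : realFieldType) (p : {poly R}) k x y :
  (size p <= k.+1)%N -> p^`(k).[x] = p^`(k).[y].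
Proof.
move=> sp; have : (size p^`(k) <= 1)%N.
  have : (size p <= k + 1)%N by rewrite addn1.
  elim: k p {sp} => [|k IH] p sp; first by rewrite derivn0.
  rewrite derivSn; apply: IH; rewrite addSn in sp.
  have [->|p0] := eqVneq p 0; first by rewrite deriv0 size_poly0.
  by rewrite -ltnS (leq_trans (lt_size_deriv p0)).
by move=> /size1_polyC ->; rewrite !hornerC.
Qed.

Lemma iter_sdiff_local {R : realFieldType} j h (u v : nat -> R) s :
  (forall i, (s <= i <= s + j * h)%N -> u i = v i) ->
  iter j (sdiff h) u s = iter j (sdiff h) v s.
Proof.
elim: j s => [|j IH] s uv /=; first by apply: uv; rewrite leqnn leq_addr.
rewrite /sdiff; congr (_ - _); apply: IH => i /andP[si ij]; apply: uv.
  by rewrite (leq_trans (leq_addr h s)) //= mulSn addnA.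
by rewrite si/= mulSn addnCA (leq_trans ij)// leq_addl.
Qed.

Lemma iter_sdiffD {R : realFieldType} j h (u v : nat -> R) s :
  iter j (sdiff h) (fun i => u i + v i) s =
  iter j (sdiff h) u s + iter j (sdiff h) v s.
Proof.
by elim: j s => //= j IH s; rewrite /sdiff in IH *; rewrite !IH; ring.
Qed.

Lemma iter_sdiffZ {R : realFieldType} j h c (u : nat -> R) s :
  iter j (sdiff h) (fun i => c * u i) s = c * iter j (sdiff h) u s.
Proof.
by elim: j s => //= j IH s; rewrite /sdiff in IH *; rewrite !IH; ring.
Qed.

Lemma iter_sdiff_sum {R : realFieldType} j h m (F : nat -> nat -> R) s :
  iter j (sdiff h) (fun i => \sum_(l < m) F l i) s =
  \sum_(l < m) iter j (sdiff h) (F l) s.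
Proof.
by elim: j s => //= j IH s; rewrite /sdiff in IH *; rewrite !IH -sumrB.
Qed.

Lemma size_poly_shift_sub (R : realFieldType) (p : {poly R}) (h : R) m :
  (size p <= m.+1)%N -> (size (p \Po ('X + h%:P) - p)%R <= m)%N.
Proof.
have sX : size ('X + h%:P) = 2 by rewrite size_XaddC.
have sc : size (p \Po ('X + h%:P)) = size p by exact: size_comp_poly2.
move=> sp; apply/leq_sizeP => j mj; rewrite coefB.
have [jm|jm] := ltnP m j.
  by rewrite !nth_default ?subrr// ?sc (leq_trans sp).
have {jm mj}-> : j = m by apply/eqP; rewrite eqn_leq jm mj.
move: sp; rewrite leq_eqVlt => /orP[/eqP sp|]; last first.
  by rewrite ltnS => sp; rewrite !nth_default ?subrr// ?sc.
have := @lead_coef_comp _ p ('X + h%:P); rewrite sX => /(_ isT).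
rewrite lead_coefXaddC expr1n mulr1 /lead_coef sc sp /= => ->.
by rewrite subrr.
Qed.

Lemma iter_sdiff_poly (R : realFieldType) (p : {poly R}) j h s (a b : R) :
  (size p <= j)%N -> iter j (sdiff h) (fun i => p.[a + i%:R * b]) s = 0.
Proof.
elim: j p => [|j IH] p sp.
  by move: sp; rewrite leqn0 size_poly_eq0 => /eqP -> /=; rewrite horner0.
rewrite iterSr; have /IH <- := size_poly_shift_sub (h%:R * b) sp.
congr (iter _ _ _ _); apply/funext => i.
rewrite /sdiff hornerD hornerN horner_comp hornerD hornerX hornerC natrD.
by congr (p.[_] - _); ring.
Qed.

(** Both parities take one form: knot [j] is the design point of index [q + j], counted from 0, with
    an offset [q] that does not depend on [n]. *)
Lemma knots_spec (R : realType) (k : nat) : exists q,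
  [/\ (0 < q)%N, (q <= k.+1)%N & forall n, (k.+2 <= n)%N ->
    [/\ size (knots R k n) = (n - k.+1)%N, sorted <%R (knots R k n) &
    forall j, (j < n - k.+1)%N -> (knots R k n)`_j = (q.+1 + j)%:R / n%:R]].
Proof.
exists (if odd k then (k.+1)./2 else k./2.+1).
have qE : (if odd k then (k.+1)./2 else k./2.+1).+1 =
    (if odd k then (k.+1)./2.+1 else k./2 + 2)%N by case: ifP => _ //; rewrite addn2.
split; [by case: ifP => // ok; case: k ok {qE}|by case: ifP => _; lia|move=> n kn].
set q := (if odd k then _ else _) in qE *.
have n0 : (0 : R) < n%:R by rewrite ltr0n; lia.
have kE : knots R k n = [seq i%:R / n%:R | i <- index_iota q.+1 (q.+1 + (n - k.+1))].
  rewrite /knots qE; congr (map _ _); have := odd_double_half k.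
  by case: ifP => ok kk; congr index_iota; lia.
have sE : size (knots R k n) = (n - k.+1)%N.
  by rewrite kE size_map size_iota addKn.
split => //.
- rewrite kE; apply: homo_sorted (iota_ltn_sorted _ _) => i j ij.
  by rewrite ltr_pM2r ?invr_gt0// ltr_nat.
- move=> j jn; rewrite kE (nth_map 0%N) ?size_iota ?addKn//.
  by rewrite /index_iota nth_iota ?addKn.
Qed.

(** * Truncated powers on the grid *)

Lemma iter_sdiff_bound {R : realFieldType} j h (u : nat -> R) s B :
  (forall i, (s <= i <= s + j * h)%N -> `|u i| <= B) ->
  `|iter j (sdiff h) u s| <= 2 ^+ j * B.
Proof.
elim: j s => [|j IH] s uB /=.
  by rewrite expr0 mul1r; apply: uB; rewrite leqnn leq_addr.
rewrite exprS -mulrA mulr_natl mulr2n {1}/sdiff.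
apply: (le_trans (ler_normB _ _)); apply: lerD; apply: IH => i /andP[si ij].
  by apply: uB; rewrite (leq_trans (leq_addr h s)) //= mulSn addnA.
by apply: uB; rewrite si/= mulSn addnCA (leq_trans ij)// leq_addl.
Qed.

Lemma iter_sdiff_cst0 {R : realFieldType} j h s :
  iter j (sdiff h) (fun=> 0) s = 0 :> R.
Proof. by elim: j s => //= j IH s; rewrite /sdiff in IH *; rewrite !IH subrr. Qed.

(** At [i = a] the value is [0 ^ k], which is 1 for k = 0, in agreement with right-continuous
    splines. *)
Definition trunc_pow {R : realFieldType} (k a i : nat) : R :=
  if (a <= i)%N then (i - a)%:R ^+ k else 0.

(** The difference of order k + 1 kills the polynomial on either side of [a]. Only the at most k + 1
    windows that straddle [a] remain, and there the values are at most (k + 1)^k. The bound depends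
    on neither [a] nor [m]. *)
Lemma trunc_pow_variation (R : realFieldType) (k a m : nat) :
  \sum_(s < m) `|iter k.+1 D1 (trunc_pow k a) s|
    <= k.+1%:R * (2 ^+ k.+1 * k.+1%:R ^+ k) :> R.
Proof.
set B : R := 2 ^+ k.+1 * k.+1%:R ^+ k.
have B0 : 0 <= B by rewrite mulr_ge0 ?exprn_ge0.
pose F s : R := if (a - k.+1 <= s < a - k.+1 + k.+1)%N then B else 0.
have wF s : `|iter k.+1 D1 (trunc_pow k a) s| <= F s.
  rewrite /F; have [sa|sa] := leqP a s.
    have -> : iter k.+1 D1 (trunc_pow k a) s =
        iter k.+1 D1 (fun i => ('X^k).[- a%:R + i%:R * 1]) s :> R.
      apply: iter_sdiff_local => i /andP[si _].
      rewrite /trunc_pow (leq_trans sa si) hornerXn mulr1 addrC natrB//.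
      exact: leq_trans si.
    rewrite iter_sdiff_poly ?size_polyXn// normr0; by case: ifP.
  case: ifP => [_|/negbT H].
    apply: iter_sdiff_bound => i /andP[si ik]; rewrite /trunc_pow; case: ifP => ai.
      rewrite ger0_norm ?exprn_ge0// lerXn2r ?nnegrE// ler_nat.
      by rewrite muln1 in ik; lia.
    by rewrite normr0 exprn_ge0.
  have -> : iter k.+1 D1 (trunc_pow k a) s = iter k.+1 D1 (fun=> 0) s :> R.
    apply: iter_sdiff_local => i /andP[si ik]; rewrite /trunc_pow; case: ifP => // ai.
    by exfalso; move/negP: H; apply; rewrite muln1 in ik; lia.
  by rewrite iter_sdiff_cst0 normr0.
apply: (@le_trans _ _ (\sum_(s < m) F s)); first by apply: ler_sum => s _; exact: wF.
have F0 s : 0 <= F s by rewrite /F; case: ifP.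
apply: (@le_trans _ _ (\sum_(s < m + (a - k.+1 + k.+1)) F s)).
  by apply: ler_sum_widen => //; exact: leq_addr.
rewrite /F -big_mkcond (@sum_ord_interval _ _ (fun=> B)) ?leq_addl//.
by rewrite sumr_const card_ord mulr_natl.
Qed.

(** This makes the spline penalty comparable to the discrete variation in the noise bound. At the
    design points a truncated power with a knot in T is [trunc_pow k (q + j)] divided by n^k, which
    cancels the scaling; the coefficients are controlled by the jumps of [g]. *)
Lemma spline_variation_bound (R : realType) (k : nat) :
  exists2 W : R, 0 < W & forall n f g, (k.+2 <= n)%N ->
    spline_with_derivative k (knots R k n) f g ->
    ((n%:R ^+ k * \sum_(s < n - k.+1) `|iter k.+1 D1 (fun i => f (i.+1%:R / n%:R)) s|)%:E
      <= W%:E * total_variation 0 1 g)%E.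
Proof.
set W := (k.+1%:R * (2 ^+ k.+1 * k.+1%:R ^+ k) : R).
exists W; first by rewrite !mulr_gt0// exprn_gt0// ltr0n.
have W0 : 0 <= W by rewrite !mulr_ge0// exprn_ge0.
move=> n f g kn; have [q [q0 qk /(_ n kn)[sT soT Tj]]] := knots_spec R k.
move: sT soT Tj; set T := knots R k n => sT soT Tj fg.
have [p sp [c fgE]] := coefficients_of_spline soT fg.
have n0 : (0 : R) < n%:R by rewrite ltr0n (leq_trans _ kn).
have n0' : n%:R != 0 :> R by rewrite gt_eqF.
have TV : ((\sum_(j < size T) `|c j|)%:E <= total_variation 0 1 g)%E.
  apply: (@le_trans _ _ (\sum_(j < size T) `|k`!%:R * c j|)%:E).
    rewrite lee_fin; apply: ler_sum => j _; rewrite normrM ler_peMl//.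
    by rewrite normr_nat ler1n fact_gt0.
  apply: (@total_variation_step_ge R p^`(k).[0] (fun j => k`!%:R * c j) (nth 0 T)).
  - move=> j; rewrite sT => jn; rewrite Tj// divr_gt0//= ?ltr0n//.
    by rewrite ler_pdivrMr// mul1r ler_nat; lia.
  - move=> i j /andP[ij]; rewrite sT => jn; rewrite !Tj ?(ltn_trans ij)//.
    by rewrite ltr_pM2r ?invr_gt0// ltr_nat ltn_add2l.
  - move=> x /fgE[_ ->]; congr (_ + _); exact: derivn_horner_const.
apply: (@le_trans _ _ (W%:E * (\sum_(j < size T) `|c j|)%:E)%E); last first.
  by apply: lee_wpmul2l => //; rewrite lee_fin.
rewrite -EFinM lee_fin.
have vE s : (s < n - k.+1)%N ->
    iter k.+1 D1 (fun i => f (i.+1%:R / n%:R)) s =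
    \sum_(j < size T) (c j / n%:R ^+ k) * iter k.+1 D1 (trunc_pow k (q + j)) s.
  move=> sn.
  rewrite (@iter_sdiff_local _ _ _ _ (fun i => p.[n%:R^-1 + i%:R * n%:R^-1] +
    \sum_(j < size T) (c j / n%:R ^+ k) * trunc_pow k (q + j) i)).
    rewrite iter_sdiffD iter_sdiff_poly// add0r.
    rewrite (@iter_sdiff_sum _ _ _ _ (fun j i => (c j / n%:R ^+ k) * trunc_pow k (q + j) i)).
    by apply: eq_bigr => j _; rewrite iter_sdiffZ.
  move=> i /andP[si ik].
  have iN : (i.+1 <= n)%N by rewrite muln1 in ik; lia.
  have x01 : i.+1%:R / n%:R \in `[0, 1 : R].
    by rewrite in_itv/= divr_ge0//= ler_pdivrMr// mul1r ler_nat.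
  have [-> _] := fgE _ x01; congr (_ + _).
    by congr (p.[_]); rewrite -natr1 mulrDl mul1r addrC.
  apply: eq_bigr => j _; have jT := ltn_ord j; rewrite [X in (_ < X)%N]sT in jT.
  rewrite Tj// ler_pM2r ?invr_gt0// ler_nat addSn ltnS /trunc_pow.
  case: ifP => ij; last by rewrite !mulr0 mul0r.
  have -> : i.+1%:R / n%:R - (q + j).+1%:R / n%:R = (i - (q + j))%:R / n%:R :> R.
    by rewrite -mulrBl -natrB// subSS.
  by rewrite mulr1 expr_div_n mulrA mulrAC.
under eq_bigr => s _ do rewrite vE//.
apply: (@le_trans _ _ (n%:R ^+ k * \sum_(s < n - k.+1) \sum_(j < size T)
    `|c j / n%:R ^+ k| * `|iter k.+1 D1 (trunc_pow k (q + j)) s|)).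
  rewrite ler_wpM2l ?exprn_ge0//; apply: ler_sum => s _.
  by apply: (le_trans (ler_norm_sum _ _ _)); apply: ler_sum => j _; rewrite normrM.
rewrite exchange_big /= mulr_sumr mulr_sumr; apply: ler_sum => j _.
rewrite -mulr_sumr mulrA.
have -> : n%:R ^+ k * `|c j / n%:R ^+ k| = `|c j|.
  rewrite normrM normfV [`|n%:R ^+ k|]ger0_norm ?exprn_ge0//.
  by rewrite mulrC divfK// expf_neq0.
by rewrite mulrC ler_wpM2r// trunc_pow_variation.
Qed.

(** * Newton's expansion and approximation by splines *)

Lemma discrete_taylor_step {R : realFieldType} k i (u : nat -> R) :
  \sum_(j < i) 'C(i - j.+1, k)%:R * u j =
  'C(i, k.+1)%:R * u 0%N + \sum_(j < i) 'C(i - j.+1, k.+1)%:R * D1 u j.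
Proof.
elim: i u => [|i IH] u; first by rewrite !big_ord0 bin0n mul0r addr0.
rewrite !big_ord_recl /= subSS subn0.
under eq_bigr => j _ do rewrite /bump add1n subSS.
under [X in _ = _ + (_ + X)]eq_bigr => j _ do rewrite /bump add1n subSS.
rewrite (IH (fun j => u j.+1)) binS natrD /sdiff add0n.
have -> : \sum_(j < i) 'C(i - j.+1, k.+1)%:R * (u (j + 1).+1 - u j.+1) =
  \sum_(j < i) 'C(i - j.+1, k.+1)%:R * (u (j.+1 + 1)%N - u j.+1) by [].
ring.
Qed.

(** Newton's forward difference formula with remainder. Each step is a summation by parts, in which
    Pascal's rule raises the order of the binomial coefficients. *)
Lemma discrete_taylor {R : realFieldType} k i (u : nat -> R) :
  u i = \sum_(r < k.+1) 'C(i, r)%:R * iter r D1 u 0%N +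
        \sum_(j < i) 'C(i - j.+1, k)%:R * iter k.+1 D1 u j.
Proof.
elim: k => [|k IH].
  rewrite big_ord_recl big_ord0 addr0 bin0 mul1r /=.
  under eq_bigr do rewrite bin0 mul1r.
  by have := sdiff_telescope i u 0; rewrite /sdiff !add0n; lra.
by rewrite {1}IH discrete_taylor_step addrA [in RHS]big_ord_recr.
Qed.

Lemma binomial_poly (R : realFieldType) n r : (0 < n)%N ->
  exists2 p : {poly R}, (size p <= r.+1)%N &
    forall i, p.[i.+1%:R / n%:R] = 'C(i, r)%:R.
Proof.
move=> n0; have n0' : n%:R != 0 :> R by rewrite pnatr_eq0 -lt0n.
have [p sp pE] : exists2 p : {poly R}, (size p <= r.+1)%N &
    forall i, p.[i.+1%:R / n%:R] = (i ^_ r)%:R.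
  elim: r => [|r [p sp pE]].
    by exists 1; [rewrite size_poly1|move=> i; rewrite hornerC ffactn0].
  (* At the design point (i + 1) / n the new factor n x - (r + 1) equals i - r. *)
  exists (p * (n%:R *: 'X - r.+1%:R%:P)).
    apply: (leq_trans (size_polyMleq _ _)).
    have : (size (n%:R *: 'X - r.+1%:R%:P : {poly R})%R <= 2)%N.
      rewrite (leq_trans (size_polyD _ _))// geq_max size_polyN.
      by rewrite (leq_trans (size_scale_leq _ _)) ?size_polyX// (leq_trans (size_polyC_leq1 _)).
    lia.
  move=> i; rewrite hornerM pE hornerD hornerN hornerZ hornerX hornerC.
  have -> : n%:R * (i.+1%:R / n%:R) = i.+1%:R :> R by field.
  rewrite ffactnSr natrM; have [ri|ir] := leqP r i.
    by rewrite natrB// -!natr1; congr (_ * _); ring.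
  by rewrite ffact_small// !mul0r.
exists (r`!%:R^-1 *: p); first by rewrite (leq_trans (size_scale_leq _ _)).
move=> i; rewrite hornerZ pE -bin_ffact natrM mulrC mulfK// pnatr_eq0 -lt0n fact_gt0.
Qed.

Lemma expn_sub_le u k : (u ^ k <= (u - k) ^ k + k * k * u ^ k.-1)%N.
Proof.
have [uk|ku] := leqP u k.
  case: k uk => [|k] uk; first by rewrite expn0.
  rewrite expnS /= (leq_trans _ (leq_addl _ _))// leq_mul2r.
  by apply/orP; right; apply: leq_trans uk _; rewrite leq_pmulr.
rewrite -leq_subLR subn_exp.
rewrite subKn ?(ltnW ku)// -mulnA leq_mul2l; apply/orP; right.
rewrite -[X in (_ <= X * _)%N](card_ord k) -sum_nat_const.
apply: leq_sum => i _; case: k ku i => [|k] ku [i ik] //=.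
apply: (@leq_trans (u ^ (k - i) * u ^ i)); last by rewrite -expnD subnK.
rewrite leq_mul2l; apply/orP; right.
by have [->|i0] := posnP i; rewrite ?expn0 // leq_exp2r ?leq_subr.
Qed.

Lemma leq_expn_base a b k : (a <= b)%N -> (a ^ k <= b ^ k)%N.
Proof. by move=> ab; case: k => [|k]; rewrite ?expn0 ?leq_exp2r. Qed.

Lemma ffact_bounds u k : ((u - k) ^ k <= u ^_ k <= u ^ k)%N.
Proof.
elim: k => [|k /andP[l r]]; first by rewrite ffactn0.
rewrite ffactnSr !expnSr !leq_mul ?leq_subr ?leq_sub2l//.
by rewrite (leq_trans _ l)// leq_expn_base// leq_sub2l.
Qed.

(* The discrete Taylor formula has binomial coefficients where a spline has
   truncated powers. *)
Lemma trunc_pow_binomial (R : realFieldType) k q i j n :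
  (0 < q)%N -> (q <= k.+1)%N -> (i < n)%N ->
  `|k`!%:R^-1 * trunc_pow k (q + j) i - (if (j < i)%N then 'C(i - j.+1, k)%:R else 0)|
    <= (k * k)%:R * n%:R ^+ k / n%:R :> R.
Proof.
move=> q0 qk iN; rewrite /trunc_pow.
have n0 : (0 : R) < n%:R by rewrite ltr0n (leq_ltn_trans _ iN).
have n0' : n%:R != 0 :> R by rewrite gt_eqF.
have rhs0 : 0 <= (k * k)%:R * n%:R ^+ k / n%:R :> R.
  by rewrite divr_ge0 ?mulr_ge0 ?exprn_ge0// ltW.
have [ji|ij] := ltnP j i; last first.
  have -> : (q + j <= i)%N = false by lia.
  by rewrite mulr0 subr0 normr0.
set u := (i - j.+1)%N; pose A := if (q + j <= i)%N then ((i - (q + j)) ^ k)%N else 0%N.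
have -> : (if (q + j <= i)%N then (i - (q + j))%:R ^+ k else 0) = A%:R :> R.
  by rewrite /A; case: ifP; rewrite ?natrX.
have un : (u <= n)%N by rewrite /u; lia.
have kf : (0 : R) < k`!%:R by rewrite ltr0n fact_gt0.
have -> : 'C(u, k)%:R = k`!%:R^-1 * (u ^_ k)%:R :> R.
  by rewrite -bin_ffact natrM mulrCA mulVf ?mulr1// gt_eqF.
rewrite -mulrBr normrM normfV normr_nat.
have AB : `|A%:R - (u ^_ k)%:R| <= (k * k * u ^ k.-1)%:R :> R.
  have /andP[B1 B2] := ffact_bounds u k; have uk := expn_sub_le u k.
  (* Like the falling factorial, [A] lies between (u - k)^k and u^k, because the offset satisfies 1
     <= q <= k + 1. *)
  have [A1 A2] : ((u - k) ^ k <= A)%N /\ (A <= u ^ k)%N.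
    rewrite /A; case: ifP => qji; split.
    - by apply: leq_expn_base; rewrite /u; lia.
    - by apply: leq_expn_base; rewrite /u; lia.
    - have [k0 uk0] : (0 < k)%N /\ (u - k = 0)%N by rewrite /u; lia.
      by rewrite uk0 exp0n.
    - by [].
  rewrite ler_norml lerBlDr lerNl opprB lerBlDr -!natrD !ler_nat.
  by apply/andP; split; lia.
apply: (@le_trans _ _ (k * k * u ^ k.-1)%:R).
  rewrite ler_pdivrMl//; apply: (le_trans AB).
  by rewrite ler_peMl// ler1n fact_gt0.
case: k {qk A kf AB rhs0} => [|k]; first by rewrite mulr_ge0// mulr_ge0.
have -> : (k.+1 * k.+1)%:R * n%:R ^+ k.+1 / n%:R = (k.+1 * k.+1)%:R * n%:R ^+ k :> R.
  by rewrite exprS; field.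
by rewrite natrM ler_wpM2l// natrX lerXn2r ?nnegrE// ler_nat.
Qed.

Lemma spline_approximation (R : realType) (k : nat) n (theta : nat -> R) :
  (k.+2 <= n)%N ->
  let J := n%:R ^+ k * \sum_(s < n - k.+1) `|iter k.+1 D1 theta s| in
  exists f g, [/\ spline_with_derivative k (knots R k n) f g,
    forall i, (i < n)%N -> `|f (i.+1%:R / n%:R) - theta i| <= (k * k)%:R * J / n%:R &
    (total_variation 0 1 g <= J%:E)%E].
Proof.
move=> kn J; have [q [q0 qk /(_ n kn)[sT soT Tj]]] := knots_spec R k.
move: sT soT Tj; set T := knots R k n => sT soT Tj.
have nN : (0 < n)%N by rewrite (leq_trans _ kn).
have n0 : (0 : R) < n%:R by rewrite ltr0n.
have n0' : n%:R != 0 :> R by rewrite gt_eqF.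
have kf : (0 : R) < k`!%:R by rewrite ltr0n fact_gt0.
have kf' : k`!%:R != 0 :> R by rewrite gt_eqF.
have [p sp pE] : exists2 p : {poly R}, (size p <= k.+1)%N &
    forall i, p.[i.+1%:R / n%:R] = \sum_(r < k.+1) 'C(i, r)%:R * iter r D1 theta 0%N.
  elim: k.+1 => [|m [p sp pE]].
    by exists 0; [rewrite size_poly0|move=> i; rewrite big_ord0 horner0].
  have [b sb bE] := @binomial_poly R n m nN.
  exists (p + iter m D1 theta 0%N *: b).
    rewrite (leq_trans (size_polyD _ _))// geq_max (leq_trans sp)//=.
    exact: leq_trans (size_scale_leq _ _) sb.
  by move=> i; rewrite hornerD pE hornerZ bE big_ord_recr /= [X in _ + X]mulrC.
pose dt j := iter k.+1 D1 theta j.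
(* There are as many knots as differences of order k + 1, so difference [j] is attached to knot [j].
   With this factor the derivative of order k jumps by n^k [dt j] there, and the jumps add up to [J]
   in absolute value. *)
pose c j := n%:R ^+ k / k`!%:R * dt j.
exists (fun x => p.[x] + \sum_(j < size T) c j * (T`_j <= x)%R%:R * (x - T`_j) ^+ k).
exists (fun x => p^`(k).[x] + \sum_(j < size T) k`!%:R * c j * (T`_j <= x)%R%:R).
have JE : J = n%:R ^+ k * \sum_(j < size T) `|dt j| by rewrite sT.
split; first exact: spline_of_coefficients.
- move=> i iN; rewrite pE [theta i](discrete_taylor k) opprD addrACA subrr add0r.
  have -> : \sum_(j < i) 'C(i - j.+1, k)%:R * iter k.+1 D1 theta j =
      \sum_(j < size T) (if (j < i)%N then 'C(i - j.+1, k)%:R * dt j else 0).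
    rewrite -big_mkcond /=.
    (* If [i] exceeds the number of knots, the terms without a knot vanish: j >= n - k - 1 and i < n
       give i - j - 1 < k. *)
    have [iT|Ti] := leqP i (size T).
      exact: (big_ord_widen (size T) (fun j => 'C(i - j.+1, k)%:R * dt j) iT).
    rewrite [RHS](eq_bigl xpredT); last first.
      by move=> j /=; rewrite (ltn_trans (ltn_ord j)).
    rewrite [RHS](big_ord_widen i (fun j => 'C(i - j.+1, k)%:R * dt j) (ltnW Ti)).
    rewrite [RHS]big_mkcond; apply: eq_bigr => j _; case: ifP => // /negbT.
    rewrite -leqNgt => Tj'; rewrite bin_small ?mul0r//.
    by move: Tj'; rewrite [X in (X <= _)%N]sT; have := ltn_ord j; lia.
  rewrite -sumrB JE mulrA mulrAC mulr_sumr.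
  apply: (le_trans (ler_norm_sum _ _ _)); apply: ler_sum => j _.
  have jT := ltn_ord j; rewrite [X in (_ < X)%N]sT in jT.
  rewrite Tj// ler_pM2r ?invr_gt0// ler_nat addSn ltnS.
  have fE : (i.+1%:R / n%:R - (q + j).+1%:R / n%:R) ^+ k =
      (i.+1%:R - (q + j).+1%:R) ^+ k / n%:R ^+ k :> R.
    by rewrite -mulrBl expr_div_n.
  have -> : c j * (q + j <= i)%N%:R * (i.+1%:R / n%:R - (q + j).+1%:R / n%:R) ^+ k -
      (if (j < i)%N then 'C(i - j.+1, k)%:R * dt j else 0) =
      dt j * (k`!%:R^-1 * trunc_pow k (q + j) i -
        (if (j < i)%N then 'C(i - j.+1, k)%:R else 0)).
    rewrite fE /trunc_pow /c [RHS]mulrBr; congr (_ - _); last first.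
      by case: ifP => _; [rewrite mulrC|rewrite mulr0].
    case: ifP => [qji|_]; last by rewrite !(mulr0, mul0r).
    rewrite mulr1 -natrB ?ltnS// subSS; field.
    by rewrite kf' expf_neq0.
  rewrite normrM mulrC ler_wpM2r//.
  exact: trunc_pow_binomial.
- apply: (@le_trans _ _ (\sum_(j < size T) `|k`!%:R * c j|)%:E).
    have := total_variation_step_le p^`(k).[0] (fun j => k`!%:R * c j) (nth 0 T) (size T).
    apply: le_trans; rewrite le_eqVlt; apply/orP; left; apply/eqP.
    congr total_variation; apply/funext => x; congr (_ + _).
    exact: derivn_horner_const.
  rewrite lee_fin JE mulr_sumr; apply: ler_sum => j _.
  have -> : k`!%:R * c j = n%:R ^+ k * dt j by rewrite /c; field.
  by rewrite normrM ger0_norm ?exprn_ge0.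
Qed.

(** * Differences of a function whose weak derivative has bounded variation *)

Definition rdiff {R : realType} (h : R) (u : R -> R) : R -> R :=
  fun x => u (x + h) - u x.

(** A list of steps, because steps of the grid and widths of the hats occur in the same
    difference. *)
Definition rdiffs {R : realType} (hs : seq R) (u : R -> R) : R -> R :=
  foldr rdiff u hs.

(** With this normalization the derivative of [tpow r.+2] is [tpow r.+1]. Differences of order above
    [r] of this function are B-splines up to scaling. *)
Definition tpow {R : realType} (r : nat) (x : R) : R :=
  if 0 <= x then x ^+ r / r`!%:R else 0.

Lemma tpow_le0 {R : realType} r (x : R) : x <= 0 -> tpow r.+1 x = 0.
Proof.
rewrite le_eqVlt => /orP[/eqP ->|x0]; rewrite /tpow.
  by rewrite lexx expr0n mul0r.
by rewrite leNgt x0.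
Qed.

Lemma is_derive_at0 {R : realType} (f : R -> R) :
  f 0 = 0 -> (forall h, `|h| <= 1 -> `|f h| <= h ^+ 2) -> is_derive (0 : R) 1 f 0.
Proof.
move=> f0 fh.
have H : (h^-1 *: ((f \o shift 0) (h *: (1 : R^o)) - f 0 : R^o)) @[h --> (0 : R)^'] --> (0 : R^o).
  apply/cvgr0Pnorm_lt => e e0; near=> h => /=.
  rewrite f0 subr0 addr0 /GRing.scale/= mulr1.
  have h0 : h != 0 by near: h; exact: nbhs_dnbhs_neq.
  have h1 : `|h| < Num.min e 1.
    by near: h; apply: dnbhs0_lt; rewrite lt_min e0 ltr01.
  move: h1; rewrite lt_min => /andP[he h1].
  rewrite normrM normfV; apply: le_lt_trans he.
  rewrite ler_pdivrMl ?normr_gt0// -expr2 real_normK ?num_real//.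
  exact/fh/ltW.
apply: DeriveDef; first by apply/cvg_ex; exists 0.
exact: cvg_lim.
Unshelve. all: by end_near. Qed.

Lemma is_derive_tpow {R : realType} r (x : R) :
  is_derive x 1 (tpow r.+2) (tpow r.+1 x).
Proof.
have rf : (r.+2)`!%:R != 0 :> R by rewrite pnatr_eq0 -lt0n fact_gt0.
have rf1 : (r.+1)`!%:R != 0 :> R by rewrite pnatr_eq0 -lt0n fact_gt0.
have [x0|x0|->] := ltgtP x 0.
- apply: (@near_eq_is_derive _ _ _ (cst 0)).
    near=> y; rewrite /cst tpow_le0//.
    by apply: ltW; near: y; exact: lt_nbhsl.
  rewrite tpow_le0 ?(ltW x0)//. exact: is_derive_cst.
- have D := is_deriveZ ((r.+2)`!%:R^-1 : R) (is_deriveX r.+2 (is_derive_id x (1 : R^o))).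
  apply: (near_eq_is_derive _ (is_derive_eq D _)).
    near=> y; have y0 : 0 < y by near: y; exact: lt_nbhsr.
    by rewrite /tpow (ltW y0) mulrC exprfctE.
  rewrite /tpow (ltW x0) factS natrM /GRing.scale/=; field.
  by rewrite -natr1 rf1 gt_eqF.
- rewrite tpow_le0//; apply: is_derive_at0; first by rewrite tpow_le0.
  move=> h h1; rewrite /tpow; case: ifP => h0; last by rewrite normr0 sqr_ge0.
  rewrite (ger0_norm h0) in h1.
  have xr : h ^+ r <= 1 by rewrite exprn_ile1.
  have rr : h ^+ r.+2 <= h ^+ 2 by rewrite -addn2 exprD ler_piMl// sqr_ge0.
  have hr0 : 0 <= h ^+ r.+2 by exact: exprn_ge0.
  rewrite ger0_norm ?divr_ge0// ler_pdivrMr ?ltr0n ?fact_gt0//.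
  apply: (le_trans rr); rewrite ler_peMr ?sqr_ge0// ler1n fact_gt0//.
Unshelve. all: by end_near. Qed.

Lemma is_derive_rdiffs {R : realType} (hs : seq R) (u u' : R -> R) :
  (forall x : R, is_derive x 1 u (u' x)) ->
  forall x : R, is_derive x 1 (rdiffs hs u) (rdiffs hs u' x).
Proof.
move=> du; elim: hs => //= h hs IH x.
have := @is_derive1_comp _ _ (shift h) _ _ _ (IH (x + h))
  (is_derive_shift x (1 : R^o) h).
rewrite mulr1 => D; exact: (is_deriveB D (IH x)).
Qed.

Lemma continuous_rdiffs {R : realType} (hs : seq R) (u : R -> R) :
  continuous u -> continuous (rdiffs hs u).
Proof.
move=> cu; elim: hs => //= h hs IH x; rewrite /rdiff.
apply: cvgB; last exact: IH.
apply: (@continuous_comp _ _ _ (shift h) (rdiffs hs u)); last exact: IH.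
by apply: cvgD => //; exact: cvg_cst.
Qed.

Lemma rdiffs_local {R : realType} (hs : seq R) (u v : R -> R) x :
  all (>= 0) hs ->
  (forall z, x <= z <= x + \sum_(h <- hs) h -> u z = v z) ->
  rdiffs hs u x = rdiffs hs v x.
Proof.
elim: hs x => [|h hs IH] x /=; first by move=> _ ->//; rewrite big_nil addr0 lexx.
move=> /andP[h0 hs0]; rewrite big_cons => uv.
have s0 : 0 <= \sum_(h <- hs) h.
  by rewrite big_seq sumr_ge0// => i /(allP hs0).
rewrite /rdiff; congr (_ - _); apply: IH => // z /andP[z1 z2]; apply: uv; lra.
Qed.

Lemma rdiffs_rdiff {R : realType} (hs : seq R) h (u : R -> R) :
  rdiffs hs (rdiff h u) = rdiff h (rdiffs hs u).
Proof.
elim: hs => //= h' hs ->; apply/funext => x; rewrite /rdiff.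
by rewrite [x + h' + h]addrAC; ring.
Qed.

Lemma rdiffs_poly {R : realType} (hs : seq R) (p : {poly R}) x :
  (size p <= size hs)%N -> rdiffs hs (horner p) x = 0.
Proof.
elim: hs p => [|h hs IH] p sp.
  by move: sp; rewrite leqn0 size_poly_eq0 => /eqP -> /=; rewrite horner0.
rewrite /= -rdiffs_rdiff; have /IH <- := size_poly_shift_sub h sp.
congr (rdiffs _ _ _); apply/funext => z.
by rewrite /rdiff hornerD hornerN horner_comp hornerD hornerX hornerC.
Qed.

Lemma rdiff_le {R : realType} (h B : R) (u u' : R -> R) x : 0 <= h ->
  (forall x : R, is_derive x 1 u (u' x)) -> (forall x, `|u' x| <= B) ->
  `|rdiff h u x| <= h * B.
Proof.
move=> h0 du uB.
have cu : {within `[x, x + h], continuous u}.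
  by apply: derivable_within_continuous => z _; case: (du z).
have xh : x <= x + h by rewrite lerDl.
have [c _ E] := MVT_segment xh (fun z _ => du z) cu.
rewrite /rdiff E addrAC subrr add0r normrM (ger0_norm h0) mulrC.
by rewrite ler_wpM2l.
Qed.

Lemma rdiffs_le_double {R : realType} (hs : seq R) m h (u : R -> R) B x :
  (forall x, `|rdiffs hs u x| <= B) -> `|rdiffs (nseq m h ++ hs) u x| <= 2 ^+ m * B.
Proof.
move=> uB; elim: m x => [|m IH] x; first by rewrite expr0 mul1r.
rewrite exprS -mulrA mulr_natl mulr2n /= {1}/rdiff.
by apply: (le_trans (ler_normB _ _)); apply: lerD.
Qed.

Lemma tpow_poly {R : realType} r (x : R) : 0 <= x ->
  tpow r x = (r`!%:R^-1 *: 'X^r).[x].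
Proof. by move=> x0; rewrite /tpow x0 hornerZ hornerXn mulrC. Qed.

(** The compact support of a B-spline: to the right of 0 the function is a polynomial of degree
    below the number of differences, to the left it is zero. *)
Lemma rdiffs_tpow_eq0 {R : realType} (hs : seq R) r x :
  all (>= 0) hs -> (r.+1 < size hs)%N ->
  0 <= x \/ x + \sum_(h <- hs) h <= 0 -> rdiffs hs (tpow r.+1) x = 0.
Proof.
move=> hs0 rs [x0|xs].
  rewrite (@rdiffs_local _ _ _ (horner ((r.+1)`!%:R^-1 *: 'X^(r.+1))))//.
    rewrite rdiffs_poly// (leq_trans (size_scale_leq _ _))//.
    by rewrite size_polyXn.
  by move=> z /andP[xz _]; rewrite tpow_poly// (le_trans x0).
rewrite (@rdiffs_local _ _ _ (horner 0))//.
  by rewrite rdiffs_poly// size_poly0.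
by move=> z /andP[_ zx]; rewrite horner0 tpow_le0// (le_trans zx).
Qed.

Lemma tpow1E {R : realType} : tpow 1 = (fun x : R => 2^-1 * (x + `|x|)).
Proof.
apply/funext => x; rewrite /tpow; case: (leP 0 x) => x0.
  by rewrite ger0_norm// expr1 divr1; lra.
by rewrite ltr0_norm// subrr mulr0.
Qed.

Lemma continuous_tpow {R : realType} r : continuous (tpow r.+1 : R -> R).
Proof.
case: r => [|r] x.
  rewrite tpow1E; apply: cvgM; first exact: cvg_cst.
  by apply: cvgD; [exact: cvg_id|exact: norm_continuous].
apply: differentiable_continuous; apply/derivable1_diffP.
by case: (is_derive_tpow r x).
Qed.

(** By the mean value theorem each difference trades one degree of the truncated power for its step;
    the last one uses that [tpow 1] is 1-Lipschitz. *)
Lemma rdiffs_tpow_le {R : realType} (hs : seq R) d x :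
  all (>= 0) hs -> 0 <= d ->
  `|rdiffs (hs ++ [:: d]) (tpow (size hs).+1) x| <= (\prod_(h <- hs) h) * d.
Proof.
move=> + d0; elim: hs x => [|h hs IH] x /=.
  move=> _; rewrite big_nil mul1r tpow1E /rdiff -mulrBr normrM.
  rewrite ger0_norm//.
  have := ler_normB `|x + d| `|x|; have := ler_dist_dist (x + d) x.
  rewrite addrAC subrr add0r (ger0_norm d0) => H _.
  have := ler_normD d (`|x + d| - `|x|); rewrite (ger0_norm d0).
  have -> : x + d + `|x + d| - (x + `|x|) = d + (`|x + d| - `|x|) by ring.
  lra.
move=> /andP[h0 hs0]; rewrite big_cons -mulrA.
apply: (rdiff_le (u' := rdiffs (hs ++ [:: d]) (tpow (size hs).+1))) => //.
  by apply: is_derive_rdiffs => z; exact: is_derive_tpow.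
by move=> z; exact: IH.
Qed.

(** A second difference of a convex function. This hat serves as an averaging kernel near a design
    point. *)
Lemma bump_ge0 {R : realType} (d x : R) : 0 <= d ->
  0 <= rdiffs [:: d; d] (tpow 1) x.
Proof.
move=> d0; rewrite /= /rdiff tpow1E.
have := ler_normD (x + d + d) x.
have -> : x + d + d + x = 2 * (x + d) by ring.
rewrite normrM (ger0_norm (ler0n R 2)); lra.
Qed.

(** * Pairing with B-splines *)

Lemma integral_derivative01 {R : realType} (F f : R -> R) :
  (forall x : R, is_derive x 1 F (f x)) -> continuous f ->
  \int[lebesgue_measure]_(x in `]0, 1[) f x = F 1 - F 0.
Proof.
move=> dF cf.
have cF : continuous F.
  move=> x; apply: differentiable_continuous; apply/derivable1_diffP.
  by case: (dF x).
have cfw : {within `[0, 1], continuous f} by exact: continuous_subspaceT.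
have dF1 : derivable_oo_LRcontinuous F 0 1.
  split; first by move=> x _; case: (dF x).
    by apply: cvg_at_right_filter; exact: cF.
  by apply: cvg_at_left_filter; exact: cF.
have dF2 : {in `]0, 1[, (F^`())%classic =1 f}.
  by move=> x _; rewrite derive1E; case: (dF x).
have H := continuous_FTC2 ltr01 cfw dF1 dF2.
have iF : lebesgue_measure.-integrable `[0, 1] (EFin \o f).
  apply: continuous_compact_integrable => //; exact: segment_compact.
rewrite Rintegral_itv_bndo_bndc; last first.
  by apply: integrableS iF => //; exact: subset_itv_oo_cc.
rewrite Rintegral_itv_obnd_cbnd; last first.
  by apply: integrableS iF => //; exact: subset_itv_oc_cc.
by rewrite /Rintegral H.
Qed.

(** Each weak derivative is tested against [rdiffs hs (tpow r.+2)], which is C^1 with support in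
    [y - sum of the steps, y]. The degree rises by one at each stage, and the bound on [size hs]
    keeps the support compact throughout. *)
Lemma weak_derivativen_pairing {R : realType} m (f g : R -> R) r (hs : seq R) y :
  weak_derivativen m f g -> all (>= 0) hs -> ((r + m).+1 < size hs)%N ->
  0 < y - \sum_(h <- hs) h -> y < 1 ->
  \int[lebesgue_measure]_(x in `]0, 1[) (f x * rdiffs hs (tpow r.+1) (x - y)) =
  (-1) ^+ m *
  \int[lebesgue_measure]_(x in `]0, 1[) (g x * rdiffs hs (tpow (r + m).+1) (x - y)).
Proof.
move=> + hs0 + y0 y1; elim: m f r => [|m IH] f r /=.
  move=> fg _; rewrite addn0 expr0 mul1r; apply: eq_Rintegral => x.
  rewrite inE/= in_itv/= => /andP[x0 x1].
  by rewrite fg// in_itv/= (ltW x0) (ltW x1).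
move=> [f' [_ _ wf] wf'] rm.
pose phi x := rdiffs hs (tpow r.+2) (x - y).
have dphi (x : R) : is_derive x 1 phi (rdiffs hs (tpow r.+1) (x - y)).
  have := @is_derive1_comp _ _ (shift (- y)) _ _ _
    (is_derive_rdiffs hs (is_derive_tpow r) (x - y)) (is_derive_shift x (1 : R^o) (- y)).
  by rewrite mulr1.
have dphiE : (phi^`())%classic = (fun x => rdiffs hs (tpow r.+1) (x - y)).
  by apply/funext => x; rewrite derive1E; case: (dphi x).
have := wf phi; rewrite dphiE => ->; last first.
  split.
  - by move=> x; case: (dphi x).
  - rewrite dphiE => x.
    apply: (@continuous_comp _ _ _ (shift (- y)) (rdiffs hs (tpow r.+1))).
      by apply: cvgD => //; exact: cvg_cst.
    exact/continuous_rdiffs/continuous_tpow.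
  - exists `[y - \sum_(h <- hs) h, y]%classic.
      split; first exact: segment_compact.
      move=> x /=; rewrite !in_itv/= => /andP[x0 x1].
      by rewrite (lt_le_trans y0)//= (le_lt_trans x1).
    move=> x /=; rewrite in_itv/= => /negP xy; apply: rdiffs_tpow_eq0 => //.
      by apply: leq_ltn_trans rm; rewrite addnS !ltnS leq_addr.
    have [xy0|xy0] := leP y x; first by left; rewrite subr_ge0.
    right; have [|xy1] := leP (y - \sum_(h <- hs) h) x; last by lra.
    by move=> xy1; case/negP: xy; rewrite xy1 ltW.
rewrite -/phi (IH _ r.+1) ?addSnnS// exprS mulN1r mulNr.
by congr (- (_ * _)).
Qed.

Lemma integrable_mul_continuous01 {R : realType} (f u : R -> R) :
  {within `[0, 1], continuous f} -> continuous u ->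
  lebesgue_measure.-integrable `]0, 1[ (EFin \o (fun x => f x * u x)).
Proof.
move=> cf cu.
have i01 : lebesgue_measure.-integrable `[0, 1] (EFin \o (fun x => f x * u x)).
  apply: continuous_compact_integrable; first exact: segment_compact.
  have cuw : {within `[0, 1], continuous u} by exact: continuous_subspaceT.
  by move=> x; apply: cvgM; [exact: cf|exact: cuw].
by apply: integrableS i01 => //; exact: subset_itv_oo_cc.
Qed.

(** The sign arises because moving the centre to the right moves the argument of [u] to the left. *)
Lemma pairing_grid_diff {R : realType} (f u : R -> R) m (h y : R) i :
  {within `[0, 1], continuous f} -> continuous u ->
  \int[lebesgue_measure]_(x in `]0, 1[)
     (f x * rdiffs (nseq m h) u (x - (y + (i + m)%:R * h))) =
  (-1) ^+ m * iter m D1 (fun j => \int[lebesgue_measure]_(x in `]0, 1[)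
     (f x * u (x - (y + j%:R * h)))) i.
Proof.
move=> cf cu; elim: m i => [|m IH] i; first by rewrite expr0 mul1r addn0.
have cv z : continuous (fun x => rdiffs (nseq m h) u (x - z)).
  move=> x; apply: (@continuous_comp _ _ _ (shift (- z)) (rdiffs (nseq m h) u)).
    by apply: cvgD => //; exact: cvg_cst.
  exact: continuous_rdiffs.
transitivity (\int[lebesgue_measure]_(x in `]0, 1[)
   (f x * rdiffs (nseq m h) u (x - (y + (i + m)%:R * h))
    - f x * rdiffs (nseq m h) u (x - (y + (i.+1 + m)%:R * h)))).
  apply: eq_Rintegral => x _; rewrite /= {1}/rdiff mulrBr.
  congr (f x * rdiffs _ _ _ - f x * rdiffs _ _ _).
    by rewrite addnS -natr1; ring.
  by rewrite addnS addSn.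
rewrite RintegralB//; [|exact: integrable_mul_continuous01..].
by rewrite !IH exprS /= /sdiff addn1; ring.
Qed.

Lemma weak_derivativen_measurable {R : realType} m (f g : R -> R) :
  weak_derivativen m.+1 f g -> measurable_fun (`]0, 1[%classic : set R) g.
Proof.
elim: m f => [|m IH] f [h [_ [mh _ _] _] hg]; last exact: IH hg.
apply: eq_measurable_fun mh => x; rewrite inE/= in_itv/= => /andP[x0 x1].
by apply: hg; rewrite in_itv/= (ltW x0) (ltW x1).
Qed.

(** As [w] has mean zero, the constant [g a] may be subtracted from [g], so only the oscillation of
    [g] on the support of [w] counts. *)
Lemma zero_mean_pairing_le {R : realType} (g w : R -> R) (a b B D : R) :
  measurable_fun (`]0, 1[%classic : set R) g -> (exists K, forall x, x \in `]0, 1[ -> `|g x| <= K) ->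
  continuous w -> \int[lebesgue_measure]_(x in `]0, 1[) w x = 0 ->
  0 < a -> a <= b -> b < 1 -> 0 <= B ->
  (forall x, `|w x| <= B) -> (forall x, ~~ (a <= x <= b) -> w x = 0) ->
  (forall x, a <= x <= b -> `|g x - g a| <= D) ->
  `|\int[lebesgue_measure]_(x in `]0, 1[) (g x * w x)| <= (b - a) * (D * B).
Proof.
move=> mg [K gK] cw w0 a0 ab b1 B0 wB ws gD.
have D0 : 0 <= D by rewrite (le_trans _ (gD a _)) ?lexx//.
have mw : measurable_fun setT w by exact: continuous_measurable_fun.
have mw01 : measurable_fun (`]0, 1[%classic : set R) w by exact: measurable_funTS.
have bnd_int (F : R -> R) K' : measurable_fun (`]0, 1[%classic : set R) F ->
    (forall x, x \in `]0, 1[ -> `|F x| <= K') ->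
    lebesgue_measure.-integrable `]0, 1[ (EFin \o F).
  move=> mF FK; apply: measurable_bounded_integrable => //.
    by rewrite /= lebesgue_measure_itv/= lte_fin ltr01 -EFinB ltry.
  exists K'; split; first exact: num_real.
  move=> z Kz x /= x01; apply: le_trans (ltW Kz); exact: FK.
have igw : lebesgue_measure.-integrable `]0, 1[ (EFin \o (fun x => g x * w x)).
  apply: (bnd_int _ (K * B)); first exact: measurable_funM.
  by move=> x x01; rewrite normrM ler_pM// gK.
have iw : lebesgue_measure.-integrable `]0, 1[ (EFin \o w) by exact: (bnd_int _ B).
have igaw : lebesgue_measure.-integrable `]0, 1[ (EFin \o (fun x => g a * w x)).
  apply: (bnd_int _ (`|g a| * B)); first exact: measurable_funM.
  by move=> x x01; rewrite normrM ler_pM.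
have -> : \int[lebesgue_measure]_(x in `]0, 1[) (g x * w x) =
    \int[lebesgue_measure]_(x in `]0, 1[) (g x * w x - g a * w x).
  by rewrite RintegralB// RintegralZl// w0 mulr0 subr0.
have mgw : measurable_fun (`]0, 1[%classic : set R) (fun x => g x * w x - g a * w x).
  by apply: measurable_funB; exact: measurable_funM.
have pt x : `|g x * w x - g a * w x| <= D * B * \1_(`[a, b]%classic) x.
  rewrite indicE; case: (boolP (x \in `[a, b]%classic)) => xab.
    move: xab; rewrite inE/= in_itv/= => xab.
    by rewrite mulr1 -mulrBl normrM ler_pM// gD.
  rewrite ws ?mulr0 ?subrr ?normr0//; apply: contra xab => xab.
  by rewrite inE/= in_itv.
apply: (le_trans (le_normr_Rintegral _ _)) => //.
  apply: (bnd_int _ (D * B)) => // x _; apply: (le_trans (pt x)).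
  by rewrite ler_piMr ?mulr_ge0// indicE; case: (_ \in _).
have i1 : lebesgue_measure.-integrable `]0, 1[ (EFin \o (\1_(`[a, b]%classic) : R -> R)).
  apply: (bnd_int _ 1); first by apply: measurable_funTS; exact: measurable_indic.
  by move=> x _; rewrite indicE; case: (_ \in _); rewrite ?normr1 ?normr0.
apply: (@le_trans _ _ (\int[lebesgue_measure]_(x in `]0, 1[)
    (D * B * \1_(`[a, b]%classic) x))).
  apply: le_Rintegral => //.
    apply: (bnd_int _ (D * B)).
      by apply: measurableT_comp.
    move=> x _; rewrite normr_id; apply: (le_trans (pt x)).
    by rewrite ler_piMr ?mulr_ge0// indicE; case: (_ \in _).
  apply: (bnd_int _ (D * B)).
    by apply: measurable_funM => //; apply: measurable_funTS; exact: measurable_indic.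
  move=> x _; rewrite normrM (ger0_norm (mulr_ge0 D0 B0)).
  by rewrite ler_piMr ?mulr_ge0// indicE; case: (_ \in _); rewrite ?normr1 ?normr0.
rewrite RintegralZl// mulrC ler_wpM2r ?mulr_ge0//.
rewrite /Rintegral integral_indic//= setIidl.
  rewrite lebesgue_measure_itv/= lte_fin; case: ifP => // _.
  by rewrite subr_ge0.
move=> x /=; rewrite !in_itv/= => /andP[ax xb].
by rewrite (lt_le_trans a0)//= (le_lt_trans xb).
Qed.

Lemma variation_function {R : realType} (g : R -> R) (C : R) :
  (total_variation 0 1 g <= C%:E)%E ->
  exists V : R -> R, [/\ V 0 = 0, V 1 <= C &
    forall a b, 0 <= a -> a <= b -> b <= 1 -> `|g b - g a| <= V b - V a].
Proof.
move=> gC; pose V x := fine (total_variation 0 x g).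
have fin x : 0 <= x -> x <= 1 -> total_variation 0 x g \is a fin_num.
  move=> x0 x1; rewrite ge0_fin_numE ?total_variation_ge0//.
  apply: le_lt_trans (ltry C); apply: le_trans gC.
  by rewrite (total_variationD g x0 x1) leeDl// total_variation_ge0.
exists V; split.
- by rewrite /V total_variationxx.
- by rewrite -lee_fin /V fineK// fin.
- move=> a b a0 ab b1; have b0 := le_trans a0 ab; have a1 := le_trans ab b1.
  rewrite lerBrDl -lee_fin EFinD /V !fineK ?fin//.
  by rewrite (total_variationD g a0 ab) leeD2l// total_variation_ge.
Qed.

(** After exchanging sums, each of the [c] shifts telescopes to a difference of two values of [W].
    It bounds the overlap of the supports of consecutive B-splines. *)
Lemma sum_sdiff_le {R : realFieldType} (W : nat -> R) c m (C : R) :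
  (forall i, (i < m + c)%N -> 0 <= W i <= C) ->
  \sum_(s < m) sdiff c W s <= c%:R * C.
Proof.
move=> WC; under eq_bigr do rewrite sdiff_telescope.
rewrite exchange_big /= -[c in c%:R]card_ord mulr_natl -sumr_const.
apply: ler_sum => l _; have lc := ltn_ord l.
under eq_bigr do rewrite addnC.
rewrite -sdiff_telescope /sdiff.
have /andP[_ ] : 0 <= W (l + m)%N <= C by apply: WC; rewrite addnC ltn_add2l.
have /andP[+ _] : 0 <= W l <= C by apply: WC; rewrite (leq_trans lc)// leq_addl.
lra.
Qed.

Lemma finite_modulus {R : realType} (f : R -> R) (x : nat -> R) n (e : R) :
  {within `[0, 1], continuous f} -> (forall j, (j < n)%N -> x j \in `[0, 1]) -> 0 < e ->
  exists2 d, 0 < d & forall j z, (j < n)%N -> z \in `[0, 1] ->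
    `|z - x j| < d -> `|f z - f (x j)| <= e.
Proof.
move=> cf x01 e0; elim: n x01 => [|n IH] x01; first by exists 1.
have [j jn|d d0 H] := IH; first by apply: x01; exact: ltnW.
have /subspace_continuousP := cf; move=> /(_ (x n) (x01 n (ltnSn n))).
move=> /cvgrPdist_le /(_ e e0) /nbhs_ballP[d' /= d'0 H'].
exists (Num.min d d'); first by rewrite lt_min d0.
move=> j z; rewrite ltnS leq_eqVlt lt_min => /orP[/eqP ->|jn] z01 /andP[zd zd'].
  by rewrite distrC; apply: H' => //=; rewrite /ball/= distrC.
exact: H.
Qed.

(* The value of [f] at a design point is approximated by its pairing with a hat
   function of width [2 d].  A difference of order [k + 2] of such hats on the grid is
   the derivative of order [k + 1] of a B-spline, hence pairs with [f] as the B-spline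
   does with [g]; this spline has mean zero and a support of length [(k + 3) / n]. *)
Lemma weak_derivativen_differences {R : realType} (k n : nat) (C : R) (f g : R -> R) :
  {within `[0, 1], continuous f} -> weak_derivativen k.+1 f g ->
  (total_variation 0 1 g <= C%:E)%E -> (k.+3 <= n)%N ->
  n%:R ^+ k.+1 * (\sum_(s < n - k.+2) `|iter k.+2 D1 (fun i => f (i.+1%:R / n%:R)) s|)
    <= 4 * k.+3%:R * (k.+3%:R * C) + 1.
Proof.
move=> cf fg gC kn; have [V [V0 V1 gV]] := variation_function gC.
have n0 : (0 : R) < n%:R by rewrite ltr0n (leq_trans _ kn).
have skE s : (s < n - k.+2)%N -> (s + k.+3 <= n)%N.
  by rewrite ltn_subRL addnS addnC.
have nk : (n - k.+2 + k.+3 = n.+1)%N by rewrite addnS subnK// ltnW.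
have n0' : n%:R != 0 :> R by rewrite gt_eqF.
pose h : R := n%:R^-1.
have h0 : 0 < h by rewrite invr_gt0.
have nh : n%:R * h = 1 by rewrite divff.
pose x j : R := j.+1%:R / n%:R.
have xh j : x j = j%:R * h + h by rewrite /x /h -natr1 mulrDl mul1r.
have jh1 j : (j <= n)%N -> j%:R * h <= 1 by move=> jn; rewrite -[leRHS]nh (ler_wpM2r (ltW h0))// ler_nat.
have jh0 j : 0 <= j%:R * h by rewrite mulr_ge0// ltW.
have x01 j : (j < n)%N -> x j \in `[0, 1].
  by move=> jn; rewrite in_itv/= divr_ge0//= ler_pdivrMr// mul1r ler_nat.
(* With this tolerance, replacing values of [f] by pairings costs 1 in total, the last term of the
   bound. *)
pose eta : R := (n%:R ^+ k.+1 * (n%:R * 2 ^+ k.+2))^-1.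
have eta0 : 0 < eta.
  by rewrite invr_gt0; apply: mulr_gt0; [|apply: mulr_gt0 => //]; apply: exprn_gt0.
have [d' d'0 fd] := finite_modulus cf x01 eta0.
pose d := Num.min (h / 4) (d' / 4).
have d0 : 0 < d by rewrite lt_min !divr_gt0.
have d3h : 3 * d < h.
  have : d <= h / 4 by rewrite ge_min lexx.
  move: h0; lra.
have d3d' : 3 * d < d'.
  have : d <= d' / 4 by rewrite ge_min lexx orbT.
  move: d'0; lra.
(* The hat for x_j is supported in [x_j - 3d, x_j - d], to the left of x_j, so that it stays inside
   ]0, 1[ even for the design point 1. *)
pose y0 := h - d.
pose B := rdiffs [:: d; d] (tpow 1 : R -> R).
have cB : continuous B by apply: continuous_rdiffs; exact: continuous_tpow.
pose G j := \int[lebesgue_measure]_(z in `]0, 1[) (f z * B (z - (y0 + j%:R * h))).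
have Gx j : (j < n)%N -> `|G j - d ^+ 2 * f (x j)| <= d ^+ 2 * eta.
  move=> jn; pose y := y0 + j%:R * h.
  have yx : y = x j - d by rewrite /y /y0 xh; ring.
  have xj1 : x j <= 1 by have := x01 j jn; rewrite in_itv/= => /andP[].
  have xjh : h <= x j by rewrite xh lerDr.
  have shiftd (u : R -> R) : continuous u -> continuous (fun z => u (z - y)).
    move=> cu z; apply: (@continuous_comp _ _ _ (shift (- y)) u); last exact: cu.
    by apply: cvgD => //; exact: cvg_cst.
  have cBy := shiftd _ cB.
  have dBy (z : R) : is_derive z 1 (fun z => rdiffs [:: d; d] (tpow 2) (z - y)) (B (z - y)).
    have := @is_derive1_comp _ _ (shift (- y)) _ _ _
      (is_derive_rdiffs [:: d; d] (is_derive_tpow 0) (z - y)) (is_derive_shift z (1 : R^o) (- y)).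
    by rewrite mulr1.
  have intB : \int[lebesgue_measure]_(z in `]0, 1[) B (z - y) = d ^+ 2.
    rewrite (integral_derivative01 dBy cBy) /= /rdiff.
    rewrite [X in _ - X](_ : _ = 0); last by rewrite !tpow_le0 ?subrr//; lra.
    have w0 : 0 <= 1 - y by rewrite yx; lra.
    have w1 : 0 <= 1 - y + d by rewrite addr_ge0// ltW.
    have w2 : 0 <= 1 - y + d + d by rewrite addr_ge0// ltW.
    rewrite subr0 /tpow w0 w1 w2 (_ : 2`! = 2)%N//; by field.
  have iB : lebesgue_measure.-integrable `]0, 1[ (EFin \o (fun z => f z * B (z - y))).
    exact: integrable_mul_continuous01.
  have icst (c : R) : lebesgue_measure.-integrable `]0, 1[ (EFin \o (fun z => c * B (z - y))).
    apply: (integrable_mul_continuous01 (f := fun=> c)) => //.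
    by apply: continuous_subspaceT => z; exact: cvg_cst.
  have iB1 : lebesgue_measure.-integrable `]0, 1[ (EFin \o (fun z => B (z - y))).
    by have := icst 1; congr (_.-integrable _ _); apply/funext => z /=; rewrite mul1r.
  have GE : G j - d ^+ 2 * f (x j) =
      \int[lebesgue_measure]_(z in `]0, 1[) (f z * B (z - y) - f (x j) * B (z - y)).
    by rewrite RintegralB// RintegralZl// intB [f (x j) * _]mulrC.
  have iD : lebesgue_measure.-integrable `]0, 1[
      (EFin \o (fun z => f z * B (z - y) - f (x j) * B (z - y))).
    have H := integrableB _ iB (icst (f (x j))).
    by apply: H; exact: measurable_itv.
  rewrite GE; apply: (le_trans (le_normr_Rintegral _ iD)) => //.
  rewrite mulrC -intB -RintegralZl//.
  apply: le_Rintegral => //; first exact: integrable_norm iD.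
  move=> z; rewrite /= in_itv/= => /andP[z0 z1].
  rewrite -mulrBl normrM [`|B _|]ger0_norm; last by apply: bump_ge0; exact: ltW.
  have [zx|zx] := ltP `|z - x j| d'.
    rewrite ler_wpM2r//; first by apply: bump_ge0; exact: ltW.
    by apply: fd => //; rewrite in_itv/= (ltW z0) (ltW z1).
  have -> : B (z - y) = 0.
    move: zx; rewrite /B /= /rdiff yx ler_normr => /orP[zx|zx].
      have w0 : 0 <= z - (x j - d) by lra.
      have w1 : 0 <= z - (x j - d) + d by lra.
      have w2 : 0 <= z - (x j - d) + d + d by lra.
      rewrite /tpow w0 w1 w2 (_ : 1`! = 1)%N//; by field.
    by rewrite !tpow_le0 ?subrr//; lra.
  by rewrite !mulr0.
have Vmono a b : 0 <= a -> a <= b -> b <= 1 -> V a <= V b.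
  by move=> a0 ab b1; rewrite -subr_ge0 (le_trans _ (gV _ _ a0 ab b1)).
have GV s : (s < n - k.+2)%N -> `|iter k.+2 D1 G s| <=
    d ^+ 2 * (4 * k.+3%:R * h ^+ k.+1) * (V ((s + k.+3)%:R * h) - V (s%:R * h)).
  move=> sn; pose y := y0 + (s + k.+2)%:R * h.
  (* The steps [h] form the difference of order k + 2, the steps [d] the hat. The support has length
     (k + 2) h + 2 d, less than (k + 3) h. *)
  pose hs := nseq k.+2 h ++ [:: d; d].
  have hs0 : all (>= 0) hs by rewrite all_cat all_nseq /= (ltW h0) (ltW d0).
  have shs : size hs = k.+4 by rewrite size_cat size_nseq addn2.
  have Shs : \sum_(a <- hs) a = k.+2%:R * h + 2 * d.
    rewrite big_cat big_nseq /= iter_addr_0 !big_cons big_nil -[h *+ _]mulr_natl; ring.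
  have ysn : y = (s + k.+3)%:R * h - d.
    by rewrite /y /y0 [(s + k.+3)%N]addnS -natr1; ring.
  have yS : y - \sum_(a <- hs) a = s%:R * h + h - 3 * d.
    by rewrite Shs ysn !natrD -(@natr1 R k.+2); ring.
  have ysh : s%:R * h <= y - \sum_(a <- hs) a by rewrite yS; lra.
  have yS0 : 0 < y - \sum_(a <- hs) a by rewrite yS; have := jh0 s; lra.
  have skn := skE s sn.
  have yt : y <= (s + k.+3)%:R * h by rewrite ysn; lra.
  have y1 : y < 1 by rewrite ysn; have := jh1 _ skn; lra.
  have := @pairing_grid_diff _ f B k.+2 h y0 s cf cB.
  rewrite -/y => E1.
  have E2 := @weak_derivativen_pairing _ k.+1 f g 0 hs y fg hs0.
  have {E1 E2} -> : `|iter k.+2 D1 G s| =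
      `|\int[lebesgue_measure]_(z in `]0, 1[) (g z * rdiffs hs (tpow k.+2) (z - y))|.
    rewrite add0n shs in E2; have {}E2 := E2 (leqnSn _) yS0 y1.
    rewrite /rdiffs foldr_cat -/(rdiffs _ _) -/(rdiffs _ _) -/B in E2.
    rewrite E1 in E2; move: (congr1 Num.norm E2).
    by rewrite !normrM !normrX normrN1 !expr1n !mul1r.
  pose w z := rdiffs hs (tpow k.+2) (z - y).
  have ab : y - \sum_(a <- hs) a <= y by rewrite Shs; have := jh0 k.+2; lra.
  (* The degree k + 2 is used up by [k] steps [h] and both steps [d]; the remaining two steps [h]
     cost a factor 2 each. *)
  have wB z : `|w z| <= 2 ^+ 2 * (h ^+ k * d * d).
    rewrite /w /hs -[k.+2]add2n nseqD -catA; apply: rdiffs_le_double => {}z.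
    have := @rdiffs_tpow_le _ (nseq k h ++ [:: d]) d z.
    rewrite -catA size_cat size_nseq addn1 all_cat all_nseq /= (ltW h0) (ltW d0) orbT.
    by rewrite big_cat big_nseq big_seq1 iter_mulr_1 => /(_ isT isT).
  have shiftc (u : R -> R) : continuous u -> continuous (fun z => u (z - y)).
    move=> cu z; apply: (@continuous_comp _ _ _ (shift (- y)) u); last exact: cu.
    by apply: cvgD => //; exact: cvg_cst.
  have cw : continuous w.
    by apply: shiftc; apply: continuous_rdiffs; exact: continuous_tpow.
  (* [w] is the derivative of a B-spline of one degree more, which still has compact support since k
     + 3 is less than the number of steps. *)
  have w_int : \int[lebesgue_measure]_(z in `]0, 1[) w z = 0.
    have dw (z : R) : is_derive z 1 (fun z => rdiffs hs (tpow k.+3) (z - y)) (w z).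
      have := @is_derive1_comp _ _ (shift (- y)) _ _ _
        (is_derive_rdiffs hs (is_derive_tpow k.+1) (z - y)) (is_derive_shift z (1 : R^o) (- y)).
      by rewrite mulr1.
    rewrite (integral_derivative01 dw cw) !rdiffs_tpow_eq0 ?subrr// ?shs//.
      by right; rewrite sub0r; move: yS0; lra.
    by left; rewrite subr_ge0 ltW.
  have w0 z : ~~ (y - \sum_(a <- hs) a <= z <= y) -> w z = 0.
    move=> zy; apply: rdiffs_tpow_eq0 => //; first by rewrite shs.
    have [yz|zy0] := leP y z; first by left; rewrite subr_ge0.
    right; have [yz|] := leP (y - \sum_(a <- hs) a) z; last by lra.
    by rewrite yz (ltW zy0) in zy.
  have g01 : exists K, forall z, z \in `]0, 1[ -> `|g z| <= K.
    exists (`|g 0| + C) => z; rewrite in_itv/= => /andP[z0 z1].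
    have H1 := gV 0 z (lexx _) (ltW z0) (ltW z1).
    have H2 := Vmono _ _ (ltW z0) (ltW z1) (lexx _).
    have := ler_normD (g 0) (g z - g 0); rewrite addrC subrK; lra.
  have gD z : y - \sum_(a <- hs) a <= z <= y ->
      `|g z - g (y - \sum_(a <- hs) a)| <= V ((s + k.+3)%:R * h) - V (s%:R * h).
    move=> /andP[az zb]; have z1 := ltW (le_lt_trans zb y1).
    have H1 := gV _ z (ltW yS0) az z1.
    have H2 := Vmono z _ (le_trans (ltW yS0) az) (le_trans zb yt) (jh1 _ skn).
    have H3 := Vmono _ _ (jh0 s) ysh (le_trans az z1).
    lra.
  have B0 : 0 <= 2 ^+ 2 * (h ^+ k * d * d) by rewrite !mulr_ge0 ?exprn_ge0 ?ltW.
  have mg := weak_derivativen_measurable fg.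
  apply: (le_trans (zero_mean_pairing_le mg g01 cw w_int yS0 ab y1 B0 wB w0 gD)).
  set DV := V _ - V _.
  have DV0 : 0 <= DV.
    by rewrite subr_ge0 Vmono// ?jh1// ler_wpM2r ?ler_nat ?leq_addr ?(ltW h0).
  have -> : d ^+ 2 * (4 * k.+3%:R * h ^+ k.+1) * DV =
    (k.+3%:R * h) * (DV * (2 ^+ 2 * (h ^+ k * d * d))) by rewrite [h ^+ k.+1]exprS; ring.
  rewrite ler_wpM2r ?mulr_ge0 ?exprn_ge0 ?(ltW h0) ?(ltW d0)//.
  by rewrite opprB addrC subrK Shs -(@natr1 R k.+2); lra.
have d2 : 0 < d ^+ 2 by rewrite exprn_gt0.
have step s : (s < n - k.+2)%N -> `|iter k.+2 D1 (fun i => f (x i)) s| <=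
    4 * k.+3%:R * h ^+ k.+1 * sdiff k.+3 (fun j => V (j%:R * h)) s + 2 ^+ k.+2 * eta.
  move=> sn; pose e j := f (x j) - (d ^+ 2)^-1 * G j.
  rewrite (@iter_sdiff_local _ _ _ _ (fun i => (d ^+ 2)^-1 * G i + e i)); last first.
    by move=> i _; rewrite /e addrC subrK.
  rewrite iter_sdiffD iter_sdiffZ; apply: (le_trans (ler_normD _ _)); apply: lerD.
    rewrite normrM ger0_norm ?invr_ge0 ?(ltW d2)// ler_pdivrMl//.
    by rewrite mulrA; exact: GV.
  apply: iter_sdiff_bound => i /andP[_ ik].
  have iN : (i < n)%N.
    by rewrite muln1 in ik; apply: leq_ltn_trans ik _; rewrite -addnS skE.
  rewrite -(ler_pM2l d2) -{1}(ger0_norm (ltW d2)) -normrM /e mulrBr.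
  by rewrite mulrA divff ?gt_eqF// mul1r distrC; exact: Gx.
apply: (@le_trans _ _ (n%:R ^+ k.+1 * \sum_(s < n - k.+2)
    (4 * k.+3%:R * h ^+ k.+1 * sdiff k.+3 (fun j => V (j%:R * h)) s + 2 ^+ k.+2 * eta))).
  by rewrite ler_wpM2l ?exprn_ge0 ?(ltW n0)//; apply: ler_sum => s _; exact: step.
rewrite big_split /= -mulr_sumr mulrDr; apply: lerD.
  have -> : n%:R ^+ k.+1 * (4 * k.+3%:R * h ^+ k.+1 *
      \sum_(s < n - k.+2) sdiff k.+3 (fun j => V (j%:R * h)) s) =
    4 * k.+3%:R * (\sum_(s < n - k.+2) sdiff k.+3 (fun j => V (j%:R * h)) s) *
      (n%:R * h) ^+ k.+1 by rewrite exprMn; ring.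
  rewrite nh expr1n mulr1 ler_wpM2l// ?mulr_ge0//.
  apply: sum_sdiff_le => i im.
  have iN : (i <= n)%N by move: im; rewrite nk ltnS.
  have := gV 0 _ (lexx _) (jh0 i) (jh1 i iN).
  have := gV _ 1 (jh0 i) (jh1 i iN) (lexx _).
  have := normr_ge0 (g 1 - g (i%:R * h)); have := normr_ge0 (g (i%:R * h) - g 0).
  rewrite V0 => *; apply/andP; split; lra.
rewrite sumr_const card_ord -[X in _ * X]mulr_natl.
apply: (@le_trans _ _ (n%:R ^+ k.+1 * (n%:R * (2 ^+ k.+2 * eta)))).
  rewrite ler_wpM2l ?exprn_ge0 ?(ltW n0)// ler_wpM2r ?ler_nat ?leq_subr//.
  by rewrite mulr_ge0 ?exprn_ge0 ?(ltW eta0).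
rewrite /eta le_eqVlt; apply/orP; left; apply/eqP; field.
by rewrite n0' !expf_neq0.
Qed.

(** * The two estimates *)

Lemma bv_class_differences {R : realType} k (C : R) (f : R -> R) :
  0 < C -> bv_class k C f ->
  exists2 K : R, 0 <= K & forall n, (k.+2 <= n)%N ->
    n%:R ^+ k * (\sum_(s < n - k.+1) `|iter k.+1 D1 (fun i => f (i.+1%:R / n%:R)) s|) <= K.
Proof.
move=> C0 [cf [g fg gC]]; case: k cf fg => [|k] cf fg; last first.
  exists (4 * k.+3%:R * (k.+3%:R * C) + 1).
    by rewrite addr_ge0// !mulr_ge0// ltW.
  move=> n kn; exact: weak_derivativen_differences (cf isT) fg gC kn.
(* For k = 0, [f] and [g] agree at every point of [0, 1], so the increments of [f] are bounded
   directly by those of the variation function. *)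
exists C; first exact: ltW.
move=> n n2; have [V [V0 V1 gV]] := variation_function gC.
have n0 : (0 : R) < n%:R by rewrite ltr0n (leq_trans _ n2).
pose x i : R := i.+1%:R / n%:R.
have x0 i : 0 <= x i by rewrite divr_ge0.
have x1 i : (i < n)%N -> x i <= 1 by move=> iN; rewrite ler_pdivrMr// mul1r ler_nat.
have xS i : x i <= x i.+1 by rewrite ler_wpM2r ?invr_ge0 ?(ltW n0)// ler_nat.
rewrite expr0 mul1r; apply: (@le_trans _ _ (\sum_(s < n - 1) sdiff 1 (fun i => V (x i)) s)).
  apply: ler_sum => s _ /=; have sn := ltn_ord s.
  have s1n : (s.+1 < n)%N by move: sn; rewrite ltn_subRL add1n.
  rewrite /sdiff !(fg (_.+1%:R / n%:R)) ?in_itv/= ?x0 ?x1 ?addn1 ?(ltnW s1n)//.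
  exact: (gV (x s) (x s.+1) (x0 s) (xS s) (x1 _ s1n)).
rewrite -[leRHS]mul1r; apply: sum_sdiff_le => i; rewrite subnK ?(ltnW n2)// => iN.
have := gV 0 _ (lexx _) (x0 i) (x1 i iN); have := gV _ 1 (x0 i) (x1 i iN) (lexx _).
have := normr_ge0 (g 1 - g (x i)); have := normr_ge0 (g (x i) - g 0).
by rewrite V0 => *; apply/andP; split; lra.
Qed.

Lemma iter_predn j n : iter j predn n = (n - j)%N.
Proof. by elim: j => [|j IH]; rewrite ?subn0// iterS IH subnS. Qed.

Lemma diff_mx_entry {R : realType} n j (b : 'cV[R]_n) (i : 'I_(iter j predn n)) :
  (diff_mx R n j *m b) i 0 = iter j D1 (extend_ord (fun l => b l 0)) i.
Proof.
elim: j i => [|j IH] i; first by rewrite /= mul1mx extend_ordE.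
rewrite [diff_mx _ _ _]/= -mulmxA mxE.
have i1 : (i.+1 < iter j predn n)%N.
  by case: i => i /=; case: (iter j predn n).
have i0 : (i < iter j predn n)%N by exact: ltnW.
transitivity (iter j D1 (extend_ord (b^~ 0)) (Ordinal i1) - iter j D1 (extend_ord (b^~ 0)) (Ordinal i0)); last first.
  by rewrite [RHS]/= /sdiff addn1.
rewrite -!IH.
under eq_bigr do rewrite mxE mulrBl.
rewrite sumrB; congr (_ - _).
  rewrite (bigD1 (Ordinal i1))//= eqxx mul1r big1 ?addr0// => l li.
  by rewrite (_ : _ == _ = false) ?mul0r//; apply/negbTE; apply: contra li => /eqP li; apply/eqP/val_inj.
rewrite (bigD1 (Ordinal i0))//= eqxx mul1r big1 ?addr0// => l li.
by rewrite (_ : _ == _ = false) ?mul0r//; apply/negbTE; apply: contra li => /eqP li; apply/eqP/val_inj.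
Qed.

Lemma tf_objectiveE {R : realType} k n (mu : R) (y b : 'cV[R]_n) :
  tf_objective k mu y b = 2^-1 * \sum_(i < n) (y i 0 - b i 0) ^+ 2 +
    mu / k`!%:R * (n%:R ^+ k *
      \sum_(s < n - k.+1) `|iter k.+1 D1 (extend_ord (fun l => b l 0)) s|).
Proof.
rewrite /tf_objective; congr (_ + _).
have -> : \sum_(i < iter k.+1 predn n) `|(diff_mx R n k.+1 *m b) i 0| =
    \sum_(s < n - k.+1) `|iter k.+1 D1 (extend_ord (fun l => b l 0)) s|.
  rewrite -iter_predn; apply: eq_bigr => i _.
  by rewrite (@diff_mx_entry _ _ k.+1).
ring.
Qed.

Lemma variation_triangle {R : realType} m j (u v : nat -> R) :
  \sum_(s < m) `|iter j D1 (fun i => u i - v i) s| <=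
  \sum_(s < m) `|iter j D1 u s| + \sum_(s < m) `|iter j D1 v s|.
Proof.
rewrite -big_split; apply: ler_sum => s _.
have -> : iter j D1 (fun i => u i - v i) s = iter j D1 u s - iter j D1 v s.
  have := iter_sdiffD j 1 u (fun i => - v i) s; rewrite iter_sdiffN => <-.
  by [].
exact: ler_normB.
Qed.

(** Here [a] and [b] are the deviations of the estimate and of its competitor from theta, and [p]
    and [q] their penalties. The noise term takes a quarter of |a - b|^2, the cross term with [b] an
    eighth, out of one half; the remaining eighth gives the factor 8. *)
Lemma penalized_basic_inequality {R : realType} n (e a b : nat -> R) (p q r F c : R) :
  2^-1 * (\sum_(i < n) (e i - a i) ^+ 2) + p <=
    2^-1 * (\sum_(i < n) (e i - b i) ^+ 2) + q ->
  \sum_(i < n) e i * (a i - b i) <= 4^-1 * (\sum_(i < n) (a i - b i) ^+ 2) + c + F ->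
  c <= p + r ->
  \sum_(i < n) (a i - b i) ^+ 2 <= 8 * (F + q + r) + 16 * \sum_(i < n) b i ^+ 2.
Proof.
move=> H1 H2 H3.
have E : \sum_(i < n) (e i - a i) ^+ 2 = \sum_(i < n) (e i - b i) ^+ 2
    - 2 * (\sum_(i < n) e i * (a i - b i)) + 2 * (\sum_(i < n) b i * (a i - b i))
    + \sum_(i < n) (a i - b i) ^+ 2.
  rewrite !mulr_sumr -sumrB -!big_split /=; apply: eq_bigr => i _; ring.
have Y : 0 <= 8^-1 * (\sum_(i < n) (a i - b i) ^+ 2) +
    \sum_(i < n) b i * (a i - b i) + 2 * \sum_(i < n) b i ^+ 2.
  rewrite !mulr_sumr -!big_split /=; apply: sumr_ge0 => i _.
  rewrite (_ : _ + _ = 2 * (4^-1 * (a i - b i) + b i) ^+ 2); last by field.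
  by rewrite mulr_ge0// sqr_ge0.
move: E H1 H2 Y.
set A := \sum_(i < n) (e i - a i) ^+ 2; set B := \sum_(i < n) (e i - b i) ^+ 2.
set V := \sum_(i < n) (a i - b i) ^+ 2; set W := \sum_(i < n) e i * (a i - b i).
set Z := \sum_(i < n) b i * (a i - b i); set Q := \sum_(i < n) b i ^+ 2.
lra.
Qed.

Lemma mean_le_markov d (T : measurableType d) (R : realType) (P : probability T R)
    (F : T -> R) (m a : R) : mean_le P F m -> 0 < a ->
  measurable [set w | a <= F w] /\ (P [set w | (a <= F w)%R] <= (m / a)%:E)%E.
Proof.
move=> [mF F0 Fm] a0.
have mE : measurable [set w | a <= F w].
  rewrite (_ : [set w | _] = F @^-1` `[a, +oo[).
    by rewrite -[_ @^-1` _]setTI; exact: mF.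
  by apply/seteqP; split => w /=; rewrite in_itv/= andbT.
split=> //; rewrite mulrC EFinM lee_pdivlMl//.
apply: le_trans Fm.
have <- : (\int[P]_w (a * \1_[set w | (a <= F w)%R] w)%:E = a%:E * P [set w | (a <= F w)%R])%E.
  under eq_integral do rewrite EFinM.
  rewrite ge0_integralZl_EFin ?(ltW a0)//; last first.
    exact/measurable_EFinP/measurable_indic.
  by rewrite integral_indic// setIT.
apply: ge0_le_integral => //.
- by move=> w _; rewrite lee_fin mulr_ge0 ?(ltW a0)// indicE.
- apply/measurable_EFinP; apply: measurable_funM => //; exact: measurable_indic.
- exact/measurable_EFinP.
- move=> w _; rewrite lee_fin indicE; case: (boolP (w \in _)) => [|_].
    by rewrite inE/= mulr1.
  by rewrite mulr0.
Qed.

Definition discrete_variation {R : realType} k n (v : nat -> R) : R :=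
  n%:R ^+ k * (\sum_(s < n - k.+1) `|iter k.+1 D1 v s|).

Lemma discrete_variation_ge0 {R : realType} k n (v : nat -> R) :
  0 <= discrete_variation k n v.
Proof. by rewrite mulr_ge0 ?exprn_ge0// sumr_ge0. Qed.

Lemma discrete_variationB {R : realType} k n (u v : nat -> R) :
  discrete_variation k n (fun i => u i - v i) <=
  discrete_variation k n u + discrete_variation k n v.
Proof. by rewrite -mulrDr ler_wpM2l ?exprn_ge0//; exact: variation_triangle. Qed.

Lemma eq_discrete_variation {R : realType} k n (u v : nat -> R) :
  (forall i, (i < n)%N -> u i = v i) ->
  discrete_variation k n u = discrete_variation k n v.
Proof.
move=> uv; congr (_ * _); apply: eq_bigr => s _; congr `|_|.
have := ltn_ord s; rewrite ltn_subRL => sn.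
apply: iter_sdiff_local => i /andP[_ is_]; apply: uv; apply: leq_ltn_trans is_ _.
by rewrite muln1 addnC.
Qed.

Lemma trend_filter_error {R : realType} k n (mu c F : R) (theta : nat -> R)
    (e : 'I_n -> R) (y b : 'cV[R]_n) :
  0 <= mu -> (forall i : 'I_n, y i 0 = theta i + e i) ->
  (forall v : nat -> R, \sum_(i < n) e i * v i <=
    4^-1 * (\sum_(i < n) v i ^+ 2) + c * discrete_variation k n v + F) ->
  c <= mu / k`!%:R -> is_trend_filter k mu y b ->
  \sum_(i < n) (b i 0 - theta i) ^+ 2 <=
    8 * (F + 2 * (mu / k`!%:R * discrete_variation k n theta)).
Proof.
move=> mu0 ye noise cmu /(_ (\col_i theta i)).
rewrite !tf_objectiveE -!/(discrete_variation k n _) => opt.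
have m0 : 0 <= mu / k`!%:R by rewrite divr_ge0.
pose B := extend_ord (fun l => b l 0).
rewrite (@eq_discrete_variation _ _ _ (extend_ord (fun l => (\col_i theta i) l 0)) theta) in opt; last first.
  by move=> i ni; rewrite -[i]/(nat_of_ord (Ordinal ni)) extend_ordE mxE.
pose mJ u := mu / k`!%:R * discrete_variation k n u.
pose a i := B i - theta i.
have -> : \sum_(i < n) (b i 0 - theta i) ^+ 2 = \sum_(i < n) (a i - 0) ^+ 2.
  by apply: eq_bigr => i _; rewrite subr0 /a /B extend_ordE.
have : \sum_(i < n) (a i - 0) ^+ 2 <=
    8 * (F + mJ theta + mJ theta) + 16 * \sum_(i < n) (0 : R) ^+ 2.
  apply: (@penalized_basic_inequality R n (extend_ord e) a (fun=> 0) (mJ B) _ _ _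
    (c * discrete_variation k n a)).
  - move: opt; congr (2^-1 * _ + _ <= 2^-1 * _ + _); apply: eq_bigr => i _.
      by rewrite ye /a /B !extend_ordE; congr (_ ^+ 2); ring.
    by rewrite ye mxE extend_ordE; congr (_ ^+ 2); ring.
  - have -> : \sum_(i < n) extend_ord e i * (a i - 0) = \sum_(i < n) e i * a i.
      by apply: eq_bigr => i _; rewrite extend_ordE subr0.
    have -> : \sum_(i < n) (a i - 0) ^+ 2 = \sum_(i < n) a i ^+ 2.
      by apply: eq_bigr => i _; rewrite subr0.
    exact: noise.
  - apply: (@le_trans _ _ (mu / k`!%:R * discrete_variation k n a)).
      exact: ler_wpM2r (discrete_variation_ge0 _ _ _) _ _ cmu.
    by rewrite -mulrDr ler_wpM2l// discrete_variationB.
rewrite [X in 16 * X]big1 => [|i _]; last by rewrite expr0n.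
rewrite /mJ; lra.
Qed.

Lemma spline_error {R : realType} k n (lambda c W F : R) (theta : nat -> R)
    (e : 'I_n -> R) (y : 'cV[R]_n) (f : R -> R) :
  (k.+2 <= n)%N -> 0 < lambda -> 0 <= c ->
  (forall f g, spline_with_derivative k (knots R k n) f g ->
    ((discrete_variation k n (fun i => f (i.+1%:R / n%:R)))%:E <=
      W%:E * total_variation 0 1 g)%E) ->
  (forall i : 'I_n, y i 0 = theta i + e i) ->
  (forall v : nat -> R, \sum_(i < n) e i * v i <=
    4^-1 * (\sum_(i < n) v i ^+ 2) + c * discrete_variation k n v + F) ->
  c * W <= lambda -> 0 <= W -> is_adaptive_spline k lambda y f ->
  \sum_(i < n) (f (design R i) - theta i) ^+ 2 <=
    16 * (F + 2 * (lambda * discrete_variation k n theta)) +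
    34 * ((k * k)%:R * discrete_variation k n theta) ^+ 2.
Proof.
move=> kn l0 c0 WJ ye noise cW W0 [g fg opt].
have [fs [gs [fgs near_theta TVs]]] := spline_approximation theta kn.
rewrite -!/(discrete_variation k n _) in near_theta TVs.
set J := discrete_variation k n theta in near_theta TVs *.
have J0 : 0 <= J := discrete_variation_ge0 k n theta.
have n0 : (0 : R) < n%:R by rewrite ltr0n (leq_trans _ kn).
have le01 : (0 : R) <= 1 := ler01.
have := opt _ _ fgs; rewrite /spline_objective => optE.
have TVs0 : (0 <= total_variation 0 1 gs)%E := total_variation_ge0 gs le01.
(* Otherwise the objective of the minimizer would be infinite, as lambda > 0, while that of the
   approximating spline is finite. *)
have [V V0 gV] : exists2 V : R, 0 <= V & total_variation 0 1 g = V%:E.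
  have TV0 : (0 <= total_variation 0 1 g)%E := total_variation_ge0 g le01.
  move: TV0 optE; case: (total_variation 0 1 g) => [V V0 _|_|//].
    by exists V.
  rewrite gt0_muley ?lte_fin//.
  move: TVs TVs0; case: (total_variation 0 1 gs) => [s _ _||]//.
have fJ := WJ _ _ fg; have fsJ := WJ _ _ fgs.
have {optE} opt' : 2^-1 * (\sum_(i < n) (y i 0 - f (design R i)) ^+ 2) + lambda * V <=
    2^-1 * (\sum_(i < n) (y i 0 - fs (design R i)) ^+ 2) + lambda * J.
  rewrite -lee_fin; move: optE; rewrite gV -!EFinM -!EFinD => /le_trans; apply.
  rewrite EFinD leeD2l// EFinM lee_pmul2l//.
rewrite gV -EFinM lee_fin in fJ.
have {}fsJ : discrete_variation k n (fun i => fs (i.+1%:R / n%:R)) <= W * J.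
  by rewrite -lee_fin; apply: (le_trans fsJ); rewrite EFinM lee_wpmul2l ?lee_fin.
pose x i : R := i.+1%:R / n%:R.
pose a i := f (x i) - theta i; pose b i := fs (x i) - theta i.
have bJ : \sum_(i < n) b i ^+ 2 <= ((k * k)%:R * J) ^+ 2.
  have T0 : 0 <= (k * k)%:R * J / n%:R by rewrite divr_ge0// mulr_ge0.
  apply: (@le_trans _ _ (\sum_(i < n) ((k * k)%:R * J / n%:R) ^+ 2)).
    apply: ler_sum => i _; rewrite -ler_sqrt ?exprn_ge0// !sqrtr_sqr.
    by rewrite (ger0_norm T0) near_theta.
  rewrite sumr_const card_ord -[leLHS]mulr_natr expr_div_n -mulrA ler_piMr ?sqr_ge0//.
  rewrite expr2 invfM -mulrA mulVf ?gt_eqF// mulr1 invf_le1// ler1n.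
  exact: leq_trans kn.
have ab : \sum_(i < n) (a i - b i) ^+ 2 <=
    8 * (F + lambda * J + lambda * J) + 16 * \sum_(i < n) b i ^+ 2.
  apply: (@penalized_basic_inequality R n (extend_ord e) a b (lambda * V) _ _ _
    (c * discrete_variation k n (fun i => f (x i) - fs (x i)))).
  - move: opt'.
    have E (h : R -> R) : \sum_(i < n) (y i 0 - h (design R i)) ^+ 2 =
        \sum_(i < n) (extend_ord e i - (h (x i) - theta i)) ^+ 2.
      by apply: eq_bigr => i _; rewrite ye extend_ordE /design /x; congr (_ ^+ 2); ring.
    by rewrite !E.
  - have := noise (fun i => a i - b i).
    rewrite (@eq_discrete_variation _ _ _ _ (fun i => f (x i) - fs (x i))); last first.
      by move=> i _; rewrite /a /b; ring.
    by under [X in X <= _ -> _]eq_bigr do rewrite -[e _]extend_ordE.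
  - apply: (@le_trans _ _ (c * (W * V + W * J))).
      rewrite ler_wpM2l//; apply: le_trans (discrete_variationB _ _ _ _) _.
      exact: lerD.
    rewrite -mulrDr mulrA -mulrDr ler_wpM2r// addr_ge0//.
have -> : \sum_(i < n) (f (design R i) - theta i) ^+ 2 = \sum_(i < n) a i ^+ 2 by [].
(* The passage from [a - b] back to [a] doubles the bound and yields 34 = 2 * 16 + 2. *)
have : \sum_(i < n) a i ^+ 2 <=
    2 * (\sum_(i < n) (a i - b i) ^+ 2) + 2 * \sum_(i < n) b i ^+ 2.
  rewrite !mulr_sumr -big_split; apply: ler_sum => i _ /=.
  have := sqr_ge0 (a i - 2 * b i); nra.
lra.
Qed.


Theorem theorem1 (R : realType) (k : nat) (C delta M sigma : R)
  (C_gt0 : 0 < C) (delta_gt0 : 0 < delta) (M_gt0 : 0 < M) (sigma_gt0 : 0 < sigma)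
  (d : nat -> measure_display) (Omega : forall n, measurableType (d n))
  (P : forall n, probability (Omega n) R)
  (f0 : R -> R) (f0_class : bv_class k C f0)
  (eps : forall n, 'I_n -> {RV (P n) >-> R})
  (eps_indep : forall n, mutually_independent (eps n))
  (eps_ident : forall n, identically_distributed (eps n))
  (eps_mean : forall n (i : 'I_n), ('E_(P n)[eps n i] = 0)%E)
  (eps_tail : forall n (i : 'I_n) (t : R), 0 < t ->
    (P n [set w | (t < `|eps n i w|)%R] <=
       (M * expR (- (t ^+ 2 / (2 * sigma ^+ 2))))%:E)%E)
  (y : forall n, Omega n -> 'cV[R]_n)
  (y_model : forall n w (i : 'I_n), y n w i 0 = f0 (design R i) + eps n i w)
  (lambda : nat -> R) (lambda_ge0 : forall n, 0 <= lambda n)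
  (lambda_Theta :
    lambda =Theta_\oo (fun n => n%:R `^ (1 / (2 * k + 3)%:R) : R))
  (fhat : forall n, Omega n -> R -> R)
  (fhat_argmin : forall n w, (k.+2 <= n)%N ->
    is_adaptive_spline k (lambda n) (y n w) (fhat n w))
  (betahat : forall n, Omega n -> 'cV[R]_n)
  (betahat_argmin : forall n w, (k.+2 <= n)%N ->
    is_trend_filter k ((1 + delta) * lambda n) (y n w) (betahat n w)) :
  bigO_prob P
    (fun n w => n%:R^-1 *
       \sum_(i < n) (betahat n w i 0 - fhat n w (design R i)) ^+ 2)
    (fun n => n%:R `^ (- ((2 * k + 2)%:R / (2 * k + 3)%:R))).
Proof.
have [k1 [k2 [k1_gt0 k2_gt0 lambda_near]]] : exists k1 k2 : R, [/\ 0 < k1, 0 < k2 &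
    \forall n \near \oo, k1 * n%:R `^ (1 / (2 * k + 3)%:R) <= lambda n <=
      k2 * n%:R `^ (1 / (2 * k + 3)%:R)].
  move: lambda_Theta; rewrite eqThetaE qualifE => /asboolP[[k1 k2]] /= /andP[k1_gt0 k2_gt0] H.
  exists k1, k2; split=> //; apply: filterS H => n [].
  by rewrite !ger0_norm ?powR_ge0// => -> ->.
pose theta n i : R := f0 (i.+1%:R / n%:R).
have [J0 J0_ge0 theta_J] : exists2 J0 : R, 0 <= J0 & forall n, (k.+2 <= n)%N ->
  discrete_variation k n (theta n) <= J0 := bv_class_differences C_gt0 f0_class.
have [W W_gt0 spline_W] := spline_variation_bound R k.
have kf : 0 < k`!%:R :> R by rewrite ltr0n fact_gt0.
have kf1 : 1 <= k`!%:R :> R by rewrite ler1n fact_gt0.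
have W1 : 0 < 1 + W by rewrite addr_gt0.
(* Small enough for both penalties to absorb the variation term of the noise: it gives c L <= lambda
   / k! for trend filtering and c L W <= lambda for splines. *)
pose c : R := k1 / (k`!%:R * (1 + W)).
have c_gt0 : 0 < c by rewrite divr_gt0// mulr_gt0.
have [K0 K0_gt0 noise] := noise_bound k c_gt0 M_gt0 sigma_gt0.
move=> e e_gt0.
(* Twice the sum of both error bounds, in units of L: 48 = 2 * 8 + 2 * 16 for the noise, 32 and 64
   for the two penalties, 68 = 2 * 34 for the spline approximation. *)
exists (48 * (K0 / e) + 32 * ((1 + delta) * k2 / k`!%:R * J0) + 64 * (k2 * J0)
  + 68 * ((k * k)%:R * J0) ^+ 2).
near=> n.
have kn : (k.+2 <= n)%N by near: n; exact: nbhs_infty_ge.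
have /andP[k1l lk2] : k1 * n%:R `^ (1 / (2 * k + 3)%:R) <= lambda n <=
  k2 * n%:R `^ (1 / (2 * k + 3)%:R) by near: n.
have n0 : (0 : R) < n%:R by rewrite ltr0n (leq_trans _ kn).
have n1 : (1 : R) <= n%:R by rewrite ler1n (leq_trans _ kn).
set L : R := n%:R `^ (1 / (2 * k + 3)%:R) in k1l lk2.
have k3 : (2 * k + 3)%:R != 0 :> R by rewrite pnatr_eq0 addnS.
have L1 : 1 <= L.
  by rewrite -(powRr0 n%:R) /L ler_powR// divr_ge0.
have L_gt0 : 0 < L by exact: lt_le_trans L1.
have Ln : L ^+ (2 * k + 3) = n%:R.
  by rewrite -powR_mulrn ?(ltW L_gt0)// -powRrM mul1r mulVf// powRr1// ltW.
have nB : n%:R * n%:R `^ (- ((2 * k + 2)%:R / (2 * k + 3)%:R)) = L.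
  rewrite -{1}(powRr1 (ltW n0)) -powRD; last by rewrite (gt_eqF n0) implybT.
  congr (_ `^ _); rewrite -{1}(mulfV k3) -mulrBl; congr (_ / _).
  by rewrite -natrB ?leq_add2l// subnDl.
have [F F_mean noiseF] := noise _ _ (P n) n (eps n) L (eps_indep n) (eps_mean n) (eps_tail n) L1 Ln.
have a_gt0 : 0 < K0 * L / e by rewrite divr_gt0// mulr_gt0.
have [mE PE] := mean_le_markov F_mean a_gt0.
exists [set w | K0 * L / e <= F w].
  split=> //; apply: le_trans PE _; rewrite lee_fin invf_div mulrCA mulfV ?mulr1//.
  by rewrite gt_eqF// mulr_gt0.
(* Outside the exceptional event of Markov's inequality, [F w] is below K0 L / e, and the rest of
   the argument is deterministic. *)
move=> w KA /=; rewrite leNgt; apply/negP => Fw; move: KA; apply/negP; rewrite -leNgt.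
have lambda_gt0 : 0 < lambda n by apply: lt_le_trans k1l; rewrite mulr_gt0.
have y_theta (i : 'I_n) : y n w i 0 = theta n i + eps n i w by exact: y_model.
have {}noiseF (v : nat -> R) : \sum_(i < n) eps n i w * v i <=
    4^-1 * (\sum_(i < n) v i ^+ 2) + (c * L) * discrete_variation k n v + F w.
  by rewrite /discrete_variation mulrA; exact: noiseF.
set S := \sum_(i < n) _.
have Sle : S <= 2 * (\sum_(i < n) (betahat n w i 0 - theta n i) ^+ 2) +
    2 * (\sum_(i < n) (fhat n w (design R i) - theta n i) ^+ 2).
  rewrite !mulr_sumr -big_split; apply: ler_sum => i _ /=.
  have := sqr_ge0 (betahat n w i 0 - theta n i + (fhat n w (design R i) - theta n i)); nra.
have cL0 : 0 <= c * L by rewrite mulr_ge0 ?ltW.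
have d1 : 0 < 1 + delta by rewrite addr_gt0.
have cLE : c * L * (k`!%:R * (1 + W)) = k1 * L.
  by rewrite /c; field; rewrite gt_eqF// gt_eqF.
have cL1 : c * L <= lambda n / k`!%:R.
  rewrite ler_pdivlMr//; apply: le_trans k1l; rewrite -cLE ler_wpM2l//.
  by apply: ler_peMr; rewrite ?lerDl ltW.
have cL2 : c * L * W <= lambda n.
  apply: le_trans k1l; rewrite -cLE ler_wpM2l//.
  apply: (@le_trans _ _ (1 + W)); first by rewrite lerDr.
  by apply: ler_peMl => //; exact: ltW.
have cL3 : c * L <= (1 + delta) * lambda n / k`!%:R.
  apply: (le_trans cL1); rewrite ler_wpM2r ?invr_ge0 ?(ltW kf)//.
  by apply: ler_peMl => //; rewrite lerDl ltW.
have tf := trend_filter_error (mulr_ge0 (ltW d1) (lambda_ge0 n)) y_theta noiseF cL3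
  (betahat_argmin n w kn).
have sp := spline_error kn lambda_gt0 cL0 (fun f g => spline_W n f g kn) y_theta noiseF cL2
  (ltW W_gt0) (fhat_argmin n w kn).
have J_ge0 : 0 <= discrete_variation k n (theta n) := discrete_variation_ge0 _ _ _.
move: tf sp (theta_J n kn) J_ge0; set J := discrete_variation k n (theta n) => tf sp JJ0 J_ge0.
have b1 : (1 + delta) * lambda n / k`!%:R * J <= (1 + delta) * k2 / k`!%:R * J0 * L.
  rewrite [leRHS](_ : _ = (1 + delta) * (k2 * L) / k`!%:R * J0); last by ring.
  apply: ler_pM => //; first by rewrite divr_ge0// mulr_ge0 ?(ltW d1).
  apply: ler_wpM2r; first by rewrite invr_ge0 ltW.
  by apply: ler_wpM2l => //; exact: ltW.
have b2 : lambda n * J <= k2 * J0 * L.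
  by rewrite [leRHS](_ : _ = k2 * L * J0); [exact: ler_pM | ring].
have b3 : ((k * k)%:R * J) ^+ 2 <= ((k * k)%:R * J0) ^+ 2 * L.
  apply: (@le_trans _ _ (((k * k)%:R * J0) ^+ 2)); last by rewrite ler_peMr ?sqr_ge0.
  have JJ : (k * k)%:R * J <= (k * k)%:R * J0 by exact: ler_wpM2l.
  by apply: lerXn2r => //; rewrite nnegrE mulr_ge0.
have b4 : F w <= K0 / e * L by rewrite mulrAC ltW.
have SE : n%:R^-1 * S / n%:R `^ (- ((2 * k + 2)%:R / (2 * k + 3)%:R)) = S / L.
  by rewrite -nB invfM; ring.
rewrite SE ger0_norm; last first.
  by rewrite divr_ge0 ?(ltW L_gt0)// sumr_ge0// => i _; exact: sqr_ge0.
rewrite (ler_pdivrMr _ _ L_gt0); apply: (le_trans Sle).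
move: tf sp b1 b2 b3 b4; clear; lra.
Unshelve. all: by end_near. Qed.
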